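(* Let $\Pi_1$ and $\Pi_2$ be polytopal (respectively, conical) complexes. Then the set $\operatorname{Hom}(\Pi_1,\Pi_2)$ of affine maps $\Pi_1\to\Pi_2$ carries a polytopal (respectively, conical) complex structure, which can be defined algorithmically from the data of $\Pi_1$ and $\Pi_2$.
   Context: A polyhedral complex consists of a finite family $\Pi$ of nonempty sets (faces), polyhedra $P_p$ ($p\in\Pi$) and bijections $\pi_p:P_p\to p$ such that: (a) for each face $F$ of $P_p$ there is $f\in\Pi$ with $\pi_p(F)=f$; (b) for all $p,q\in\Pi$ there are faces $F$ of $P_p$ and $G$ of $P_q$ with $p\cap q=\pi_p(F)=\pi_q(G)$ and $\pi_q^{-1}\circ\pi_p|_F:F\to G$ an affine isomorphism. It is polytopal (resp. conical) if all $P_p$ are convex polytopes (resp. pointed finite polyhedral cones). $|\Pi|=\bigcup_p p$. An affine map $\Pi_1\to\Pi_2$ is a map $f:|\Pi_1|\to|\Pi_2|$ such that for every $p\in\Pi_1$ there is $q\in\Pi_2$ with $f(p)\subset q$ and $\pi_q^{-1}\circ f\circ\pi_p:P_p\to P_q$ affine (linear in the conical case). $\operatorname{Hom}(\Pi_1,\Pi_2)$ denotes the set of these maps. *)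

(* Defs.v *)
From mathcomp Require Import all_boot all_order all_algebra.
From mathcomp Require Import all_classical all_reals all_analysis.

Set Implicit Arguments.
Unset Strict Implicit.
Unset Printing Implicit Defensive.

Import Order.TTheory GRing.Theory Num.Theory.
Import numFieldNormedType.Exports.

Local Open Scope classical_set_scope.
Local Open Scope ring_scope.

Definition dot (R : realType) (d : nat) (c x : 'rV[R]_d) : R :=
  \sum_(j < d) c 0 j * x 0 j.

Definition is_polyhedron (R : realType) (d : nat) (P : set 'rV[R]_d) : Prop :=
  exists hs : seq ('rV[R]_d * R),
    P = [set x | forall h, h \in hs -> dot h.1 x <= h.2].

Definition is_polytope (R : realType) (d : nat) (P : set 'rV[R]_d) : Prop :=
  is_polyhedron P /\ bounded_set P.

Definition is_pointed_cone (R : realType) (d : nat) (P : set 'rV[R]_d) : Prop :=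
  (exists cs : seq 'rV[R]_d, P = [set x | forall c, c \in cs -> dot c x <= 0])
  /\ (forall x, P x -> P (- x) -> x = 0).

Definition supports (R : realType) (d : nat)
    (c : 'rV[R]_d) (b : R) (P : set 'rV[R]_d) : Prop :=
  forall x, P x -> dot c x <= b.

Definition exposed (R : realType) (d : nat)
    (c : 'rV[R]_d) (b : R) (P : set 'rV[R]_d) : set 'rV[R]_d :=
  [set x | P x /\ dot c x = b].

(* The improper faces are included: (c, b) = (0, 0) gives P itself and
   (c, b) = (0, 1) gives the empty face. *)
Definition is_face (R : realType) (d : nat) (P F : set 'rV[R]_d) : Prop :=
  exists (c : 'rV[R]_d) (b : R), supports c b P /\ F = exposed c b P.

Definition affine_on (R : realType) (d e : nat)
    (F : set 'rV[R]_d) (g : 'rV[R]_d -> 'rV[R]_e) : Prop :=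
  exists (M : 'M[R]_(d, e)) (t : 'rV[R]_e), forall x, F x -> g x = x *m M + t.

Definition linear_on (R : realType) (d e : nat)
    (F : set 'rV[R]_d) (g : 'rV[R]_d -> 'rV[R]_e) : Prop :=
  exists M : 'M[R]_(d, e), forall x, F x -> g x = x *m M.

Definition affine_iso (R : realType) (d e : nat)
    (F : set 'rV[R]_d) (G : set 'rV[R]_e) (g : 'rV[R]_d -> 'rV[R]_e) : Prop :=
  [/\ set_bij F G g, affine_on F g &
      exists h : 'rV[R]_e -> 'rV[R]_d,
        affine_on G h /\ (forall x, F x -> h (g x) = x)].

(* The finite family of faces is enumerated without repetition by 'I_n.  The
   chart pi_i is a total function, but only its values on P_i matter. *)
Record polyhedral_complex (R : realType) (X : Type) := PolyhedralComplex {
  nfaces : nat;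
  face : 'I_nfaces -> set X;
  adim : 'I_nfaces -> nat;
  cell : forall i, set 'rV[R]_(adim i);
  chart : forall i, 'rV[R]_(adim i) -> X;
  face_inj : injective face;
  face_nonempty : forall i, face i !=set0;
  cell_polyhedron : forall i, is_polyhedron (@cell i);
  chart_bij : forall i, set_bij (@cell i) (face i) (@chart i);
  face_closed : forall i (F : set 'rV[R]_(adim i)),
    is_face (@cell i) F -> F !=set0 -> exists j, @chart i @` F = face j;
  face_meet : forall i j,
    exists (F : set 'rV[R]_(adim i)) (G : set 'rV[R]_(adim j)),
      [/\ is_face (@cell i) F, is_face (@cell j) G,
          face i `&` face j = @chart i @` F,
          face i `&` face j = @chart j @` G &
          exists g, affine_iso F G g /\
                    (forall x, F x -> @chart j (g x) = @chart i x)]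
}.
Arguments face {R X} p i _.
Arguments adim {R X} p i.
Arguments cell {R X} p i _.
Arguments chart {R X} p i _.

Definition carrier (R : realType) (X : Type) (Pi : polyhedral_complex R X) : set X :=
  \bigcup_i face Pi i.

Inductive complex_kind := Polytopal | Conical.

Definition of_kind (k : complex_kind) (R : realType) (X : Type)
    (Pi : polyhedral_complex R X) : Prop :=
  match k with
  | Polytopal => forall i, is_polytope (cell Pi i)
  | Conical => forall i, is_pointed_cone (cell Pi i)
  end.

Definition morphism_on (k : complex_kind) (R : realType) (d e : nat)
    (F : set 'rV[R]_d) (g : 'rV[R]_d -> 'rV[R]_e) : Prop :=
  match k with
  | Polytopal => affine_on F g
  | Conical => linear_on F g
  end.

Definition affine_maps (k : complex_kind) (R : realType) (X1 X2 : Type)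
    (Pi1 : polyhedral_complex R X1) (Pi2 : polyhedral_complex R X2) :
    set (carrier Pi1 -> carrier Pi2) :=
  [set f | forall i, exists j,
     (forall y : carrier Pi1, face Pi1 i (val y) -> face Pi2 j (val (f y))) /\
     (exists g, morphism_on k (cell Pi1 i) g /\
        forall u (y : carrier Pi1), cell Pi1 i u -> val y = chart Pi1 i u ->
          cell Pi2 j (g u) /\ chart Pi2 j (g u) = val (f y))].
Arguments affine_maps k {R X1 X2} Pi1 Pi2 _.

(* The basic instructions form a simply typed lambda-calculus with primitive
   recursion on nat and seq, exact field operations and comparison of scalars;
   an algorithm is a machine that iterates such an instruction until it halts.
   Hence algorithms compute all (partial) functions computable in the
   real-number (Blum-Shub-Smale) model without real constants.  Programs are
   closed first-order syntax (typed de Bruijn terms) independent of R, so no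
   non-effective function can be hidden in them. *)

Inductive ty :=
  | Bool | Nat | Scal
  | Prod of ty & ty
  | List of ty
  | Arr of ty & ty.

Fixpoint den (R : realType) (t : ty) : Type :=
  match t with
  | Bool => bool
  | Nat => nat
  | Scal => R
  | Prod a b => (den R a * den R b)%type
  | List a => seq (den R a)
  | Arr a b => den R a -> den R b
  end.

Inductive var : seq ty -> ty -> Type :=
  | Var0 : forall G a, var (a :: G) a
  | VarS : forall G a b, var G a -> var (b :: G) a.

Inductive term : seq ty -> ty -> Type :=
  | TVar : forall G a, var G a -> term G a
  | TLam : forall G a b, term (a :: G) b -> term G (Arr a b)
  | TApp : forall G a b, term G (Arr a b) -> term G a -> term G b
  | TTrue : forall G, term G Bool
  | TFalse : forall G, term G Bool
  | TIf : forall G a, term G Bool -> term G a -> term G a -> term G a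
  | TO : forall G, term G Nat
  | TS : forall G, term G Nat -> term G Nat
  | TRec : forall G a, term G a -> term G (Arr Nat (Arr a a)) ->
      term G Nat -> term G a
  | TPair : forall G a b, term G a -> term G b -> term G (Prod a b)
  | TFst : forall G a b, term G (Prod a b) -> term G a
  | TSnd : forall G a b, term G (Prod a b) -> term G b
  | TNil : forall G a, term G (List a)
  | TCons : forall G a, term G a -> term G (List a) -> term G (List a)
  | TFold : forall G a b, term G (Arr a (Arr b b)) -> term G b ->
      term G (List a) -> term G b
  | TZero : forall G, term G Scal
  | TOne : forall G, term G Scal
  | TAdd : forall G, term G Scal -> term G Scal -> term G Scal
  | TOpp : forall G, term G Scal -> term G Scal
  | TMul : forall G, term G Scal -> term G Scal -> term G Scal
  | TInv : forall G, term G Scal -> term G Scal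
  | TLe : forall G, term G Scal -> term G Scal -> term G Bool.

Fixpoint env (R : realType) (G : seq ty) : Type :=
  if G is a :: G' then (den R a * env R G')%type else unit.

Fixpoint lookup (R : realType) (G : seq ty) (a : ty) (v : var G a) :
    env R G -> den R a :=
  match v in var G a return env R G -> den R a with
  | Var0 _ _ => fun r => r.1
  | VarS _ _ _ v' => fun r => lookup v' r.2
  end.

Fixpoint eval_term (R : realType) (G : seq ty) (a : ty) (e : term G a) :
    env R G -> den R a :=
  match e in term G a return env R G -> den R a with
  | TVar _ _ v => fun r => lookup v r
  | TLam _ _ _ e1 => fun r x => eval_term e1 (x, r)
  | TApp _ _ _ e1 e2 => fun r => (eval_term e1 r) (eval_term e2 r)
  | TTrue _ => fun _ => true
  | TFalse _ => fun _ => false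
  | TIf _ _ e1 e2 e3 => fun r => if eval_term e1 r then eval_term e2 r else eval_term e3 r
  | TO _ => fun _ => 0%N
  | TS _ e1 => fun r => (eval_term e1 r).+1
  | TRec _ _ e1 e2 e3 => fun r => nat_rect _ (eval_term e1 r) (eval_term e2 r) (eval_term e3 r)
  | TPair _ _ _ e1 e2 => fun r => (eval_term e1 r, eval_term e2 r)
  | TFst _ _ _ e1 => fun r => (eval_term e1 r).1
  | TSnd _ _ _ e1 => fun r => (eval_term e1 r).2
  | TNil _ _ => fun _ => [::]
  | TCons _ _ e1 e2 => fun r => eval_term e1 r :: eval_term e2 r
  | TFold _ _ _ e1 e2 e3 => fun r => foldr (eval_term e1 r) (eval_term e2 r) (eval_term e3 r)
  | TZero _ => fun _ => (0 : R)
  | TOne _ => fun _ => (1 : R)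
  | TAdd _ e1 e2 => fun r => (eval_term e1 r : R) + (eval_term e2 r : R)
  | TOpp _ e1 => fun r => - (eval_term e1 r : R)
  | TMul _ e1 e2 => fun r => (eval_term e1 r : R) * (eval_term e2 r : R)
  | TInv _ e1 => fun r => (eval_term e1 r : R)^-1
  | TLe _ e1 e2 => fun r => (eval_term e1 r : R) <= (eval_term e2 r : R)
  end.

Record algorithm (a b : ty) := Algorithm {
  state : ty;
  start : term [::] (Arr a state);
  halted : term [::] (Arr state Bool);
  step : term [::] (Arr state state);
  result : term [::] (Arr state b)
}.

Definition computes (a b : ty) (A : algorithm a b) (R : realType)
    (x : den R a) (y : den R b) : Prop :=
  let st n := iter n (eval_term (step A) tt) (eval_term (start A) tt x) in
  exists n : nat,
    [/\ eval_term (halted A) tt (st n) = true,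
        (forall m, (m < n)%N -> eval_term (halted A) tt (st m) = false) &
        y = eval_term (result A) tt (st n)].

(* Lists stand for vectors and lists of rows for matrices; the ambient
   dimensions are known from the context, missing entries count as 0 and
   superfluous ones are ignored. *)
Definition vec_of (R : realType) (d : nat) (s : seq R) : 'rV[R]_d :=
  \row_(j < d) nth 0 s j.

Definition mx_of (R : realType) (d e : nat) (s : seq (seq R)) : 'M[R]_(d, e) :=
  \matrix_(i < d, j < e) nth 0 (nth [::] s i) j.

Definition vecT := List Scal.
Definition halfspaceT := Prod vecT Scal.
Definition affineT := Prod (List vecT) vecT.
(* Ambient dimension and inequalities. *)
Definition polyhedronT := Prod Nat (List halfspaceT).
(* For a pair (i, j): supporting functionals of the faces F of P_i and G of P_j
   over the intersection, and an affine map extending pi_j^-1 \o pi_i on F. *)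
Definition gluingT := Prod (Prod halfspaceT halfspaceT) affineT.
Definition complexT := Prod (List polyhedronT) (List (List gluingT)).

Definition encodes (R : realType) (X : Type) (Pi : polyhedral_complex R X)
    (c : den R complexT) : Prop :=
  [/\ size c.1 = nfaces Pi,
      (forall i : 'I_(nfaces Pi),
         let P := nth (0%N, [::]) c.1 i in
         P.1 = adim Pi i /\
         cell Pi i = [set x | all (fun h => dot (vec_of _ h.1) x <= h.2) P.2]) &
      (forall i j : 'I_(nfaces Pi),
         let: (hF, hG, (m, t)) :=
           nth (([::], 0), ([::], 0), ([::], [::])) (nth [::] c.2 i) j in
         let F := exposed (vec_of (adim Pi i) hF.1) hF.2 (cell Pi i) in
         let G := exposed (vec_of (adim Pi j) hG.1) hG.2 (cell Pi j) in
         [/\ supports (vec_of (adim Pi i) hF.1) hF.2 (cell Pi i),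
             supports (vec_of (adim Pi j) hG.1) hG.2 (cell Pi j),
             face Pi i `&` face Pi j = chart Pi i @` F,
             face Pi i `&` face Pi j = chart Pi j @` G &
             forall x, F x ->
               let x' := x *m mx_of _ _ m + vec_of _ t in
               G x' /\ chart Pi j x' = chart Pi i x])].

(* Data of a complex of maps: besides the complex itself, its charts pi_h are
   described by giving, for each face h and each face i of the source, a face j
   of the target with f(i) inside j for all f in h, and affine maps
   (m_0, t_0), ..., (m_D, t_D), D the ambient dimension of P_h, such that the
   coordinate expression of f = pi_h(x) from P_i to P_j is u |-> u m + t with
   (m, t) = (m_0, t_0) + sum_k x_k (m_k, t_k). *)
Definition homT := Prod complexT (List (List (Prod Nat (List affineT)))).

Definition encodes_hom (R : realType) (X1 X2 : Type)
    (Pi1 : polyhedral_complex R X1) (Pi2 : polyhedral_complex R X2)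
    (Pi : polyhedral_complex R (carrier Pi1 -> carrier Pi2))
    (c : den R homT) : Prop :=
  encodes Pi c.1 /\
  forall (h : 'I_(nfaces Pi)) (i : 'I_(nfaces Pi1)),
    let: (jn, ms) := nth (0%N, [::]) (nth [::] c.2 h) i in
    exists j : 'I_(nfaces Pi2), jn = j :> nat /\
      forall (x : 'rV[R]_(adim Pi h)) (u : 'rV[R]_(adim Pi1 i)) (y : carrier Pi1),
        cell Pi h x -> cell Pi1 i u -> val y = chart Pi1 i u ->
        let coef (k : nat) := nth ([::], [::]) ms k in
        let m : 'M[R]_(adim Pi1 i, adim Pi2 j) :=
          mx_of _ _ (coef 0%N).1
          + \sum_(k < adim Pi h) x 0 k *: mx_of _ _ (coef k.+1).1 in
        let t : 'rV[R]_(adim Pi2 j) :=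
          vec_of _ (coef 0%N).2
          + \sum_(k < adim Pi h) x 0 k *: vec_of _ (coef k.+1).2 in
        cell Pi2 j (u *m m + t) /\
        chart Pi2 j (u *m m + t) = val (chart Pi h x y).

(* Main.v *)
Require Import Defs.
From mathcomp Require Import all_boot all_order all_algebra.
From mathcomp Require Import all_classical all_reals all_analysis.
From mathcomp Require Import ring lra.

(* A map f of complexes sending each face p_i into q_{s(i)} is determined by the
   coordinates in Q_{s(i)} of the images of finitely many generators v of the
   cells P_i (vertices, or ray generators together with the origin).  For a
   fixed choice s these coordinates range over the polyhedron H_s cut out by the
   linear conditions: f(v) lies in Q_{s(i)}, and f(v) is compatible with the
   gluings of v with the other cells P_i'; taking i' = i, the latter condition
   says that the values extend affinely to P_i.  H_s is bounded, respectively
   pointed, because the cells Q_j are.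

   The point is that every face of H_s is again some H_t.  A face of H_s is the
   set where certain inequalities h(f(v)) <= b are tight.  If l is the smallest
   face of the source containing v, then h(f(v)) = b forces h(f(x)) = b for all
   x in l, so that tightness at v only depends on the face of the target
   containing f(l); one takes for t(i) the smallest face of the target containing
   f(p_i) for all f in the face of H_s.

   Everything is computable from Fourier-Motzkin elimination, which yields a
   point of any nonempty polyhedron: it produces the generators, the generalised
   inverses that recover an affine map from its values, and it decides emptiness
   and inclusion of the H_s, hence removes repetitions among them. *)

(** Values at generators serve as coordinates, rather than matrix entries, because an affine map on
    a cell that does not span its ambient space has many matrices, while charts must be injective
    and polyhedra of maps between polytopes bounded. Redundant generators do no harm: the equations
    with i' = i tie their values together.

    The intersection condition for H_s and H_t comes from the target. A map of H_s belongs to H_t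
    when its value at each generator of p_i lies in the common part of q_{s(i)} and q_{t(i)}, a face
    of q_{s(i)} exposed by one supporting functional. The sum of these functionals over all
    generators supports H_s and is tight exactly when every summand is, so it exposes the
    intersection.

    Polytopes and cones share all formulas through a homogenising coordinate equal to 1 or 0, which
    makes the interpolated maps affine or linear. The remaining obstacle in the conical case is that
    gluings are only assumed affine; their translation parts vanish where needed because they fix
    the origin. *)

Set Implicit Arguments.
Unset Strict Implicit.
Unset Printing Implicit Defensive.

Import Order.TTheory GRing.Theory Num.Theory.
Import numFieldNormedType.Exports.

Local Open Scope ring_scope.

(** * The algorithm on real data *)

(* These functions are written with [foldr] and [nat_rect] only, so that each of
   them is convertible to the denotation of a term. *)
Section Primitives.
Variables T U : Type.

Definition fmap (f : T -> U) (s : seq T) : seq U :=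
  foldr (fun x l => f x :: l) [::] s.

Definition fcat (s t : seq T) : seq T := foldr cons t s.

Definition fnth (x0 : T) (s : seq T) : nat -> T :=
  foldr (fun x rec m => nat_rect (fun _ => T) x (fun m' _ => rec m') m) (fun _ => x0) s.

Definition fall (p : T -> bool) (s : seq T) : bool :=
  foldr (fun x b => if p x then b else false) true s.

Definition fsize (s : seq T) : nat := foldr (fun _ n => n.+1) 0%N s.

End Primitives.

Definition fbind T U (f : T -> seq U) (s : seq T) : seq U :=
  foldr (fun x l => fcat (f x) l) [::] s.

Definition fiota (n : nat) : seq nat :=
  nat_rect (fun _ => seq nat) [::] (fun j l => fcat l [:: j]) n.

Definition fadd (m n : nat) : nat := nat_rect (fun _ => nat) m (fun _ => S) n.

Definition fmul (m n : nat) : nat := nat_rect (fun _ => nat) 0%N (fun _ a => fadd a m) n.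

Definition feqn (m n : nat) : bool :=
  nat_rect (fun _ => nat -> bool)
    (fun n => nat_rect (fun _ => bool) true (fun _ _ => false) n)
    (fun _ rec n => nat_rect (fun _ => bool) false (fun n' _ => rec n') n) m n.

Definition fltn (m n : nat) : bool :=
  nat_rect (fun _ => nat -> bool)
    (fun n => nat_rect (fun _ => bool) false (fun _ _ => true) n)
    (fun _ rec n => nat_rect (fun _ => bool) false (fun n' _ => rec n') n) m n.

Definition fdivmod (n k : nat) : nat * nat :=
  nat_rect (fun _ => (nat * nat)%type) (0%N, 0%N)
    (fun _ qr => if feqn qr.2.+1 n then (qr.1.+1, 0%N) else (qr.1, qr.2.+1)) k.

Section Programs.
Variable R : realType.

Definition vec := nat -> R.
Definition con := (vec * R)%type.
(* Supporting functional of a face and affine map on that face. *)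
Definition glue := (con * ((nat -> vec) * vec))%type.

(* Number of cells, common ambient dimension, inequalities and gluings. *)
Definition udata := ((nat * nat) * ((nat -> seq con) * (nat -> nat -> glue)))%type.
Definition ncell (U : udata) : nat := U.1.1.
Definition udim (U : udata) : nat := U.1.2.
Definition ineqs (U : udata) : nat -> seq con := U.2.1.
Definition gluing (U : udata) : nat -> nat -> glue := U.2.2.

Definition fsum (n : nat) (f : vec) : R :=
  nat_rect (fun _ => R : Type) 0 (fun j a => a + f j) n.

Definition dotn (D : nat) (c x : vec) : R := fsum D (fun j => c j * x j).

Definition sat (D : nat) (x : vec) (h : con) : bool := dotn D h.1 x <= h.2.

Definition inP (D : nat) (hs : seq con) (x : vec) : bool := fall (sat D x) hs.

Definition consv (a : R) (x : vec) : vec :=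
  fun j => nat_rect (fun _ => R : Type) a (fun j' _ => x j') j.

Definition shift (x : vec) : vec := fun j => x j.+1.

Definition trivc : con := (fun=> 0, 0).

(* When the head coefficients of [h] and [h'] are negative and positive, the
   positive combination free of the head variable; [trivc] is a filler. *)
Definition elim_pair (h h' : con) : con :=
  if h.1 0%N <= 0 then
    if 0 <= h.1 0%N then (shift h.1, h.2)
    else if 0 <= h'.1 0%N then
      (fun j => h'.1 0%N * h.1 j.+1 + - (h.1 0%N * h'.1 j.+1),
       h'.1 0%N * h.2 + - (h.1 0%N * h'.2))
    else trivc
  else trivc.

Definition elim_head (hs : seq con) : seq con :=
  fbind (fun h => fmap (elim_pair h) hs) hs.

(* Equal to 0 when the head coefficient vanishes. *)
Definition bound (D : nat) (x : vec) (h : con) : R :=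
  (h.2 + - dotn D (shift h.1) x) * (h.1 0%N)^-1.

(** When nonempty, the set of admissible values of the head variable over [x] is an interval. Unless
    it is the whole line, one of its endpoints is the [bound] of some inequality; so these
    candidates are tested, with 0 as the default. *)
Definition pick_head (D : nat) (hs : seq con) (x : vec) : R :=
  foldr (fun h a => if inP D.+1 hs (consv (bound D x h) x) then bound D x h else a) 0 hs.

Definition sample (D : nat) (hs : seq con) : vec :=
  nat_rect (fun _ => seq con -> vec) (fun _ _ => 0)
    (fun n rec hs => consv (pick_head n hs (rec (elim_head hs))) (rec (elim_head hs))) D hs.

Definition feasible (D : nat) (hs : seq con) : bool := inP D hs (sample D hs).

Definition negc (h : con) : con := (fun j => - h.1 j, - h.2).
Definition eqc (h : con) : seq con := [:: h; negc h].

(* All sublists, used as candidate sets of tight inequalities. *)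
Definition sublists (hs : seq con) : seq (seq con) :=
  foldr (fun h acc => fcat acc (fmap (cons h) acc)) [:: [::]] hs.

(** Each nonempty face contributes a sample, with its tight inequalities as [S]; the vertices, being
    one-point faces, are among these samples. The other samples that pass the test are harmless,
    since they belong to the polyhedron. *)
Definition gens_poly (D : nat) (hs : seq con) : seq vec :=
  fbind (fun S => if inP D hs (sample D (fcat hs (fmap negc S)))
                  then [:: sample D (fcat hs (fmap negc S))] else [::])
    (sublists hs).

(** On a pointed cone this sum of normals is negative off the origin. *)
Definition height (hs : seq con) : vec := fun j => foldr (fun h a => h.1 j + a) 0 hs.

(* Pointed cones are generated by a slice, on which the sum of the (nonpositive)
   left-hand sides is -1, and the origin. *)
Definition gens (k : complex_kind) (D : nat) (hs : seq con) : seq vec :=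
  match k with
  | Polytopal => gens_poly D hs
  | Conical => (fun=> 0) :: gens_poly D (fcat hs (eqc (height hs, - 1)))
  end.

(** The homogenising coordinate of a point: with 1 the interpolated maps are affine, with 0 they are
    linear. *)
Definition hconst (k : complex_kind) : R :=
  match k with Polytopal => 1 | Conical => 0 end.

Definition hrhs (k : complex_kind) (b : R) : R :=
  match k with Polytopal => b | Conical => 0 end.

(* Index [p * E + s] of a vector of length [n * E] is entry [s] of block [p]. *)
Definition flat (E : nat) (g : nat -> vec) : vec :=
  fun j => g (fdivmod E j).1 (fdivmod E j).2.

Definition delta (i j : nat) : R := if feqn i j then 1 else 0.

Definition gapply (D : nat) (g : glue) (x : vec) : vec :=
  fun s => fsum D (fun r => x r * g.2.1 r s) + g.2.2 s.

(* All cells are moved to the same ambient space, with zeros in the additional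
   coordinates, and the inequalities of cones are made homogeneous. *)
Section Normalize.
Variables (k : complex_kind) (c : den R complexT).

Definition cdim (i : nat) : nat := (fnth (0%N, [::]) c.1 i).1.

Definition maxdim : nat := foldr (fun (P : den R polyhedronT) a => fadd P.1 a) 0%N c.1.

Definition nineqs (i : nat) : seq con :=
  fcat (fmap (fun h : den R halfspaceT => (fnth 0 h.1 : vec, hrhs k h.2))
          (fnth (0%N, [::]) c.1 i).2)
       (fbind (fun s => if fltn s (cdim i) then [::] else eqc (delta s, 0)) (fiota maxdim)).

Definition cgl (i j : nat) : den R gluingT :=
  fnth (([::], 0), ([::], 0), ([::], [::])) (fnth [::] c.2 i) j.

Definition ngluing (i j : nat) : glue :=
  ((fnth 0 (cgl i j).1.1.1, (cgl i j).1.1.2),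
   (fun r s => if fltn s (cdim j) then fnth 0 (fnth [::] (cgl i j).2.1 r) s else 0,
    fun s => if fltn s (cdim j) then fnth 0 (cgl i j).2.2 s else 0)).

Definition normalize : udata := ((fsize c.1, maxdim), (nineqs, ngluing)).

End Normalize.

Section Hom.
Variables (k : complex_kind) (U V : udata).

Definition points : seq (nat * vec) :=
  fbind (fun i => fmap (pair i) (gens k (udim U) (ineqs U i))) (fiota (ncell U)).

Definition npt : nat := fsize points.
Definition ptcell (p : nat) : nat := (fnth (0%N, fun=> 0) points p).1.
Definition ptvec (p : nat) : vec := (fnth (0%N, fun=> 0) points p).2.

Definition homv (u : vec) : vec := fun r => if fltn r (udim U) then u r else hconst k.

Definition ptmx (i p : nat) : vec :=
  fun r => if feqn (ptcell p) i then homv (ptvec p) r else 0.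

(** With the homogenised points of cell [i] as the rows of a matrix M, the equation M G M = M is
    linear in the entries of G, so [sample] solves it. The entry (r', p') of G has index r' * npt +
    p'. *)
Definition ginv (i : nat) : vec :=
  sample (fmul (udim U).+1 npt)
    (fbind (fun p => fbind (fun r =>
       eqc (flat npt (fun r' p' => ptmx i p r' * ptmx i p' r), ptmx i p r))
       (fiota (udim U).+1)) (fiota npt)).

(* The value at [u] of the map with values [w_p] at the points [p] of cell [i] is
   the sum of the [lamv i u p * w_p]. *)
Definition lamx (i r p : nat) : R :=
  if feqn (ptcell p) i then ginv i (fadd (fmul r npt) p) else 0.

Definition lamv (i : nat) (u : vec) : vec :=
  fun p => fsum (udim U).+1 (fun r => homv u r * lamx i r p).

Definition hdim : nat := fmul npt (udim V).

Definition at_pt (p : nat) (h : vec) : vec :=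
  flat (udim V) (fun p' s => if feqn p' p then h s else 0).

Definition consA (f : seq nat) : seq con :=
  fbind (fun p => fmap (fun h => (at_pt p h.1, h.2)) (ineqs V (fnth 0%N f (ptcell p))))
    (fiota npt).

(** The point [p] lies in cell [i] too exactly when the supporting functional of the gluing is tight
    there; one comparison decides this, as the opposite one holds on the whole cell. The equations
    then say that the value at [p] lies on the face glued in the target, and that the target gluing
    moves it to the value of the interpolated map of cell [i] at the glued point. *)
Definition consB (f : seq nat) : seq con :=
  fbind (fun p => fbind (fun i =>
    let g := gluing U (ptcell p) i in
    let g' := gluing V (fnth 0%N f (ptcell p)) (fnth 0%N f i) in
    if g.1.2 <= dotn (udim U) g.1.1 (ptvec p) then
      fcat (eqc (at_pt p g'.1.1, g'.1.2))
        (fbind (fun s => eqc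
          (flat (udim V) (fun p' s' =>
             (if feqn p' p then g'.2.1 s' s else 0) +
             - (if feqn s' s then lamv i (gapply (udim U) g (ptvec p)) p' else 0)),
           - g'.2.2 s)) (fiota (udim V)))
    else [::]) (fiota (ncell U))) (fiota npt).

Definition hcons (f : seq nat) : seq con := fcat (consA f) (consB f).

(** A sum of supporting functionals, one for each generator, is tight only if all of them are; hence
    a single functional expresses that all values lie in the cells chosen by [f'] as well. The
    affine map acts separately on each block of coordinates. *)
Definition hglue (f f' : seq nat) : glue :=
  let g p := gluing V (fnth 0%N f (ptcell p)) (fnth 0%N f' (ptcell p)) in
  ((flat (udim V) (fun p => (g p).1.1), fsum npt (fun p => (g p).1.2)),
   (fun j => flat (udim V) (fun p' s' =>
      if feqn (fdivmod (udim V) j).1 p'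
      then (g p').2.1 (fdivmod (udim V) j).2 s' else 0),
    flat (udim V) (fun p s => (g p).2.2 s))).

(* The linear program below, homogenised by an extra variable, asks for a point
   of the polyhedron of [f] off the face on which the maps also belong to [f']. *)
Definition hincl (f f' : seq nat) : bool :=
  let c := (hglue f f').1 in
  if feasible hdim.+1
       (fcat [:: (consv (- 1) (fun=> 0), 0); (consv (- c.2) c.1, - 1)]
             (fmap (fun h => (consv (- h.2) h.1, 0)) (hcons f)))
  then false else true.

Definition choices (n m : nat) : seq (seq nat) :=
  nat_rect (fun _ => seq (seq nat)) [:: [::]]
    (fun _ acc => fbind (fun j => fmap (cons j) acc) (fiota m)) n.

Definition kept : seq (seq nat) :=
  foldr (fun f acc =>
      if feasible hdim (hcons f) then
        if fall (fun f' => if hincl f f' then if hincl f' f then false else true else true) acc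
        then f :: acc else acc
      else acc) [::] (choices (ncell U) (ncell V)).

Definition hom : udata :=
  ((fsize kept, hdim),
   (fun a => hcons (fnth [::] kept a),
    fun a b => hglue (fnth [::] kept a) (fnth [::] kept b))).

Definition flist (n : nat) (x : vec) : seq R := fmap x (fiota n).

(** The interpolated map depends linearly on the coordinates, hence the empty constant term. The
    coordinate with indices (p, s) only affects column s; the row of [lamx] for the homogenising
    coordinate gives the translation. *)
Definition hom_coefs (i : nat) : den R (List affineT) :=
  ([::], [::]) ::
  fmap (fun j =>
    let p := (fdivmod (udim V) j).1 in let s := (fdivmod (udim V) j).2 in
    (fmap (fun r => flist (udim V) (fun s' => if feqn s s' then lamx i r p else 0))
       (fiota (udim U)),
     flist (udim V) (fun s' => if feqn s s' then hconst k * lamx i (udim U) p else 0)))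
    (fiota hdim).

Definition hom_charts : seq (seq (nat * den R (List affineT))) :=
  fmap (fun f : seq nat => fmap (fun i => (fnth 0%N f i, hom_coefs i)) (fiota (ncell U))) kept.

End Hom.

Definition encode (U : udata) : den R complexT :=
  let lst := flist (udim U) in
  (fmap (fun i => (udim U, fmap (fun h : con => (lst h.1, h.2)) (ineqs U i))) (fiota (ncell U)),
   fmap (fun i => fmap (fun j =>
     (((lst (gluing U i j).1.1, (gluing U i j).1.2),
       (lst (gluing U j i).1.1, (gluing U j i).1.2)),
      (fmap (fun r => lst ((gluing U i j).2.1 r)) (fiota (udim U)),
       lst (gluing U i j).2.2))) (fiota (ncell U))) (fiota (ncell U))).

Definition hom_program (k : complex_kind) (c : den R (Prod complexT complexT)) : den R homT :=
  (encode (hom k (normalize k c.1) (normalize k c.2)),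
   hom_charts k (normalize k c.1) (normalize k c.2)).

End Programs.

Arguments inP : simpl never.
Arguments sat : simpl never.
Arguments dotn : simpl never.
Arguments fsum : simpl never.
Arguments fiota : simpl never.
Arguments fdivmod : simpl never.

(** * The algorithm as a term *)

(* Named binders for the de Bruijn syntax: a bound variable weakens itself to
   the context of each of its occurrences. *)
Class ext (G G' : seq ty) := weaken : forall a, var G a -> var G' a.
#[global] Instance ext_refl G : ext G G := fun a v => v.
#[global] Instance ext_cons b G G' (e : ext G G') : ext G (b :: G') :=
  fun a v => VarS b (e a v).

Definition lam G a b
    (f : (forall G', ext (a :: G) G' -> term G' a) -> term (a :: G) b) : term G (Arr a b) :=
  TLam (f (fun G' e => TVar (e _ (Var0 G a)))).

Notation "'\l' x .. y , e" := (lam (fun x => .. (lam (fun y => e)) ..))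
  (at level 200, x binder, y binder, right associativity).
Notation "$ x" := (x _ _) (at level 1, x at level 0, only parsing).
Notation "f @@ x" := (TApp f x) (at level 12, left associativity).

Arguments TNil {G a}.
Arguments TTrue {G}.
Arguments TFalse {G}.
Arguments TO {G}.
Arguments TZero {G}.
Arguments TOne {G}.

Definition vT := Arr Nat Scal.
Definition cT := Prod vT Scal.
Definition gT := Prod cT (Prod (Arr Nat vT) vT).
Definition uT := Prod (Prod Nat Nat) (Prod (Arr Nat (List cT)) (Arr Nat (Arr Nat gT))).

(* [locked] keeps the evaluation of a program from unfolding its subprograms. *)
Definition tmap a b : forall G, term G (Arr (Arr a b) (Arr (List a) (List b))) :=
  locked (fun G =>   \l f s, TFold (\l x l, TCons ($f @@ $x) $l) TNil $s).
Definition tcat a : forall G, term G (Arr (List a) (Arr (List a) (List a))) :=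
  locked (fun G =>   \l s t, TFold (\l x l, TCons $x $l) $t $s).
Definition tnth a : forall G, term G (Arr a (Arr (List a) (Arr Nat a))) :=
  locked (fun G =>   \l x0 s, TFold (\l x rec m, TRec $x (\l m' y, $rec @@ $m') $m) (\l m, $x0) $s).
Definition tall a : forall G, term G (Arr (Arr a Bool) (Arr (List a) Bool)) :=
  locked (fun G =>   \l p s, TFold (\l x b, TIf ($p @@ $x) $b TFalse) TTrue $s).
Definition tsize a : forall G, term G (Arr (List a) Nat) :=
  locked (fun G => \l s, TFold (\l x n, TS $n) TO $s).
Definition tbind a b : forall G, term G (Arr (Arr a (List b)) (Arr (List a) (List b))) :=
  locked (fun G =>   \l f s, TFold (\l x l, tcat _ _ @@ ($f @@ $x) @@ $l) TNil $s).
Definition tiota : forall G, term G (Arr Nat (List Nat)) :=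
  locked (fun G =>   \l n, TRec TNil (\l j l, tcat _ _ @@ $l @@ TCons $j TNil) $n).
Definition tadd : forall G, term G (Arr Nat (Arr Nat Nat)) :=
  locked (fun G => \l m n, TRec $m (\l j a, TS $a) $n).
Definition tmul : forall G, term G (Arr Nat (Arr Nat Nat)) :=
  locked (fun G =>   \l m n, TRec TO (\l j a, tadd _ @@ $a @@ $m) $n).
Definition teqn : forall G, term G (Arr Nat (Arr Nat Bool)) :=
  locked (fun G =>   \l m, TRec (\l n, TRec TTrue (\l i b, TFalse) $n)
    (\l j rec n, TRec TFalse (\l n' b, $rec @@ $n') $n) $m).
Definition tltn : forall G, term G (Arr Nat (Arr Nat Bool)) :=
  locked (fun G =>   \l m, TRec (\l n, TRec TFalse (\l i b, TTrue) $n)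
    (\l j rec n, TRec TFalse (\l n' b, $rec @@ $n') $n) $m).
Definition tdivmod : forall G, term G (Arr Nat (Arr Nat (Prod Nat Nat))) :=
  locked (fun G =>   \l n k, TRec (TPair TO TO)
    (\l j qr, TIf (teqn _ @@ TS (TSnd $qr) @@ $n)
                (TPair (TS (TFst $qr)) TO) (TPair (TFst $qr) (TS (TSnd $qr)))) $k).
Definition tsum : forall G, term G (Arr Nat (Arr vT Scal)) :=
  locked (fun G =>   \l n f, TRec TZero (\l j a, TAdd $a ($f @@ $j)) $n).
Definition tdot : forall G, term G (Arr Nat (Arr vT (Arr vT Scal))) :=
  locked (fun G =>   \l D c x, tsum _ @@ $D @@ (\l j, TMul ($c @@ $j) ($x @@ $j))).
Definition tsat : forall G, term G (Arr Nat (Arr vT (Arr cT Bool))) :=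
  locked (fun G =>   \l D x h, TLe (tdot _ @@ $D @@ TFst $h @@ $x) (TSnd $h)).
Definition tinP : forall G, term G (Arr Nat (Arr (List cT) (Arr vT Bool))) :=
  locked (fun G =>   \l D hs x, tall _ _ @@ (tsat _ @@ $D @@ $x) @@ $hs).
Definition tconsv : forall G, term G (Arr Scal (Arr vT vT)) :=
  locked (fun G =>   \l a x j, TRec $a (\l j' y, $x @@ $j') $j).
Definition tshift : forall G, term G (Arr vT vT) :=
  locked (fun G => \l x j, $x @@ TS $j).
Definition tpair_elim : forall G, term G (Arr cT (Arr cT cT)) :=
  locked (fun G =>   \l h h', TIf (TLe (TFst $h @@ TO) TZero)
    (TIf (TLe TZero (TFst $h @@ TO)) (TPair (tshift _ @@ TFst $h) (TSnd $h))
      (TIf (TLe TZero (TFst $h' @@ TO))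
        (TPair (\l j, TAdd (TMul (TFst $h' @@ TO) (TFst $h @@ TS $j))
                           (TOpp (TMul (TFst $h @@ TO) (TFst $h' @@ TS $j))))
               (TAdd (TMul (TFst $h' @@ TO) (TSnd $h))
                     (TOpp (TMul (TFst $h @@ TO) (TSnd $h')))))
        (TPair (\l j, TZero) TZero)))
    (TPair (\l j, TZero) TZero)).
Definition telim : forall G, term G (Arr (List cT) (List cT)) :=
  locked (fun G =>   \l hs, tbind _ _ _ @@ (\l h, tmap _ _ _ @@ (tpair_elim _ @@ $h) @@ $hs) @@ $hs).
Definition tbound : forall G, term G (Arr Nat (Arr vT (Arr cT Scal))) :=
  locked (fun G =>   \l D x h, TMul (TAdd (TSnd $h) (TOpp (tdot _ @@ $D @@ (tshift _ @@ TFst $h) @@ $x)))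
                 (TInv (TFst $h @@ TO))).
Definition tpick : forall G, term G (Arr Nat (Arr (List cT) (Arr vT Scal))) :=
  locked (fun G =>   \l D hs x, TFold (\l h a, TIf (tinP _ @@ TS $D @@ $hs @@
                                   (tconsv _ @@ (tbound _ @@ $D @@ $x @@ $h) @@ $x))
                                (tbound _ @@ $D @@ $x @@ $h) $a) TZero $hs).
Definition tsample : forall G, term G (Arr Nat (Arr (List cT) vT)) :=
  locked (fun G =>   \l D, TRec (\l hs j, TZero)
    (\l n rec hs, tconsv _ @@ (tpick _ @@ $n @@ $hs @@ ($rec @@ (telim _ @@ $hs)))
                           @@ ($rec @@ (telim _ @@ $hs))) $D).
Definition tfeasible : forall G, term G (Arr Nat (Arr (List cT) Bool)) :=
  locked (fun G =>   \l D hs, tinP _ @@ $D @@ $hs @@ (tsample _ @@ $D @@ $hs)).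
Definition tnegc : forall G, term G (Arr cT cT) :=
  locked (fun G =>   \l h, TPair (\l j, TOpp (TFst $h @@ $j)) (TOpp (TSnd $h))).
Definition teqc : forall G, term G (Arr cT (List cT)) :=
  locked (fun G =>   \l h, TCons $h (TCons (tnegc _ @@ $h) TNil)).
Definition tsublists : forall G, term G (Arr (List cT) (List (List cT))) :=
  locked (fun G =>   \l hs, TFold (\l h acc, tcat _ _ @@ $acc @@ (tmap _ _ _ @@ (\l s, TCons $h $s) @@ $acc))
    (TCons TNil TNil) $hs).
Definition tgens_poly : forall G, term G (Arr Nat (Arr (List cT) (List vT))) :=
  locked (fun G =>   \l D hs, tbind _ _ _ @@ (\l S,
    TIf (tinP _ @@ $D @@ $hs @@
           (tsample _ @@ $D @@ (tcat _ _ @@ $hs @@ (tmap _ _ _ @@ tnegc _ @@ $S))))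
        (TCons (tsample _ @@ $D @@ (tcat _ _ @@ $hs @@ (tmap _ _ _ @@ tnegc _ @@ $S))) TNil)
        TNil) @@ (tsublists _ @@ $hs)).
Definition theight : forall G, term G (Arr (List cT) vT) :=
  locked (fun G =>   \l hs j, TFold (\l h a, TAdd (TFst $h @@ $j) $a) TZero $hs).
Definition tgens k : forall G, term G (Arr Nat (Arr (List cT) (List vT))) :=
  locked (fun G =>   match k with
  | Polytopal => tgens_poly G
  | Conical => \l D hs, TCons (\l j, TZero)
      (tgens_poly _ @@ $D @@
         (tcat _ _ @@ $hs @@ (teqc _ @@ TPair (theight _ @@ $hs) (TOpp TOne))))
  end).
Definition thconst k : forall G, term G Scal :=
  locked (fun G =>   match k with Polytopal => TOne | Conical => TZero end).
Definition thrhs k : forall G, term G (Arr Scal Scal) :=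
  locked (fun G =>   match k with Polytopal => \l b, $b | Conical => \l b, TZero end).
Definition tflat : forall G, term G (Arr Nat (Arr (Arr Nat vT) vT)) :=
  locked (fun G =>   \l E g j, $g @@ TFst (tdivmod _ @@ $E @@ $j) @@ TSnd (tdivmod _ @@ $E @@ $j)).
Definition tdelta : forall G, term G (Arr Nat vT) :=
  locked (fun G => \l i j, TIf (teqn _ @@ $i @@ $j) TOne TZero).
Definition tgapply : forall G, term G (Arr Nat (Arr gT (Arr vT vT))) :=
  locked (fun G =>   \l D g x s, TAdd (tsum _ @@ $D @@ (\l r, TMul ($x @@ $r) (TFst (TSnd $g) @@ $r @@ $s)))
                   (TSnd (TSnd $g) @@ $s)).

Definition tcdim : forall G, term G (Arr complexT (Arr Nat Nat)) :=
  locked (fun G =>   \l c i, TFst (tnth _ _ @@ TPair TO TNil @@ TFst $c @@ $i)).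
Definition tmaxdim : forall G, term G (Arr complexT Nat) :=
  locked (fun G =>   \l c, TFold (\l P a, tadd _ @@ TFst $P @@ $a) TO (TFst $c)).
Definition tnineqs k : forall G, term G (Arr complexT (Arr Nat (List cT))) :=
  locked (fun G =>   \l c i, tcat _ _ @@
    (tmap _ _ _ @@ (\l h, TPair (tnth _ _ @@ TZero @@ TFst $h) (thrhs k _ @@ TSnd $h))
       @@ TSnd (tnth _ _ @@ TPair TO TNil @@ TFst $c @@ $i)) @@
    (tbind _ _ _ @@ (\l s, TIf (tltn _ @@ $s @@ (tcdim _ @@ $c @@ $i)) TNil
                               (teqc _ @@ TPair (tdelta _ @@ $s) TZero))
       @@ (tiota _ @@ (tmaxdim _ @@ $c)))).
Definition tcgl : forall G, term G (Arr complexT (Arr Nat (Arr Nat gluingT))) :=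
  locked (fun G =>   \l c i j, tnth _ _ @@ TPair (TPair (TPair TNil TZero) (TPair TNil TZero)) (TPair TNil TNil)
    @@ (tnth _ _ @@ TNil @@ TSnd $c @@ $i) @@ $j).
Definition tngluing : forall G, term G (Arr complexT (Arr Nat (Arr Nat gT))) :=
  locked (fun G =>   \l c i j, TPair
    (TPair (tnth _ _ @@ TZero @@ TFst (TFst (TFst (tcgl _ @@ $c @@ $i @@ $j))))
           (TSnd (TFst (TFst (tcgl _ @@ $c @@ $i @@ $j)))))
    (TPair
      (\l r s, TIf (tltn _ @@ $s @@ (tcdim _ @@ $c @@ $j))
         (tnth _ _ @@ TZero @@
            (tnth _ _ @@ TNil @@ TFst (TSnd (tcgl _ @@ $c @@ $i @@ $j)) @@ $r) @@ $s) TZero)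
      (\l s, TIf (tltn _ @@ $s @@ (tcdim _ @@ $c @@ $j))
         (tnth _ _ @@ TZero @@ TSnd (TSnd (tcgl _ @@ $c @@ $i @@ $j)) @@ $s) TZero))).
Definition tnormalize k : forall G, term G (Arr complexT uT) :=
  locked (fun G =>   \l c, TPair (TPair (tsize _ _ @@ TFst $c) (tmaxdim _ @@ $c))
              (TPair (tnineqs k _ @@ $c) (tngluing _ @@ $c))).

(** This abbreviation and the following ones act on terms and disappear on unfolding, so that no
    evaluation lemma is stated for them. *)
Definition mncell G (U : term G uT) := TFst (TFst U).
Definition mudim G (U : term G uT) := TSnd (TFst U).
Definition mineqs G (U : term G uT) := TFst (TSnd U).
Definition mgluing G (U : term G uT) := TSnd (TSnd U).
Definition mc G (g : term G gT) := TFst (TFst g).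
Definition mb G (g : term G gT) := TSnd (TFst g).
Definition mm G (g : term G gT) := TFst (TSnd g).
Definition mt G (g : term G gT) := TSnd (TSnd g).
Definition mnth G a (x : term G a) (s : term G (List a)) (n : term G Nat) := tnth _ _ @@ x @@ s @@ n.

Section HomTerms.
Variable k : complex_kind.

Definition tpoints : forall G, term G (Arr uT (List (Prod Nat vT))) :=
  locked (fun G =>   \l U, tbind _ _ _ @@ (\l i, tmap _ _ _ @@ (\l v, TPair $i $v) @@
      (tgens k _ @@ mudim $U @@ (mineqs $U @@ $i))) @@ (tiota _ @@ mncell $U)).
Definition tnpt : forall G, term G (Arr uT Nat) :=
  locked (fun G => \l U, tsize _ _ @@ (tpoints _ @@ $U)).
Definition tptcell : forall G, term G (Arr uT (Arr Nat Nat)) :=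
  locked (fun G =>   \l U p, TFst (mnth (TPair TO (\l j, TZero)) (tpoints _ @@ $U) $p)).
Definition tptvec : forall G, term G (Arr uT (Arr Nat vT)) :=
  locked (fun G =>   \l U p, TSnd (mnth (TPair TO (\l j, TZero)) (tpoints _ @@ $U) $p)).
Definition thomv : forall G, term G (Arr uT (Arr vT vT)) :=
  locked (fun G =>   \l U u r, TIf (tltn _ @@ $r @@ mudim $U) ($u @@ $r) (thconst k _)).
Definition tptmx : forall G, term G (Arr uT (Arr Nat (Arr Nat vT))) :=
  locked (fun G =>   \l U i p r, TIf (teqn _ @@ (tptcell _ @@ $U @@ $p) @@ $i)
                  (thomv _ @@ $U @@ (tptvec _ @@ $U @@ $p) @@ $r) TZero).
Definition tginv : forall G, term G (Arr uT (Arr Nat vT)) :=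
  locked (fun G =>   \l U i, tsample _ @@ (tmul _ @@ TS (mudim $U) @@ (tnpt _ @@ $U)) @@
    (tbind _ _ _ @@ (\l p, tbind _ _ _ @@ (\l r,
       teqc _ @@ TPair
         (tflat _ @@ (tnpt _ @@ $U) @@ (\l r' p',
            TMul (tptmx _ @@ $U @@ $i @@ $p @@ $r') (tptmx _ @@ $U @@ $i @@ $p' @@ $r)))
         (tptmx _ @@ $U @@ $i @@ $p @@ $r))
       @@ (tiota _ @@ TS (mudim $U))) @@ (tiota _ @@ (tnpt _ @@ $U)))).
Definition tlamx : forall G, term G (Arr uT (Arr Nat (Arr Nat (Arr Nat Scal)))) :=
  locked (fun G =>   \l U i r p, TIf (teqn _ @@ (tptcell _ @@ $U @@ $p) @@ $i)
    (tginv _ @@ $U @@ $i @@ (tadd _ @@ (tmul _ @@ $r @@ (tnpt _ @@ $U)) @@ $p)) TZero).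
Definition tlamv : forall G, term G (Arr uT (Arr Nat (Arr vT vT))) :=
  locked (fun G =>   \l U i u p, tsum _ @@ TS (mudim $U) @@
    (\l r, TMul (thomv _ @@ $U @@ $u @@ $r) (tlamx _ @@ $U @@ $i @@ $r @@ $p))).
Definition thdim : forall G, term G (Arr uT (Arr uT Nat)) :=
  locked (fun G =>   \l U V, tmul _ @@ (tnpt _ @@ $U) @@ mudim $V).
Definition tat_pt : forall G, term G (Arr uT (Arr Nat (Arr vT vT))) :=
  locked (fun G =>   \l V p h, tflat _ @@ mudim $V @@
    (\l p' s, TIf (teqn _ @@ $p' @@ $p) ($h @@ $s) TZero)).
Definition tconsA : forall G, term G (Arr uT (Arr uT (Arr (List Nat) (List cT)))) :=
  locked (fun G =>   \l U V f, tbind _ _ _ @@ (\l p, tmap _ _ _ @@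
      (\l h, TPair (tat_pt _ @@ $V @@ $p @@ TFst $h) (TSnd $h)) @@
      (mineqs $V @@ mnth TO $f (tptcell _ @@ $U @@ $p)))
    @@ (tiota _ @@ (tnpt _ @@ $U))).
Definition tconsB : forall G, term G (Arr uT (Arr uT (Arr (List Nat) (List cT)))) :=
  locked (fun G =>   \l U V f, tbind _ _ _ @@ (\l p, tbind _ _ _ @@ (\l i,
    (\l g g',
      TIf (TLe (mb $g) (tdot _ @@ mudim $U @@ mc $g @@ (tptvec _ @@ $U @@ $p)))
        (tcat _ _ @@ (teqc _ @@ TPair (tat_pt _ @@ $V @@ $p @@ mc $g') (mb $g')) @@
          (tbind _ _ _ @@ (\l s, teqc _ @@ TPair
             (tflat _ @@ mudim $V @@ (\l p' s', TAdd
                (TIf (teqn _ @@ $p' @@ $p) (mm $g' @@ $s' @@ $s) TZero)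
                (TOpp (TIf (teqn _ @@ $s' @@ $s)
                   (tlamv _ @@ $U @@ $i @@ (tgapply _ @@ mudim $U @@ $g @@ (tptvec _ @@ $U @@ $p)) @@ $p')
                   TZero))))
             (TOpp (mt $g' @@ $s)))
           @@ (tiota _ @@ mudim $V)))
        TNil)
      @@ (mgluing $U @@ (tptcell _ @@ $U @@ $p) @@ $i)
      @@ (mgluing $V @@ mnth TO $f (tptcell _ @@ $U @@ $p) @@ mnth TO $f $i))
    @@ (tiota _ @@ mncell $U)) @@ (tiota _ @@ (tnpt _ @@ $U))).
Definition thcons : forall G, term G (Arr uT (Arr uT (Arr (List Nat) (List cT)))) :=
  locked (fun G =>   \l U V f, tcat _ _ @@ (tconsA _ @@ $U @@ $V @@ $f) @@ (tconsB _ @@ $U @@ $V @@ $f)).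
Definition thglue : forall G, term G (Arr uT (Arr uT (Arr (List Nat) (Arr (List Nat) gT)))) :=
  locked (fun G =>   \l U V f f', (\l g,
    TPair (TPair (tflat _ @@ mudim $V @@ (\l p, mc ($g @@ $p)))
                 (tsum _ @@ (tnpt _ @@ $U) @@ (\l p, mb ($g @@ $p))))
          (TPair (\l j, tflat _ @@ mudim $V @@ (\l p' s',
                    TIf (teqn _ @@ TFst (tdivmod _ @@ mudim $V @@ $j) @@ $p')
                        (mm ($g @@ $p') @@ TSnd (tdivmod _ @@ mudim $V @@ $j) @@ $s') TZero))
                 (tflat _ @@ mudim $V @@ (\l p s, mt ($g @@ $p) @@ $s))))
  @@ (\l p, mgluing $V @@ mnth TO $f (tptcell _ @@ $U @@ $p)
                       @@ mnth TO $f' (tptcell _ @@ $U @@ $p))).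
Definition thincl : forall G, term G (Arr uT (Arr uT (Arr (List Nat) (Arr (List Nat) Bool)))) :=
  locked (fun G =>   \l U V f f', (\l c,
    TIf (tfeasible _ @@ TS (thdim _ @@ $U @@ $V) @@
      (tcat _ _ @@
        (TCons (TPair (tconsv _ @@ TOpp TOne @@ (\l j, TZero)) TZero)
          (TCons (TPair (tconsv _ @@ TOpp (TSnd $c) @@ TFst $c) (TOpp TOne)) TNil)) @@
        (tmap _ _ _ @@ (\l h, TPair (tconsv _ @@ TOpp (TSnd $h) @@ TFst $h) TZero)
           @@ (thcons _ @@ $U @@ $V @@ $f)))) TFalse TTrue)
  @@ TFst (thglue _ @@ $U @@ $V @@ $f @@ $f')).
Definition tchoices : forall G, term G (Arr Nat (Arr Nat (List (List Nat)))) :=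
  locked (fun G =>   \l n m, TRec (TCons TNil TNil)
    (\l j acc, tbind _ _ _ @@ (\l i, tmap _ _ _ @@ (\l f, TCons $i $f) @@ $acc) @@ (tiota _ @@ $m)) $n).
Definition tkept : forall G, term G (Arr uT (Arr uT (List (List Nat)))) :=
  locked (fun G =>   \l U V, TFold (\l f acc,
      TIf (tfeasible _ @@ (thdim _ @@ $U @@ $V) @@ (thcons _ @@ $U @@ $V @@ $f))
        (TIf (tall _ _ @@ (\l f', TIf (thincl _ @@ $U @@ $V @@ $f @@ $f')
                 (TIf (thincl _ @@ $U @@ $V @@ $f' @@ $f) TFalse TTrue) TTrue) @@ $acc)
           (TCons $f $acc) $acc)
        $acc) TNil (tchoices _ @@ mncell $U @@ mncell $V)).
Definition thom : forall G, term G (Arr uT (Arr uT uT)) :=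
  locked (fun G =>   \l U V, TPair
    (TPair (tsize _ _ @@ (tkept _ @@ $U @@ $V)) (thdim _ @@ $U @@ $V))
    (TPair (\l a, thcons _ @@ $U @@ $V @@ mnth TNil (tkept _ @@ $U @@ $V) $a)
           (\l a b, thglue _ @@ $U @@ $V @@ mnth TNil (tkept _ @@ $U @@ $V) $a
                                         @@ mnth TNil (tkept _ @@ $U @@ $V) $b))).
Definition tflist : forall G, term G (Arr Nat (Arr vT (List Scal))) :=
  locked (fun G =>   \l n x, tmap _ _ _ @@ $x @@ (tiota _ @@ $n)).
Definition thom_coefs : forall G, term G (Arr uT (Arr uT (Arr Nat (List affineT)))) :=
  locked (fun G =>   \l U V i, TCons (TPair TNil TNil) (tmap _ _ _ @@ (\l j,
    (\l p s, TPair
      (tmap _ _ _ @@ (\l r, tflist _ @@ mudim $V @@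
          (\l s', TIf (teqn _ @@ $s @@ $s') (tlamx _ @@ $U @@ $i @@ $r @@ $p) TZero))
         @@ (tiota _ @@ mudim $U))
      (tflist _ @@ mudim $V @@
          (\l s', TIf (teqn _ @@ $s @@ $s')
             (TMul (thconst k _) (tlamx _ @@ $U @@ $i @@ mudim $U @@ $p)) TZero)))
    @@ TFst (tdivmod _ @@ mudim $V @@ $j) @@ TSnd (tdivmod _ @@ mudim $V @@ $j))
    @@ (tiota _ @@ (thdim _ @@ $U @@ $V)))).
Definition thom_charts : forall G, term G (Arr uT (Arr uT (List (List (Prod Nat (List affineT)))))) :=
  locked (fun G =>   \l U V, tmap _ _ _ @@ (\l f, tmap _ _ _ @@ (\l i,
      TPair (mnth TO $f $i) (thom_coefs _ @@ $U @@ $V @@ $i)) @@ (tiota _ @@ mncell $U))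
    @@ (tkept _ @@ $U @@ $V)).

End HomTerms.

Definition tencode : forall G, term G (Arr uT complexT) :=
  locked (fun G =>   \l U, TPair
    (tmap _ _ _ @@ (\l i, TPair (mudim $U) (tmap _ _ _ @@
         (\l h, TPair (tflist _ @@ mudim $U @@ TFst $h) (TSnd $h)) @@ (mineqs $U @@ $i)))
       @@ (tiota _ @@ mncell $U))
    (tmap _ _ _ @@ (\l i, tmap _ _ _ @@ (\l j, TPair
         (TPair (TPair (tflist _ @@ mudim $U @@ mc (mgluing $U @@ $i @@ $j))
                       (mb (mgluing $U @@ $i @@ $j)))
                (TPair (tflist _ @@ mudim $U @@ mc (mgluing $U @@ $j @@ $i))
                       (mb (mgluing $U @@ $j @@ $i))))
         (TPair (tmap _ _ _ @@ (\l r, tflist _ @@ mudim $U @@ (mm (mgluing $U @@ $i @@ $j) @@ $r))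
                   @@ (tiota _ @@ mudim $U))
                (tflist _ @@ mudim $U @@ mt (mgluing $U @@ $i @@ $j))))
       @@ (tiota _ @@ mncell $U)) @@ (tiota _ @@ mncell $U))).

Definition thom_program k : term [::] (Arr (Prod complexT complexT) homT) :=
  \l c, (\l U V, TPair (tencode _ @@ (thom k _ @@ $U @@ $V)) (thom_charts k _ @@ $U @@ $V))
    @@ (tnormalize k _ @@ TFst $c) @@ (tnormalize k _ @@ TSnd $c).

Section Evaluation.
Variable R : realType.

(* The equations are stated between functions of the environment so that they
   can be used to rewrite under the binders of larger programs. *)
Local Notation "t :=> f" := (@eval_term R _ _ t = fun=> f) (at level 70).

Local Ltac unfold_program t f :=
  rewrite /t -?lock /f; cbn [eval_term lam weaken ext_refl ext_cons lookup fst snd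
    mncell mudim mineqs mgluing mc mb mm mt mnth]; autorewrite with eval; reflexivity.

Lemma tmapE G a b : tmap a b G :=> @fmap (den R a) (den R b).
Proof. by rewrite /tmap -lock. Qed.
#[local] Hint Rewrite tmapE : eval.
Lemma tcatE G a : tcat a G :=> @fcat (den R a).
Proof. by rewrite /tcat -lock. Qed.
#[local] Hint Rewrite tcatE : eval.
Lemma tnthE G a : tnth a G :=> @fnth (den R a).
Proof. by rewrite /tnth -lock. Qed.
#[local] Hint Rewrite tnthE : eval.
Lemma tallE G a : tall a G :=> @fall (den R a).
Proof. by rewrite /tall -lock. Qed.
#[local] Hint Rewrite tallE : eval.
Lemma tsizeE G a : tsize a G :=> @fsize (den R a).
Proof. by rewrite /tsize -lock. Qed.
#[local] Hint Rewrite tsizeE : eval.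
Lemma tbindE G a b : tbind a b G :=> @fbind (den R a) (den R b).
Proof. unfold_program tbind fbind. Qed.
#[local] Hint Rewrite tbindE : eval.
Lemma tiotaE G : tiota G :=> fiota.
Proof. unfold_program tiota fiota. Qed.
#[local] Hint Rewrite tiotaE : eval.
Lemma taddE G : tadd G :=> fadd.
Proof. unfold_program tadd fadd. Qed.
#[local] Hint Rewrite taddE : eval.
Lemma tmulE G : tmul G :=> fmul.
Proof. unfold_program tmul fmul. Qed.
#[local] Hint Rewrite tmulE : eval.
Lemma teqnE G : teqn G :=> feqn.
Proof. unfold_program teqn feqn. Qed.
#[local] Hint Rewrite teqnE : eval.
Lemma tltnE G : tltn G :=> fltn.
Proof. unfold_program tltn fltn. Qed.
#[local] Hint Rewrite tltnE : eval.
Lemma tdivmodE G : tdivmod G :=> fdivmod.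
Proof. unfold_program tdivmod fdivmod. Qed.
#[local] Hint Rewrite tdivmodE : eval.
Lemma tsumE G : tsum G :=> @fsum R.
Proof. unfold_program tsum fsum. Qed.
#[local] Hint Rewrite tsumE : eval.
Lemma tdotE G : tdot G :=> @dotn R.
Proof. unfold_program tdot dotn. Qed.
#[local] Hint Rewrite tdotE : eval.
Lemma tsatE G : tsat G :=> @sat R.
Proof. unfold_program tsat sat. Qed.
#[local] Hint Rewrite tsatE : eval.
Lemma tinPE G : tinP G :=> @inP R.
Proof. unfold_program tinP inP. Qed.
#[local] Hint Rewrite tinPE : eval.
Lemma tconsvE G : tconsv G :=> @consv R.
Proof. unfold_program tconsv consv. Qed.
#[local] Hint Rewrite tconsvE : eval.
Lemma tshiftE G : tshift G :=> @shift R.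
Proof. unfold_program tshift shift. Qed.
#[local] Hint Rewrite tshiftE : eval.
Lemma tpair_elimE G : tpair_elim G :=> @elim_pair R.
Proof. unfold_program tpair_elim elim_pair. Qed.
#[local] Hint Rewrite tpair_elimE : eval.
Lemma telimE G : telim G :=> @elim_head R.
Proof. unfold_program telim elim_head. Qed.
#[local] Hint Rewrite telimE : eval.
Lemma tboundE G : tbound G :=> @bound R.
Proof. unfold_program tbound bound. Qed.
#[local] Hint Rewrite tboundE : eval.
Lemma tpickE G : tpick G :=> @pick_head R.
Proof. unfold_program tpick pick_head. Qed.
#[local] Hint Rewrite tpickE : eval.
Lemma tsampleE G : tsample G :=> @sample R.
Proof. unfold_program tsample sample. Qed.
#[local] Hint Rewrite tsampleE : eval.
Lemma tfeasibleE G : tfeasible G :=> @feasible R.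
Proof. unfold_program tfeasible feasible. Qed.
#[local] Hint Rewrite tfeasibleE : eval.
Lemma tnegcE G : tnegc G :=> @negc R.
Proof. unfold_program tnegc negc. Qed.
#[local] Hint Rewrite tnegcE : eval.
Lemma teqcE G : teqc G :=> @eqc R.
Proof. unfold_program teqc eqc. Qed.
#[local] Hint Rewrite teqcE : eval.
Lemma tsublistsE G : tsublists G :=> @sublists R.
Proof. unfold_program tsublists sublists. Qed.
#[local] Hint Rewrite tsublistsE : eval.
Lemma tgens_polyE G : tgens_poly G :=> @gens_poly R.
Proof. unfold_program tgens_poly gens_poly. Qed.
#[local] Hint Rewrite tgens_polyE : eval.
Lemma theightE G : theight G :=> @height R.
Proof. unfold_program theight height. Qed.
#[local] Hint Rewrite theightE : eval.
Lemma tgensE k G : tgens k G :=> @gens R k.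
Proof. by case: k; unfold_program tgens gens. Qed.
#[local] Hint Rewrite tgensE : eval.
Lemma thconstE k G : thconst k G :=> hconst R k.
Proof. by case: k; unfold_program thconst hconst. Qed.
#[local] Hint Rewrite thconstE : eval.
Lemma thrhsE k G : thrhs k G :=> @hrhs R k.
Proof. by case: k; unfold_program thrhs hrhs. Qed.
#[local] Hint Rewrite thrhsE : eval.
Lemma tflatE G : tflat G :=> @flat R.
Proof. unfold_program tflat flat. Qed.
#[local] Hint Rewrite tflatE : eval.
Lemma tdeltaE G : tdelta G :=> @delta R.
Proof. unfold_program tdelta delta. Qed.
#[local] Hint Rewrite tdeltaE : eval.
Lemma tgapplyE G : tgapply G :=> @gapply R.
Proof. unfold_program tgapply gapply. Qed.
#[local] Hint Rewrite tgapplyE : eval.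
Lemma tcdimE G : tcdim G :=> @cdim R.
Proof. unfold_program tcdim cdim. Qed.
#[local] Hint Rewrite tcdimE : eval.
Lemma tmaxdimE G : tmaxdim G :=> @maxdim R.
Proof. unfold_program tmaxdim maxdim. Qed.
#[local] Hint Rewrite tmaxdimE : eval.
Lemma tnineqsE k G : tnineqs k G :=> @nineqs R k.
Proof. unfold_program tnineqs nineqs. Qed.
#[local] Hint Rewrite tnineqsE : eval.
Lemma tcglE G : tcgl G :=> @cgl R.
Proof. unfold_program tcgl cgl. Qed.
#[local] Hint Rewrite tcglE : eval.
Lemma tngluingE G : tngluing G :=> @ngluing R.
Proof. unfold_program tngluing ngluing. Qed.
#[local] Hint Rewrite tngluingE : eval.
Lemma tnormalizeE k G : tnormalize k G :=> @normalize R k.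
Proof. unfold_program tnormalize normalize. Qed.
#[local] Hint Rewrite tnormalizeE : eval.
Lemma tpointsE k G : tpoints k G :=> @points R k.
Proof. unfold_program tpoints points. Qed.
#[local] Hint Rewrite tpointsE : eval.
Lemma tnptE k G : tnpt k G :=> @npt R k.
Proof. unfold_program tnpt npt. Qed.
#[local] Hint Rewrite tnptE : eval.
Lemma tptcellE k G : tptcell k G :=> @ptcell R k.
Proof. unfold_program tptcell ptcell. Qed.
#[local] Hint Rewrite tptcellE : eval.
Lemma tptvecE k G : tptvec k G :=> @ptvec R k.
Proof. unfold_program tptvec ptvec. Qed.
#[local] Hint Rewrite tptvecE : eval.
Lemma thomvE k G : thomv k G :=> @homv R k.
Proof. unfold_program thomv homv. Qed.
#[local] Hint Rewrite thomvE : eval.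
Lemma tptmxE k G : tptmx k G :=> @ptmx R k.
Proof. unfold_program tptmx ptmx. Qed.
#[local] Hint Rewrite tptmxE : eval.
Lemma tginvE k G : tginv k G :=> @ginv R k.
Proof. unfold_program tginv ginv. Qed.
#[local] Hint Rewrite tginvE : eval.
Lemma tlamxE k G : tlamx k G :=> @lamx R k.
Proof. unfold_program tlamx lamx. Qed.
#[local] Hint Rewrite tlamxE : eval.
Lemma tlamvE k G : tlamv k G :=> @lamv R k.
Proof. unfold_program tlamv lamv. Qed.
#[local] Hint Rewrite tlamvE : eval.
Lemma thdimE k G : thdim k G :=> @hdim R k.
Proof. unfold_program thdim hdim. Qed.
#[local] Hint Rewrite thdimE : eval.
Lemma tat_ptE G : tat_pt G :=> @at_pt R.
Proof. unfold_program tat_pt at_pt. Qed.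
#[local] Hint Rewrite tat_ptE : eval.
Lemma tconsAE k G : tconsA k G :=> @consA R k.
Proof. unfold_program tconsA consA. Qed.
#[local] Hint Rewrite tconsAE : eval.
Lemma tconsBE k G : tconsB k G :=> @consB R k.
Proof. unfold_program tconsB consB. Qed.
#[local] Hint Rewrite tconsBE : eval.
Lemma thconsE k G : thcons k G :=> @hcons R k.
Proof. unfold_program thcons hcons. Qed.
#[local] Hint Rewrite thconsE : eval.
Lemma thglueE k G : thglue k G :=> @hglue R k.
Proof. unfold_program thglue hglue. Qed.
#[local] Hint Rewrite thglueE : eval.
Lemma thinclE k G : thincl k G :=> @hincl R k.
Proof. unfold_program thincl hincl. Qed.
#[local] Hint Rewrite thinclE : eval.
Lemma tchoicesE G : tchoices G :=> choices.
Proof. unfold_program tchoices choices. Qed.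
#[local] Hint Rewrite tchoicesE : eval.
Lemma tkeptE k G : tkept k G :=> @kept R k.
Proof. unfold_program tkept kept. Qed.
#[local] Hint Rewrite tkeptE : eval.
Lemma thomE k G : thom k G :=> @hom R k.
Proof. unfold_program thom hom. Qed.
#[local] Hint Rewrite thomE : eval.
Lemma tflistE G : tflist G :=> @flist R.
Proof. unfold_program tflist flist. Qed.
#[local] Hint Rewrite tflistE : eval.
Lemma thom_coefsE k G : thom_coefs k G :=> @hom_coefs R k.
Proof. unfold_program thom_coefs hom_coefs. Qed.
#[local] Hint Rewrite thom_coefsE : eval.
Lemma thom_chartsE k G : thom_charts k G :=> @hom_charts R k.
Proof. unfold_program thom_charts hom_charts. Qed.
#[local] Hint Rewrite thom_chartsE : eval.
Lemma tencodeE G : tencode G :=> @encode R.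
Proof. unfold_program tencode encode. Qed.
#[local] Hint Rewrite tencodeE : eval.
Lemma thom_programE k : eval_term (thom_program k) tt = @hom_program R k.
Proof. unfold_program thom_program hom_program. Qed.

End Evaluation.

(** Structural recursion suffices for the whole computation: [start] does all the work and the
    machine halts before its first step. *)
Definition hom_algorithm k : algorithm (Prod complexT complexT) homT :=
  {| state := homT; start := thom_program k; halted := \l y, TTrue;
     step := \l y, $y; result := \l y, $y |}.

Lemma hom_algorithmP k (R : realType) (c : den R (Prod complexT complexT)) :
  computes (hom_algorithm k) c (hom_program k c).
Proof.
by exists 0%N; split=> //; rewrite -thom_programE.
Qed.

(** * Fourier-Motzkin elimination *)

Lemma fmapE T U (f : T -> U) s : fmap f s = map f s.
Proof. by elim: s => //= x s ->. Qed.

Lemma fcatE T (s t : seq T) : fcat s t = s ++ t.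
Proof. by elim: s => //= x s ->. Qed.

Lemma fnthE T (x0 : T) s : fnth x0 s = nth x0 s.
Proof.
apply/funext => n; elim: s n => [|x s IH] [|n] //=.
Qed.

Lemma fallE T (p : T -> bool) s : fall p s = all p s.
Proof. by elim: s => //= x s ->; case: (p x). Qed.

Lemma fsizeE T (s : seq T) : fsize s = size s.
Proof. by elim: s => //= x s ->. Qed.

Lemma fbindE T U (f : T -> seq U) s : fbind f s = flatten (map f s).
Proof. by elim: s => //= x s ->; rewrite fcatE. Qed.

Lemma fiotaE n : fiota n = iota 0 n.
Proof. by elim: n => // n IH; rewrite -[LHS]/(fcat (fiota n) [:: n]) fcatE IH -addn1 iotaD. Qed.

Lemma faddE m n : fadd m n = (m + n)%N.
Proof. by elim: n => [|n IH]; rewrite ?addn0 // addnS -IH. Qed.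

Lemma fmulE m n : fmul m n = (m * n)%N.
Proof. by elim: n => [|n IH]; rewrite ?muln0 // mulnS addnC -IH -faddE. Qed.

Lemma feqnE m n : feqn m n = (m == n).
Proof. by elim: m n => [|m IH] [|n] //=; exact: IH. Qed.

Lemma fltnE m n : fltn m n = (m < n)%N.
Proof. by elim: m n => [|m IH] [|n] //=; exact: IH. Qed.

Lemma fdivmodE n k : (0 < n)%N -> fdivmod n k = ((k %/ n)%N, (k %% n)%N).
Proof.
move=> n0; elim: k => [|k IH]; first by rewrite div0n mod0n.
rewrite -[LHS]/(if feqn (fdivmod n k).2.+1 n then ((fdivmod n k).1.+1, 0%N)
  else ((fdivmod n k).1, (fdivmod n k).2.+1)) feqnE IH /=.
have lt := ltn_pmod k n0.
have [e|ne] := eqVneq (k %% n).+1 n.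
  have -> : k.+1 = ((k %/ n).+1 * n)%N by rewrite {1}(divn_eq k n) mulSn -addnS e addnC.
  by rewrite mulnK // modnMl.
have lt' : ((k %% n).+1 < n)%N by rewrite ltn_neqAle ne.
have -> : k.+1 = ((k %/ n) * n + (k %% n).+1)%N by rewrite addnS -divn_eq.
by rewrite divnMDl // (divn_small lt') addn0 modnMDl (modn_small lt').
Qed.

Lemma fdivmod_lt n m k : (k < m * n)%N ->
  [/\ (0 < n)%N, ((fdivmod n k).1 < m)%N, ((fdivmod n k).2 < n)%N
   & k = ((fdivmod n k).1 * n + (fdivmod n k).2)%N].
Proof.
move=> lt; have n0 : (0 < n)%N by case: n lt => //; rewrite muln0.
by rewrite fdivmodE //=; split=> //; rewrite ?ltn_divLR ?ltn_pmod // -divn_eq.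
Qed.

Lemma fdivmodMD n p s : (s < n)%N -> fdivmod n (p * n + s) = (p, s).
Proof.
move=> lt; have n0 : (0 < n)%N by case: n lt.
by rewrite fdivmodE // divnMDl // divn_small // addn0 modnMDl modn_small.
Qed.

Definition listE := (fmapE, fcatE, fallE, fsizeE, fbindE, fiotaE, fnthE).

Lemma all_flatten_map T U (p : pred U) (f : T -> seq U) s :
  all p (flatten (map f s)) = all (fun x => all p (f x)) s.
Proof. by elim: s => //= x s IH; rewrite all_cat IH. Qed.

Lemma all_iotaP n (p : pred nat) :
  reflect (forall i, (i < n)%N -> p i) (all p (iota 0 n)).
Proof.
apply: (iffP allP) => H i; last by rewrite mem_iota => /H.
by move=> lt; apply: H; rewrite mem_iota.
Qed.

(** * Finite sums and scalar products of coordinate functions *)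

Section Sums.
Variable R : realType.
Implicit Types (f g c x y : nat -> R) (a b : R).

Lemma fsumE n f : fsum n f = \sum_(j < n) f j.
Proof.
elim: n => [|n IH]; first by rewrite big_ord0.
by rewrite big_ord_recr /= -IH.
Qed.

Lemma dotnE D c x : dotn D c x = \sum_(j < D) c j * x j.
Proof. exact: fsumE. Qed.

Lemma flat_sum n E f :
  \sum_(k < n * E) f k = \sum_(p < n) \sum_(s < E) f (p * E + s)%N.
Proof.
elim: n => [|n IH]; first by rewrite !big_ord0.
rewrite big_ord_recr /= -IH -!(big_mkord xpredT) mulSn addnC.
rewrite (@big_cat_nat _ _ _ (n * E)) //= ?leq_addr //; congr (_ + _).
by rewrite -{1}[(n * E)%N]add0n big_addn addKn big_mkord; apply: eq_bigr => i _; rewrite addnC.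
Qed.

Lemma dotn_flat n E (g : nat -> nat -> R) x :
  dotn (n * E) (flat E g) x = \sum_(p < n) \sum_(s < E) g p s * x (p * E + s)%N.
Proof.
rewrite dotnE (flat_sum _ _ (fun k => flat E g k * x k)); apply: eq_bigr => p _; apply: eq_bigr => s _.
by rewrite /flat fdivmodMD.
Qed.

Lemma dotn_ext D c x y : (forall j, (j < D)%N -> x j = y j) -> dotn D c x = dotn D c y.
Proof. by move=> e; rewrite !dotnE; apply: eq_bigr => j _; rewrite e. Qed.

Lemma dotn_lin D c x y a b :
  dotn D c (fun j => a * x j + b * y j) = a * dotn D c x + b * dotn D c y.
Proof.
rewrite !dotnE !mulr_sumr -big_split; apply: eq_bigr => j _ /=.
by rewrite mulrDr !(mulrCA (c j)).
Qed.

Lemma dotnC D c x : dotn D c x = dotn D x c.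
Proof. by rewrite !dotnE; apply: eq_bigr => j _; rewrite mulrC. Qed.

Lemma dotn_linl D c f x a b :
  dotn D (fun j => a * c j + b * f j) x = a * dotn D c x + b * dotn D f x.
Proof. by rewrite dotnC dotn_lin ![dotn _ x _]dotnC. Qed.

Lemma dotn0l D x : dotn D (fun=> 0) x = 0.
Proof. by rewrite dotnE big1 // => j _; rewrite mul0r. Qed.

Lemma dotnN D c x : dotn D c (fun j => - x j) = - dotn D c x.
Proof. by rewrite !dotnE -sumrN; apply: eq_bigr => j _; rewrite mulrN. Qed.

Lemma dotnNl D c x : dotn D (fun j => - c j) x = - dotn D c x.
Proof. by rewrite dotnC dotnN dotnC. Qed.

Lemma dotn0 D c : dotn D c (fun=> 0) = 0.
Proof. by rewrite dotnE big1 // => j _; rewrite mulr0. Qed.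

Lemma dotn_consv D c a x : dotn D.+1 c (consv a x) = c 0%N * a + dotn D (shift c) x.
Proof. by rewrite !dotnE big_ord_recl. Qed.

Lemma dotn_delta D s x : (s < D)%N -> dotn D (delta R s) x = x s.
Proof.
move=> lt; rewrite dotnE (bigD1 (Ordinal lt)) //= big1 => [|j ne].
  by rewrite /delta feqnE eqxx mul1r addr0.
rewrite /delta feqnE; case: eqP => [e|]; last by rewrite mul0r.
by case/eqP: ne; apply: val_inj.
Qed.

Lemma consv_shift x : consv (x 0%N) (shift x) = x.
Proof. by apply/funext => -[]. Qed.

Lemma inP_all D hs x : inP D hs x = all (sat D x) hs.
Proof. exact: fallE. Qed.

Lemma inPP D hs x : reflect (forall h, h \in hs -> dotn D h.1 x <= h.2) (inP D hs x).
Proof. by rewrite /inP fallE; apply: allP. Qed.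

Lemma inP_cat D hs hs' x : inP D (hs ++ hs') x = inP D hs x && inP D hs' x.
Proof. by rewrite /inP !fallE all_cat. Qed.

Lemma inP_ext D hs x y : (forall j, (j < D)%N -> x j = y j) -> inP D hs x = inP D hs y.
Proof.
move=> e; rewrite /inP !fallE; apply: eq_all => h.
by rewrite /sat (dotn_ext _ e).
Qed.

Lemma inP_eqc D h x : inP D (eqc h) x = (dotn D h.1 x == h.2).
Proof.
by rewrite /inP /= /sat /= dotnNl lerN2 eq_le; case: (_ <= _); case: (_ <= _).
Qed.

End Sums.

Section FourierMotzkin.
Variable R : realType.
Implicit Types (hs : seq (con R)) (x : vec R).

Lemma elim_headP D hs x :
  reflect (forall h h', h \in hs -> h' \in hs -> sat D x (elim_pair h h'))
          (inP D (elim_head hs) x).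
Proof.
rewrite /inP /elim_head !listE all_flatten_map; apply: (iffP allP) => [H h h' hin hin'|H h hin].
  by have := H _ hin; rewrite fmapE all_map => /allP /(_ _ hin').
by rewrite fmapE all_map; apply/allP => h' hin' /=; apply: H.
Qed.

Lemma elim_head_sound D hs a x : inP D.+1 hs (consv a x) -> inP D (elim_head hs) x.
Proof.
move=> /inPP H; apply/elim_headP => h h' /H + /H; rewrite !dotn_consv /elim_pair => H1 H2.
case: ifP => [h0|_]; last by rewrite /sat /= dotn0l.
case: ifP => [h0'|/negbT]; last rewrite -ltNge => h0'.
  have e : h.1 0%N = 0 by apply/eqP; rewrite eq_le h0.
  by move: H1; rewrite e mul0r add0r.
case: ifP => [h1|_]; last by rewrite /sat /= dotn0l.
rewrite /sat /= (_ : (fun _ => _) =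
  fun j => h'.1 0%N * shift h.1 j + (- h.1 0%N) * shift h'.1 j); last first.
  by apply/funext => j; rewrite mulNr.
rewrite dotn_linl.
have := ler_wpM2l h1 H1.
have := ler_wpM2l (_ : 0 <= - h.1 0%N) H2.
rewrite oppr_ge0 => /(_ h0); lra.
Qed.

Lemma list_max (T : eqType) (f : T -> R) (p : pred T) (s : seq T) : has p s ->
  exists2 x, (x \in s) && p x & forall y, y \in s -> p y -> f y <= f x.
Proof.
elim: s => //= x s IH; case: (boolP (has p s)) => [/IH [m /andP[ms pm] H] _|/hasPn H].
  case: (boolP (p x)) => px; last first.
    exists m; first by rewrite inE ms orbT.
    by move=> y; rewrite inE => /predU1P[->|]; [rewrite (negPf px)|exact: H].
  case: (leP (f x) (f m)) => le.
    exists m; first by rewrite inE ms orbT.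
    by move=> y; rewrite inE => /predU1P[->|]; last exact: H.
  exists x; first by rewrite inE eqxx.
  move=> y; rewrite inE => /predU1P[->//|ys py].
  by apply: le_trans (ltW le); apply: H.
rewrite orbF => px; exists x; first by rewrite inE eqxx.
by move=> y; rewrite inE => /predU1P[->//|/H /negPf ->].
Qed.

Lemma foldr_first (T : Type) (f : T -> R) (p : pred R) (a : R) (s : seq T) :
  p (foldr (fun h r => if p (f h) then f h else r) a s) = has (p \o f) s || p a.
Proof. by elim: s => //= h s IH; case: (boolP (p (f h))) => // /negPf ->. Qed.

(** The combinations of pairs say that every lower bound is at most every upper bound, so the
    greatest lower bound is admissible. Without lower bounds the least upper bound is, and without
    bounds every value is. *)
Lemma pick_headP D hs x : inP D (elim_head hs) x ->
  inP D.+1 hs (consv (pick_head D hs x) x).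
Proof.
move=> /elim_headP H.
have satE a h : dotn D.+1 h.1 (consv a x) <= h.2 =
    (h.1 0%N * a <= h.2 - dotn D (shift h.1) x).
  by rewrite dotn_consv lerBrDr.
have neu h a : h \in hs -> h.1 0%N = 0 -> dotn D.+1 h.1 (consv a x) <= h.2.
  move=> hin h0; have := H h h hin hin.
  by rewrite /elim_pair h0 lexx /sat /= satE h0 mul0r subr_ge0.
have pickE : inP D.+1 hs (consv (pick_head D hs x) x) =
    has (fun h => inP D.+1 hs (consv (bound D x h) x)) hs || inP D.+1 hs (consv 0 x).
  exact: (foldr_first (bound D x) (fun a => inP D.+1 hs (consv a x))).
have pickY h : h \in hs -> inP D.+1 hs (consv (bound D x h) x) ->
    inP D.+1 hs (consv (pick_head D hs x) x).
  by move=> hin ok; rewrite pickE; apply/orP; left; apply/hasP; exists h.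
case: (boolP (has (fun h => h.1 0%N < 0) hs)) => [lo|/hasPn lo].
  have [m /andP[ms m0] mmax] := list_max (bound D x) lo.
  apply: (pickY m) => //; apply/inPP => h hin; case: (ltgtP (h.1 0%N) 0) => h0.
  - by rewrite satE mulrC -ler_ndivrMr //; apply: mmax.
  - have := H m h ms hin; rewrite /elim_pair (ltW m0) leNgt m0 /= (ltW h0) /sat /=.
    rewrite (_ : (fun _ => _) = fun j => h.1 0%N * shift m.1 j + (- m.1 0%N) * shift h.1 j);
      last by apply/funext => j; rewrite mulNr.
    rewrite dotn_linl satE /bound => le.
    rewrite mulrA ler_ndivrMr //; lra.
  - exact: neu.
case: (boolP (has (fun h => 0 < h.1 0%N) hs)) => [up|/hasPn up].
  have [m /andP[ms m0] mmin] := list_max (fun h => - bound D x h) up.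
  apply: (pickY m) => //; apply/inPP => h hin; case: (ltgtP (h.1 0%N) 0) => h0.
  - by have := lo _ hin; rewrite h0.
  - by rewrite satE mulrC -ler_pdivlMr // -lerN2; apply: mmin.
  - exact: neu.
have n0 h : h \in hs -> h.1 0%N = 0.
  by move=> hin; have := lo _ hin; have := up _ hin; rewrite -!leNgt => a b; apply/eqP; rewrite eq_le a.
have all_ok a : inP D.+1 hs (consv a x) by apply/inPP => h hin; apply: neu => //; apply: n0.
by rewrite pickE all_ok orbT.
Qed.

Lemma sampleP D hs x : inP D hs x -> inP D hs (sample D hs).
Proof.
elim: D hs x => [|D IH] hs x.
  by rewrite (inP_ext _ (y := sample 0 hs)).
rewrite -(consv_shift x) => /elim_head_sound /IH.
exact: pick_headP.
Qed.

Lemma feasibleP D hs : reflect (exists x, inP D hs x) (feasible D hs).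
Proof. by apply: (iffP idP) => [H|[x /sampleP]] //; exists (sample D hs). Qed.

End FourierMotzkin.

(** * Generators of polytopes and pointed cones *)

Section Affine.
Variables (R : realType) (D : nat).
Implicit Types (phi psi : vec R -> R) (c x y : vec R) (a b : R).

Definition aff phi := exists c b, forall u, phi u = dotn D c u + b.

Lemma aff_const a : aff (fun=> a).
Proof. by exists (fun=> 0), a => u; rewrite dotn0l add0r. Qed.

Lemma aff_dot c : aff (dotn D c).
Proof. by exists c, 0 => u; rewrite addr0. Qed.

Lemma aff_coord s : (s < D)%N -> aff (fun u => u s).
Proof. by move=> lt; exists (delta R s), 0 => u; rewrite addr0 dotn_delta. Qed.

Lemma affD phi psi : aff phi -> aff psi -> aff (fun u => phi u + psi u).
Proof.
move=> [c [b H]] [c' [b' H']]; exists (fun j => 1 * c j + 1 * c' j), (b + b') => u.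
by rewrite H H' dotn_linl; ring.
Qed.

Lemma affZ a phi : aff phi -> aff (fun u => a * phi u).
Proof.
move=> [c [b H]]; exists (fun j => a * c j + 0 * c j), (a * b) => u.
by rewrite H dotn_linl; ring.
Qed.

Lemma affZr a phi : aff phi -> aff (fun u => phi u * a).
Proof. by move=> /(affZ a) [c [b H]]; exists c, b => u; rewrite mulrC. Qed.

Lemma affN phi : aff phi -> aff (fun u => - phi u).
Proof. by move=> /(affZ (- 1)) [c [b H]]; exists c, b => u; rewrite -H mulN1r. Qed.

Lemma affB phi psi : aff phi -> aff psi -> aff (fun u => phi u - psi u).
Proof. by move=> H /affN; apply: affD. Qed.

Lemma aff_sum n (f : nat -> vec R -> R) :
  (forall j, (j < n)%N -> aff (f j)) -> aff (fun u => \sum_(j < n) f j u).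
Proof.
elim: n => [|n IH] H.
  have [c [b E]] := aff_const 0; exists c, b => u; rewrite -E big_ord0 //.
have [c [b E]] := affD (IH (fun j lt => H j (ltnW lt))) (H n (ltnSn n)).
by exists c, b => u; rewrite -E big_ord_recr.
Qed.

Lemma aff_fsum n (f : nat -> vec R -> R) :
  (forall j, (j < n)%N -> aff (f j)) -> aff (fun u => fsum n (fun j => f j u)).
Proof.
by move=> /aff_sum [c [b E]]; exists c, b => u; rewrite fsumE E.
Qed.

Lemma aff_comb phi a b x y : aff phi -> a + b = 1 ->
  phi (fun j => a * x j + b * y j) = a * phi x + b * phi y.
Proof. by move=> [c [d H]] e; rewrite !H dotn_lin -[in LHS](mul1r d) -e; ring. Qed.

Lemma aff_ext phi x y : aff phi -> (forall j, (j < D)%N -> x j = y j) -> phi x = phi y.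
Proof. by move=> [c [d H]] e; rewrite !H (dotn_ext _ e). Qed.

End Affine.

Section ListLemmas.
Variables (R : realType) (T : eqType).

Lemma count_lt (a b : pred T) (s : seq T) (x : T) :
  (forall y, y \in s -> a y -> b y) -> x \in s -> b x -> ~~ a x -> (count a s < count b s)%N.
Proof.
move=> sub + bx ax; elim: s sub => //= y s IH sub; rewrite inE => xs.
have suby : (a y <= b y)%N by have := sub y (mem_head _ _); case: (a y) => // ->.
have subs z : z \in s -> a z -> b z by move=> zs; apply: sub; rewrite inE zs orbT.
have le : (count a s <= count b s)%N.
  by rewrite -!size_filter; elim: s subs {IH sub xs} => //= z s IH sub;
    have := sub z (mem_head _ _); case: (a z) => [->//|_]; [|case: (b z) => /=; [apply: leqW|]];
    apply: IH => t ts; apply: sub; rewrite inE ts orbT.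
case/predU1P: xs => [e|xs]; first by rewrite -e bx (negPf ax) add0n add1n ltnS.
by rewrite -addnS leq_add //; apply: IH.
Qed.

Lemma list_eps (Q : T -> R -> Prop) (s : seq T) :
  (forall h, h \in s -> exists2 e, 0 < e & forall e', 0 < e' -> e' <= e -> Q h e') ->
  exists2 e, 0 < e & forall h, h \in s -> Q h e.
Proof.
move=> H; suff [e e0 He] : exists2 e, 0 < e &
    forall h e', h \in s -> 0 < e' -> e' <= e -> Q h e'.
  by exists e => // h hs; apply: He.
elim: s H => [|x s IH] H; first by exists 1.
have [e e0 He] := IH (fun h hs => H h (mem_behead (s := x :: s) hs)).
have [d d0 Hd] := H x (mem_head _ _).
exists (Num.min d e) => [|h e']; first by rewrite lt_min d0.
by rewrite inE le_min => /predU1P[->|hs] e0' /andP[]; [move=> ? _; apply: Hd|move=> _; apply: He].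
Qed.

Lemma list_big (Q : T -> R -> Prop) (s : seq T) :
  (forall h, h \in s -> exists K, forall K', K <= K' -> Q h K') ->
  exists K, forall h, h \in s -> Q h K.
Proof.
move=> H; suff [K HK] : exists K, forall h K', h \in s -> K <= K' -> Q h K'.
  by exists K => h hs; apply: HK.
elim: s H => [|x s IH] H; first by exists 0.
have [e He] := IH (fun h hs => H h (mem_behead (s := x :: s) hs)).
have [d Hd] := H x (mem_head _ _).
exists (Num.max d e) => h K'.
by rewrite inE ge_max => /predU1P[->|hs] /andP[]; [move=> ? _; apply: Hd|move=> _; apply: He].
Qed.

End ListLemmas.

Section Generators.
Variables (R : realType) (D : nat).
Implicit Types (hs : seq (con R)) (x y : vec R) (phi : vec R -> R).

Definition tight x (h : con R) : bool := dotn D h.1 x == h.2.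

(** For a nonempty polyhedron this is boundedness. In terms of recession directions it can also be
    proved for the slice of a cone without a point of the slice at hand. *)
Definition no_recession hs :=
  forall w, (forall h, h \in hs -> dotn D h.1 w <= 0) -> forall j, (j < D)%N -> w j = 0.

Lemma filter_sublists (p : pred (con R)) hs : seq.filter p hs \in sublists hs.
Proof.
elim: hs => //= h hs IH; rewrite fcatE fmapE mem_cat.
by case: (p h); rewrite ?IH // map_f ?orbT.
Qed.

Lemma mem_gens_poly hs v :
  reflect (exists2 S, S \in sublists hs &
             v = sample D (hs ++ map (@negc R) S) /\ inP D hs v)
          (v \in gens_poly D hs).
Proof.
rewrite /gens_poly fbindE; apply: (iffP flatten_mapP) => [[S Sin]|[S Sin [-> H]]].
  rewrite fcatE fmapE; case: ifP => // H; rewrite inE => /eqP e.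
  by exists S => //; rewrite e.
by exists S => //; rewrite fcatE fmapE H inE.
Qed.

(** For [S] the set of inequalities tight at [x], the point [x] itself shows that the sampled system
    is feasible. *)
Lemma sample_tight hs x : inP D hs x ->
  exists2 v, v \in gens_poly D hs & forall h, h \in hs -> tight x h -> tight v h.
Proof.
move=> Px; set S := seq.filter (tight x) hs.
have HS y : inP D (hs ++ map (@negc R) S) y = inP D hs y && all (tight y) S.
  rewrite inP_cat; case: (boolP (inP D hs y)) => //= /inPP Py.
  rewrite /inP fallE all_map; apply: eq_in_all => h.
  rewrite mem_filter => /andP[_ /Py le] /=.
  by rewrite /sat /tight /= dotnNl lerN2 eq_le le.
have /sampleP : inP D (hs ++ map (@negc R) S) x by rewrite HS Px; apply: filter_all.
rewrite HS => /andP[Pv /allP Tv]; exists (sample D (hs ++ map (@negc R) S)).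
  by apply/mem_gens_poly; exists S => //; apply: filter_sublists.
by move=> h hin hx; apply: Tv; rewrite mem_filter hx.
Qed.

(* Move [x] away from a sampled point of its minimal face on which [phi] is not
   positive, until one more inequality becomes tight. *)
Lemma gens_poly_pos hs phi x : no_recession hs -> aff D phi ->
  inP D hs x -> 0 < phi x -> exists2 v, v \in gens_poly D hs & 0 < phi v.
Proof.
move=> rec aphi; have [m] := ubnP (count (predC (tight x)) hs).
elim: m x => // m IH x; rewrite ltnS => lem Px px.
have [y yg Ty] := sample_tight Px.
have [py|py] := ltP 0 (phi y); first by exists y.
have Py : inP D hs y by case/mem_gens_poly: yg => S _ [].
pose w j := x j - y j.
have wE c : dotn D c w = dotn D c x - dotn D c y.
  rewrite (_ : w = fun j => 1 * x j + (- 1) * y j); last first.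
    by apply/funext => j; rewrite mul1r mulN1r.
  by rewrite dotn_lin mul1r mulN1r.
(* Otherwise [w] is a recession direction, hence 0, and [phi] takes the same value at [x] and
   [y]. *)
have up : has (fun h => 0 < dotn D h.1 w) hs.
  apply/negPn/negP => /hasPn no.
  have /rec w0 : forall h, h \in hs -> dotn D h.1 w <= 0.
    by move=> h /no; rewrite -leNgt.
  have e : phi x = phi y.
    by apply: (aff_ext aphi) => j /w0 /eqP; rewrite subr_eq0 => /eqP.
  by move: px; rewrite e ltNge py.
(* Ratio test: [q h] is the step along [w] after which [h] becomes tight, and the smallest one keeps
   the point in the polyhedron. *)
pose q h := (h.2 - dotn D h.1 x) / dotn D h.1 w.
have [h0 /andP[h0in h0w] hmin] := list_max (fun h => - q h) up.
have slack h : h \in hs -> 0 <= h.2 - dotn D h.1 x by move/inPP: Px => Px /Px; rewrite subr_ge0.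
have q0 : 0 <= q h0 by rewrite divr_ge0 ?slack // ltW.
pose x' j := (1 + q h0) * x j + (- q h0) * y j.
have x'E c : dotn D c x' = dotn D c x + q h0 * dotn D c w.
  by rewrite dotn_lin wE; ring.
apply: (IH x').
- apply: leq_trans lem; apply: (@count_lt _ _ _ _ h0) => //=.
  + move=> h hin; apply: contra => t; move: (t) (Ty _ hin t).
    by rewrite /tight x'E wE => /eqP -> /eqP ->; rewrite subrr mulr0 addr0.
  + apply/negP => t; move: (t) (Ty _ h0in t).
    rewrite /tight => /eqP e1 /eqP e2.
    by move: h0w; rewrite wE e1 e2 subrr ltxx.
  + by rewrite /tight x'E /q divfK ?negbK; [rewrite addrC subrK|rewrite gt_eqF].
- apply/inPP => h hin; rewrite x'E -lerBrDl.
  have [hw|hw] := ltP 0 (dotn D h.1 w).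
    by rewrite -ler_pdivlMr // -lerN2 hmin.
  by apply: le_trans (slack _ hin); rewrite mulr_ge0_le0.
- rewrite (aff_comb _ _ aphi); last by ring.
  have : 0 <= - phi y by rewrite oppr_ge0.
  move=> py'; have := mulr_ge0 q0 py'; have := mulr_ge0 q0 (ltW px); lra.
Qed.

Lemma bounded_no_recession hs x0 B : inP D hs x0 ->
  (forall x, inP D hs x -> forall j, (j < D)%N -> `|x j| <= B) -> no_recession hs.
Proof.
move=> P0 bd w wrec j jD; apply/eqP/negP => /negP w0.
have B0 : 0 <= B by apply: le_trans (bd _ P0 _ jD).
have nw : 0 < `|w j| by rewrite normr_gt0.
(* The displacement by [s * w] has length 2 * B + 1 in coordinate [j], more than two points bounded
   by [B] can differ. *)
pose s := (2 * B + 1) / `|w j|.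
have s0 : 0 <= s by rewrite divr_ge0 ?normr_ge0 //; lra.
have Ps : inP D hs (fun j => 1 * x0 j + s * w j).
  apply/inPP => h hin; rewrite dotn_lin mul1r.
  move/inPP: P0 => /(_ h hin) le; have := mulr_ge0_le0 s0 (wrec _ hin); lra.
have := bd _ Ps _ jD; have := bd _ P0 _ jD.
have e : `|s * w j| = 2 * B + 1 by rewrite normrM (ger0_norm s0) /s divfK ?gt_eqF.
rewrite mul1r => l1 l2.
have := ler_normB (x0 j + s * w j) (x0 j).
rewrite addrAC subrr add0r e; lra.
Qed.

(** Inequalities tight at [x] are tight at [y], hence constant along the line through both; the
    others have slack at [x], which a small step does not exhaust. *)
Lemma push hs x y : inP D hs x -> inP D hs y ->
  (forall h, h \in hs -> tight x h -> tight y h) ->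
  exists2 e, 0 < e & inP D hs (fun j => (1 + e) * x j + (- e) * y j).
Proof.
move=> /inPP Px /inPP Py T.
have [|e e0 He] := @list_eps R _ (fun h e => dotn D h.1 (fun j => (1 + e) * x j + (- e) * y j) <= h.2) hs.
  move=> h hin; have := T h hin; rewrite /tight; case: eqP => [e1 /(_ isT) /eqP e2|ne _].
    by exists 1 => // e' _ _; rewrite dotn_lin e1 e2 -mulrDl addrK mul1r.
  have sl : 0 < h.2 - dotn D h.1 x by rewrite subr_gt0 lt_neqAle Px // andbT; apply/eqP.
  have [d0|d0] := leP (dotn D h.1 x - dotn D h.1 y) 0.
    exists 1 => // e' e0 _; rewrite dotn_lin.
    have := mulr_ge0_le0 (ltW e0) d0; lra.
  exists ((h.2 - dotn D h.1 x) / (dotn D h.1 x - dotn D h.1 y)); first exact: divr_gt0.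
  move=> e' e0; rewrite ler_pdivlMr // dotn_lin; lra.
by exists e => //; apply/inPP.
Qed.

(** A point in the relative interior of [F]. The inequalities are treated one by one: if some point
    of [F] leaves one slack, averaging with it makes that inequality slack and creates no new tight
    one. *)
Lemma generic_point hs (F : vec R -> Prop) x0 :
  (forall x, F x -> inP D hs x) ->
  (forall x y, F x -> F y -> F (fun j => 2^-1 * x j + 2^-1 * y j)) -> F x0 ->
  exists2 x, F x & forall h z, h \in hs -> tight x h -> F z -> tight z h.
Proof.
move=> FP mid F0; suff : forall s : seq (con R), {subset s <= hs} ->
  exists2 x, F x & forall h z, h \in s -> tight x h -> F z -> tight z h by apply.
elim=> [|h s IH] sub; first by exists x0.
have [|x Fx Hx] := IH; first by move=> h' h's; apply: sub; rewrite inE h's orbT.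
case: (EM (exists2 z, F z & ~~ tight z h)) => [[z Fz nz]|no]; last first.
  exists x => // h' z; rewrite inE => /predU1P[->|h's] t Fz; last exact: Hx t Fz.
  by apply/negPn/negP => nz; apply: no; exists z.
exists (fun j => 2^-1 * x j + 2^-1 * z j); first exact: mid.
have key h' : h' \in hs -> tight (fun j => 2^-1 * x j + 2^-1 * z j) h' -> tight x h' && tight z h'.
  move=> h'in; rewrite /tight dotn_lin => /eqP e.
  have := FP _ Fx; have := FP _ Fz; move=> /inPP /(_ _ h'in) l1 /inPP /(_ _ h'in) l2.
  by rewrite !eq_le l1 l2 /=; apply/andP; split; lra.
move=> h' y; rewrite inE => /predU1P[->|h's].
  by move=> /key; rewrite (negPf nz) andbF sub ?mem_head // => /(_ isT).
move=> /key; rewrite sub ?inE ?h's ?orbT // => /(_ isT) /andP[t _]; exact: Hx.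
Qed.

(** Otherwise the small step from [x] away from [z] given by [push] would violate the supporting
    inequality. *)
Lemma tight_supp hs (h0 : con R) x z :
  (forall y, inP D hs y -> dotn D h0.1 y <= h0.2) -> inP D hs x -> tight x h0 -> inP D hs z ->
  (forall h, h \in hs -> tight x h -> tight z h) -> tight z h0.
Proof.
move=> supp Px tx Pz T; have [e e0 /supp] := push Px Pz T.
move/eqP: tx => tx; have le := supp _ Pz; rewrite dotn_lin tx => le'.
rewrite /tight eq_le le /=.
have : 0 <= e * (dotn D h0.1 z - h0.2) by lra.
by rewrite pmulr_rge0 // subr_ge0.
Qed.

Definition kind_ok (k : complex_kind) hs : Prop :=
  match k with
  | Polytopal => no_recession hs
  | Conical => (forall h, h \in hs -> h.2 = 0) /\
      forall x, inP D hs x -> inP D hs (fun j => - x j) -> forall j, (j < D)%N -> x j = 0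
  end.

Lemma cone_scale hs a x : (forall h, h \in hs -> h.2 = 0) -> 0 <= a ->
  inP D hs x -> inP D hs (fun j => a * x j).
Proof.
move=> h0 a0 /inPP Px; apply/inPP => h hin.
rewrite (_ : (fun _ => _) = fun j => a * x j + 0 * x j); last first.
  by apply/funext => j; rewrite mul0r addr0.
by rewrite dotn_lin mul0r addr0 (h0 _ hin) mulr_ge0_le0 // -(h0 _ hin); apply: Px.
Qed.

Lemma cone0 hs : (forall h, h \in hs -> h.2 = 0) -> inP D hs (fun=> 0).
Proof. by move=> h0; apply/inPP => h hin; rewrite dotn0 h0. Qed.

(** Test the supporting functional at the origin and at twice [x]. *)
Lemma cone_supp0 hs (h0 : con R) x : (forall h, h \in hs -> h.2 = 0) ->
  (forall y, inP D hs y -> dotn D h0.1 y <= h0.2) -> inP D hs x -> tight x h0 -> h0.2 = 0.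
Proof.
move=> h0' supp Px /eqP tx.
have := supp _ (cone0 h0'); rewrite dotn0 => le.
have := supp _ (cone_scale h0' (ler0n _ 2) Px).
rewrite (_ : (fun _ => _) = fun j => 2%:R * x j + 0 * x j); last first.
  by apply/funext => j; rewrite mul0r addr0.
rewrite dotn_lin tx => le'; apply/eqP; rewrite eq_le le andbT; lra.
Qed.

Lemma gens_in k hs v : kind_ok k hs -> v \in gens k D hs -> inP D hs v.
Proof.
case: k => [_ /mem_gens_poly [S _ []]//|[h0 _]] /=.
rewrite inE => /predU1P[->|/mem_gens_poly[S _ [_]]]; first exact: cone0.
by rewrite fcatE inP_cat => /andP[].
Qed.

Lemma dotn_height hs x : dotn D (height hs) x = \sum_(h <- hs) dotn D h.1 x.
Proof.
elim: hs => [|h hs IH]; first by rewrite big_nil dotn0l.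
rewrite big_cons -IH (_ : height _ = fun j => 1 * h.1 j + 1 * height hs j); last first.
  by apply/funext => j; rewrite !mul1r.
by rewrite dotn_linl !mul1r.
Qed.

Lemma height_le0 hs x : (forall h, h \in hs -> dotn D h.1 x <= 0) ->
  dotn D (height hs) x <= 0 /\
  (dotn D (height hs) x = 0 -> forall h, h \in hs -> dotn D h.1 x = 0).
Proof.
move=> le; rewrite dotn_height; split; first by rewrite big_seq; apply: sumr_le0.
move=> /eqP; rewrite -oppr_eq0 -sumrN big_seq psumr_eq0 => [/allP H h hin|h /le]; last first.
  by rewrite oppr_ge0.
by have := H h hin; rewrite hin oppr_eq0 => /eqP.
Qed.

(** In the conical case [phi] is linear and every nonzero point of the cone has a positive multiple
    on the slice of height -1, to which [gens_poly_pos] applies. *)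
Lemma gens_le0 k hs phi : kind_ok k hs -> aff D phi -> (k = Conical -> phi (fun=> 0) = 0) ->
  (forall v, v \in gens k D hs -> phi v <= 0) -> forall x, inP D hs x -> phi x <= 0.
Proof.
move=> ok aphi phi0 H x Px; rewrite leNgt; apply/negP => px.
case: k ok phi0 H => [rec _ H|[h0 pt] /(_ erefl) phi0 H].
  by have [v /H] := gens_poly_pos rec aphi Px px; rewrite leNgt => /negP.
have [le0 eq0] : dotn D (height hs) x <= 0 /\
    (dotn D (height hs) x = 0 -> forall h, h \in hs -> dotn D h.1 x = 0).
  by apply: height_le0 => h hin; rewrite -(h0 h hin); move/inPP: Px; apply.
have phi_ext y : (forall j, (j < D)%N -> y j = 0) -> phi y = 0.
  by move=> y0; rewrite (aff_ext aphi (y := fun=> 0)).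
case: (ltgtP (dotn D (height hs) x) 0) le0 => // [lt0|e] _; last first.
  have /phi_ext x0 : forall j, (j < D)%N -> x j = 0.
    apply: pt => //; apply/inPP => h hin.
    by rewrite dotnN (eq0 e) // oppr0 h0.
  by move: px; rewrite x0 ltxx.
pose hs' := hs ++ eqc (height hs, - 1).
(* A recession direction of the slice lies in the cone at height 0, hence is 0 because the cone is
   pointed. *)
have rec : no_recession hs'.
  move=> w wrec.
  have wh h : h \in hs -> dotn D h.1 w <= 0 by move=> hin; apply: wrec; rewrite mem_cat hin.
  have [_ weq] := height_le0 wh.
  have l1 : dotn D (height hs) w <= 0.
    by apply: (wrec (height hs, - 1)); rewrite mem_cat !inE eqxx !orbT.
  have : dotn D (negc (height hs, - 1)).1 w <= 0.
    by apply: wrec; rewrite mem_cat !inE eqxx !orbT.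
  rewrite /= dotnNl oppr_le0 => l2.
  have /weq e : dotn D (height hs) w = 0 by apply/eqP; rewrite eq_le l1 l2.
  apply: pt; apply/inPP => h hin; first by rewrite e // h0.
  by rewrite dotnN e // oppr0 h0.
pose a := (- dotn D (height hs) x)^-1.
have a0 : 0 < a by rewrite invr_gt0 oppr_gt0.
have aE : (fun j => a * x j) = fun j => a * x j + (1 - a) * (fun=> 0) j.
  by apply/funext => j; rewrite mulr0 addr0.
have [||v vg] := gens_poly_pos rec aphi (x := fun j => a * x j).
- rewrite inP_cat cone_scale // ?ltW // inP_eqc /= aE dotn_lin dotn0 mulr0 addr0.
  by rewrite /a invrN mulNr mulVf // lt_eqF.
- by rewrite aE (aff_comb _ _ aphi) ?phi0 ?mulr0 ?addr0 ?mulr_gt0 // addrC subrK.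
by rewrite ltNge H // inE fcatE vg orbT.
Qed.

(* Adding a large multiple of the functional of the face makes [chi]
   nonpositive on the generators outside the face. *)
Lemma gens_face k hs (h0 : con R) chi : kind_ok k hs ->
  (forall y, inP D hs y -> dotn D h0.1 y <= h0.2) -> aff D chi ->
  (forall v, v \in gens k D hs -> tight v h0 -> chi v = 0) ->
  forall x, inP D hs x -> tight x h0 -> chi x = 0.
Proof.
move=> ok supp.
suff main chi' : aff D chi' -> (forall v, v \in gens k D hs -> tight v h0 -> chi' v = 0) ->
    forall x, inP D hs x -> tight x h0 -> chi' x <= 0.
  move=> achi H x Px tx; apply/eqP; rewrite eq_le main //= -oppr_le0.
  apply: (main (fun u => - chi u)) => //; first exact: affN.
  by move=> v vg tv; rewrite H // oppr0.
move=> {chi} achi H x Px tx.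
have [|K HK] := @list_big R _ (fun v K => chi' v + K * (dotn D h0.1 v - h0.2) <= 0) (gens k D hs).
  move=> v vg; have := supp _ (gens_in ok vg); rewrite le_eqVlt => /predU1P[e|lt].
    by exists 0 => K' _; rewrite H // /tight e // subrr mulr0 addr0.
  exists (chi' v / (h0.2 - dotn D h0.1 v)) => K'.
  rewrite ler_pdivrMr ?subr_gt0 //; lra.
have := gens_le0 ok (phi := fun u => chi' u + K * (dotn D h0.1 u - h0.2)) _ _ HK Px.
rewrite (eqP tx) subrr mulr0 addr0; apply.
  by apply: affD => //; apply: affZ; apply: affB; [apply: aff_dot|apply: aff_const].
move=> e; subst k; case: ok => h0' _.
have b0 := cone_supp0 h0' supp Px tx.
rewrite b0 dotn0 subr0 mulr0 addr0; apply: H; first by rewrite inE eqxx.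
by rewrite /tight dotn0 b0.
Qed.

Lemma gens_eq k hs chi : kind_ok k hs -> aff D chi ->
  (forall v, v \in gens k D hs -> chi v = 0) -> forall x, inP D hs x -> chi x = 0.
Proof.
move=> ok achi H x Px; apply: (gens_face (h0 := (fun=> 0, 0)) ok _ achi _ Px).
- by move=> y _; rewrite dotn0l.
- by move=> v /H.
- by rewrite /tight dotn0l.
Qed.

End Generators.

(** * Complexes in coordinates *)

(* [at_ i u y]: the point [u] of the [i]-th cell represents [y]. *)
Record geometric (R : realType) (k : complex_kind) (T : Type) (U : udata R)
    (at_ : nat -> vec R -> T -> Prop) : Prop := Geometric {
  geo_lt : forall i u y, at_ i u y -> (i < ncell U)%N;
  geo_ne : forall i, (i < ncell U)%N -> exists u, inP (udim U) (ineqs U i) u;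
  geo_in : forall i u y, at_ i u y -> inP (udim U) (ineqs U i) u;
  geo_ex : forall i u, (i < ncell U)%N -> inP (udim U) (ineqs U i) u -> exists y, at_ i u y;
  geo_fun : forall i u y y', at_ i u y -> at_ i u y' -> y = y';
  geo_inj : forall i u v y, at_ i u y -> at_ i v y ->
    forall s, (s < udim U)%N -> u s = v s;
  geo_ext : forall i u v y, at_ i u y ->
    (forall s, (s < udim U)%N -> u s = v s) -> at_ i v y;
  geo_supp : forall i j u, (i < ncell U)%N -> (j < ncell U)%N ->
    inP (udim U) (ineqs U i) u ->
    dotn (udim U) (gluing U i j).1.1 u <= (gluing U i j).1.2;
  geo_meet : forall i j u v y, at_ i u y -> at_ j v y -> tight (udim U) u (gluing U i j).1;
  geo_glue : forall i j u y, (j < ncell U)%N -> at_ i u y ->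
    tight (udim U) u (gluing U i j).1 -> at_ j (gapply (udim U) (gluing U i j) u) y;
  geo_face : forall i (h : con R) u0, (i < ncell U)%N ->
    (forall u, inP (udim U) (ineqs U i) u -> dotn (udim U) h.1 u <= h.2) ->
    inP (udim U) (ineqs U i) u0 -> tight (udim U) u0 h ->
    exists2 l, (l < ncell U)%N & forall y, (exists v, at_ l v y) <->
      (exists2 u, at_ i u y & tight (udim U) u h);
  geo_kind : match k with
    | Polytopal => exists B, forall i, (i < ncell U)%N ->
        forall u, inP (udim U) (ineqs U i) u -> forall s, (s < udim U)%N -> `|u s| <= B
    | Conical => forall i, (i < ncell U)%N -> kind_ok (udim U) Conical (ineqs U i)
    end
}.

Lemma geo_kind_ok R k T U (at_ : nat -> vec R -> T -> Prop) i :
  geometric k U at_ -> (i < ncell U)%N -> kind_ok (udim U) k (ineqs U i).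
Proof.
move=> geo lt; have := geo_kind geo; case: k geo => geo; last exact.
by move=> [B /(_ i lt)]; have [u /bounded_no_recession] := geo_ne geo lt; apply.
Qed.

Definition mx_fun (R : realType) a b (A : 'M[R]_(a, b)) (i j : nat) : R :=
  match insub i, insub j with Some i', Some j' => A i' j' | _, _ => 0 end.

Lemma mx_funE (R : realType) a b (A : 'M[R]_(a, b)) (i : 'I_a) (j : 'I_b) :
  mx_fun A i j = A i j.
Proof. by rewrite /mx_fun !valK. Qed.

Lemma mx_fun_out (R : realType) a b (A : 'M[R]_(a, b)) i j : (b <= j)%N -> mx_fun A i j = 0.
Proof. by move=> le; rewrite /mx_fun; case: insub => // i'; rewrite insubN // -leqNgt. Qed.

(** * Interpolation of affine and linear maps from their values at the generators *)

Section Points.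
Variables (R : realType) (k : complex_kind) (U : udata R).
Local Notation n := (ncell U).
Local Notation D := (udim U).
Local Notation NP := (npt k U).

Lemma ptP p : (p < NP)%N -> (ptcell k U p < n)%N /\
  ptvec k U p \in gens k D (ineqs U (ptcell k U p)).
Proof.
rewrite /npt fsizeE /ptcell /ptvec fnthE => lt.
have := mem_nth (0%N, fun=> 0) lt; set q := nth _ _ _.
rewrite {1}/points fbindE => /flatten_mapP[i].
rewrite fiotaE mem_iota add0n => ltn; rewrite fmapE => /mapP[v vg ->] //.
Qed.

Lemma ptE i v : (i < n)%N -> v \in gens k D (ineqs U i) ->
  exists p, [/\ (p < NP)%N, ptcell k U p = i & ptvec k U p = v].
Proof.
move=> lt vg; have H : (i, v) \in points k U.
  rewrite /points fbindE; apply/flatten_mapP; exists i.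
    by rewrite fiotaE mem_iota add0n.
  by rewrite fmapE map_f.
exists (index (i, v) (points k U)).
by rewrite /npt fsizeE index_mem /ptcell /ptvec fnthE nth_index.
Qed.

(* [ginv] is a generalised inverse of the matrix of the homogenised points. *)
Lemma ginvP i p r : (p < NP)%N -> (r < D.+1)%N ->
  \sum_(r' < D.+1) \sum_(p' < NP)
     ptmx k U i p r' * ptmx k U i p' r * ginv k U i (r' * NP + p')%N = ptmx k U i p r.
Proof.
move=> lp lr; set hs := fbind (fun p => fbind (fun r =>
  eqc (flat NP (fun r' p' => ptmx k U i p r' * ptmx k U i p' r), ptmx k U i p r))
  (fiota D.+1)) (fiota NP).
have HS x : reflect (forall p r, (p < NP)%N -> (r < D.+1)%N ->
    \sum_(r' < D.+1) \sum_(p' < NP)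
      ptmx k U i p r' * ptmx k U i p' r * x (r' * NP + p')%N = ptmx k U i p r)
    (inP (fmul D.+1 NP) hs x).
  rewrite /inP /hs !listE all_flatten_map fmulE; apply: (iffP (all_iotaP _ _)) => H.
    move=> p1 r1 /H; rewrite !listE all_flatten_map => /all_iotaP /[apply].
    by rewrite -inP_all inP_eqc /= dotn_flat => /eqP.
  move=> p1 lp1; rewrite !listE all_flatten_map; apply/all_iotaP => r1 lr1.
  by rewrite -inP_all inP_eqc /= dotn_flat H.
have : inP (fmul D.+1 NP) hs (sample (fmul D.+1 NP) hs); last by move=> /HS; apply.
(* The system defining [ginv] is solvable, with the pseudo-inverse of [M] as a solution; [sampleP]
   then applies. *)
pose M := \matrix_(p < NP, r < D.+1) ptmx k U i p r.
have := mulmxKpV (submx_refl M); move: (pinvmx M) => P MPM.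
apply: (@sampleP _ _ _ (flat NP (mx_fun P))).
apply/HS => {lp lr p r} p r lp lr.
have := congr1 (fun A : 'M[R]_(NP, D.+1) => A (Ordinal lp) (Ordinal lr)) MPM.
rewrite !mxE /= => <-.
rewrite exchange_big /=; apply: eq_bigr => p' _; rewrite !mxE mulr_suml.
apply: eq_bigr => r' _; rewrite !mxE /flat fdivmodMD //= mx_funE.
by rewrite mulrAC.
Qed.

(** Row [D] of [A] is the translation, which [homv] multiplies by 0 in the conical case. *)
Definition haff (A : nat -> vec R) (u : vec R) : vec R :=
  fun s => \sum_(r < D.+1) homv k U u r * A r s.

Lemma aff_homv r : (r < D.+1)%N -> aff D (fun u => homv k U u r).
Proof.
rewrite ltnS leq_eqVlt /homv fltnE => /predU1P[->|lt].
  by rewrite ltnn; apply: aff_const.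
by rewrite lt; apply: aff_coord.
Qed.

Lemma aff_haff A s : aff D (fun u => haff A u s).
Proof. by apply: (aff_sum (f := fun r u => homv k U u r * A r s)) => r lt; apply/affZr/aff_homv. Qed.

Lemma homv0 r : k = Conical -> homv k U (fun=> 0) r = 0.
Proof. by move=> ->; rewrite /homv; case: ifP. Qed.

Lemma haff0 A : k = Conical -> haff A (fun=> 0) = fun=> 0.
Proof. by move=> kc; apply/funext => s; rewrite /haff big1 // => r _; rewrite homv0 // mul0r. Qed.

Lemma lamvE i u p : lamv k U i u p = \sum_(r < D.+1) homv k U u r * lamx k U i r p.
Proof. exact: fsumE. Qed.

Lemma lamv_out i u p : ptcell k U p != i -> lamv k U i u p = 0.
Proof. by move=> /negPf ne; rewrite lamvE big1 // => r _; rewrite /lamx feqnE ne mulr0. Qed.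

(** Interpolating the values of an affine map gives back these values: this is M G M A = M A, read
    in row [p]. *)
Lemma lamv_haff A p s : (p < NP)%N ->
  \sum_(p' < NP) lamv k U (ptcell k U p) (ptvec k U p) p' * haff A (ptvec k U p') s
  = haff A (ptvec k U p) s.
Proof.
move=> lp; set i := ptcell k U p.
have E r : (r < D.+1)%N -> \sum_(p' < NP) lamv k U i (ptvec k U p) p' * homv k U (ptvec k U p') r
    = homv k U (ptvec k U p) r.
  move=> lr; have pE r' : ptmx k U i p r' = homv k U (ptvec k U p) r'.
    by rewrite /ptmx feqnE eqxx.
  rewrite -[RHS]pE -(ginvP i lp lr) exchange_big /=; apply: eq_bigr => p' _.
  rewrite lamvE mulr_suml; apply: eq_bigr => r' _.
  rewrite pE /lamx /ptmx !feqnE faddE fmulE.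
  by case: ifP => _; rewrite ?(mulr0, mul0r) // mulrAC.
rewrite /haff; under eq_bigr => p' _ do rewrite mulr_sumr.
rewrite exchange_big /=; apply: eq_bigr => r _.
by rewrite -(E r) // mulr_suml; apply: eq_bigr => p' _; rewrite mulrA.
Qed.

End Points.

(** * The linear conditions on the values of a map at the generators *)

Section HomCells.
Variables (R : realType) (k : complex_kind) (U V : udata R).
Local Notation n := (ncell U).
Local Notation D := (udim U).
Local Notation E := (udim V).
Local Notation NP := (npt k U).
Local Notation pc := (ptcell k U).
Local Notation pv := (ptvec k U).
Local Notation N := (hdim k U V).
Implicit Types (f : seq nat) (W : vec R).

Definition ptrow (W : vec R) (p : nat) : vec R := fun s => W (p * E + s)%N.

Definition fval (W : vec R) (i : nat) (u : vec R) : vec R :=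
  fun s => \sum_(p < NP) lamv k U i u p * ptrow W p s.

Lemma fval_haff W i u :
  fval W i u = haff k U (fun r s => \sum_(p < NP) lamx k U i r p * ptrow W p s) u.
Proof.
apply/funext => s; rewrite /fval /haff.
under eq_bigr => p _ do rewrite lamvE mulr_suml.
rewrite exchange_big; apply: eq_bigr => r _ /=; rewrite mulr_sumr.
by apply: eq_bigr => p _; rewrite mulrA.
Qed.

Lemma aff_fval W i s : aff D (fun u => fval W i u s).
Proof.
have [c [b H]] := aff_haff k U (fun r s => \sum_(p < NP) lamx k U i r p * ptrow W p s) s.
by exists c, b => u; rewrite fval_haff.
Qed.

Lemma fval0 W i : k = Conical -> fval W i (fun=> 0) = fun=> 0.
Proof. by move=> kc; rewrite fval_haff haff0. Qed.

Lemma aff_dot_fval W i c : aff D (fun u => dotn E c (fval W i u)).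
Proof.
have := aff_sum (D := D) (n := E) (f := fun s u => c s * fval W i u s).
move=> [|a [b H]]; first by move=> s _; apply/affZ/aff_fval.
by exists a, b => u; rewrite dotnE H.
Qed.

Lemma dotn_at_pt p c W : (p < NP)%N -> dotn N (at_pt V p c) W = dotn E c (ptrow W p).
Proof.
move=> lp; rewrite /hdim fmulE /at_pt dotn_flat (bigD1 (Ordinal lp)) //= feqnE eqxx [X in _ + X]big1 => [|p' ne].
  by rewrite addr0 dotnE.
rewrite big1 // => s _; rewrite feqnE; case: eqP => [e|]; last by rewrite mul0r.
by case/eqP: ne; apply: val_inj.
Qed.

Definition glue_test p i : bool := (gluing U (pc p) i).1.2 <= dotn D (gluing U (pc p) i).1.1 (pv p).

Lemma hconsP f W : inP N (hcons k U V f) W <->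
  forall p, (p < NP)%N -> inP E (ineqs V (nth 0%N f (pc p))) (ptrow W p) /\
    forall i, (i < n)%N -> glue_test p i ->
      let g := gluing V (nth 0%N f (pc p)) (nth 0%N f i) in
      tight E (ptrow W p) g.1 /\
      forall s, (s < E)%N -> gapply E g (ptrow W p) s = fval W i (gapply D (gluing U (pc p) i) (pv p)) s.
Proof.
have A : inP N (consA k U V f) W <->
    forall p, (p < NP)%N -> inP E (ineqs V (nth 0%N f (pc p))) (ptrow W p).
  rewrite /inP /consA !listE all_flatten_map; split=> [/all_iotaP H p lp|H].
    have := H p lp; rewrite fallE fmapE all_map; congr is_true; apply: eq_all => h.
    by rewrite /= /sat /= dotn_at_pt.
  apply/all_iotaP => p lp; have := H p lp; rewrite fallE fmapE all_map; congr is_true.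
  by apply: eq_all => h; rewrite /= /sat /= dotn_at_pt.
have B p i s : (p < NP)%N -> (s < E)%N ->
   let g := gluing V (nth 0%N f (pc p)) (nth 0%N f i) in
   inP N (eqc (flat E (fun p' s' => (if feqn p' p then g.2.1 s' s else 0) +
             - (if feqn s' s then lamv k U i (gapply D (gluing U (pc p) i) (pv p)) p' else 0)),
           - g.2.2 s)) W =
   (gapply E g (ptrow W p) s == fval W i (gapply D (gluing U (pc p) i) (pv p)) s).
  move=> lp ls g; set l := lamv _ _ _ _; rewrite inP_eqc /hdim fmulE dotn_flat /=.
  have -> : \sum_(p' < NP) \sum_(s' < E) ((if feqn p' p then g.2.1 s' s else 0) +
      - (if feqn s' s then l p' else 0)) * W (p' * E + s')%N =
      \sum_(s' < E) ptrow W p s' * g.2.1 s' s - \sum_(p' < NP) l p' * ptrow W p' s.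
    transitivity (\sum_(p' < NP) ((if p' == Ordinal lp then
        \sum_(s' < E) ptrow W p s' * g.2.1 s' s else 0) - l p' * ptrow W p' s)).
      apply: eq_bigr => p' _; rewrite -(inj_eq val_inj) /=.
      under eq_bigr => s' _ do rewrite mulrBl !feqnE.
      rewrite sumrB; congr (_ - _).
        case: eqP => [->|_]; first by apply: eq_bigr => s' _; rewrite mulrC.
        by rewrite big1 // => s' _; rewrite mul0r.
      rewrite (bigD1 (Ordinal ls)) //= eqxx big1 ?addr0 // => s' ne.
      by case: eqP => [e|]; [case/eqP: ne; apply: val_inj|rewrite mul0r].
    by rewrite sumrB -big_mkcond big_pred1_eq.
  rewrite /gapply fsumE -subr_eq0 -[in RHS]subr_eq0 opprK; congr (_ == 0).
  by rewrite addrAC.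
have C : inP N (consB k U V f) W <-> forall p i, (p < NP)%N -> (i < n)%N -> glue_test p i ->
      let g := gluing V (nth 0%N f (pc p)) (nth 0%N f i) in
      tight E (ptrow W p) g.1 /\
      forall s, (s < E)%N -> gapply E g (ptrow W p) s = fval W i (gapply D (gluing U (pc p) i) (pv p)) s.
  rewrite /inP /consB !listE all_flatten_map.
  have step p i : (p < NP)%N -> glue_test p i ->
     let g := gluing V (nth 0%N f (pc p)) (nth 0%N f i) in
     all (sat N W) (fcat (eqc (at_pt V p g.1.1, g.1.2))
        (fbind (fun s => eqc
          (flat E (fun p' s' =>
             (if feqn p' p then g.2.1 s' s else 0) +
             - (if feqn s' s then lamv k U i (gapply D (gluing U (pc p) i) (pv p)) p' else 0)),
           - g.2.2 s)) (iota 0 E))) <-> tight E (ptrow W p) g.1 /\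
      forall s, (s < E)%N -> gapply E g (ptrow W p) s = fval W i (gapply D (gluing U (pc p) i) (pv p)) s.
    move=> lp gt g; rewrite !listE all_cat all_flatten_map -inP_all inP_eqc dotn_at_pt //.
    rewrite /tight; split=> [/andP[-> /all_iotaP H]|[-> H]].
      by split=> // s ls; apply/eqP; rewrite -B // inP_all; apply: H.
    by apply/all_iotaP => s ls; rewrite -inP_all B // H.
  split=> [/all_iotaP H p i lp li gt|H].
    have := H p lp; rewrite fbindE all_flatten_map => /all_iotaP /(_ i li) /=.
    by rewrite -/(glue_test p i) gt => /step; apply.
  apply/all_iotaP => p lp; rewrite fbindE all_flatten_map; apply/all_iotaP => i li /=.
  by rewrite -/(glue_test p i); case: ifP => // gt; apply/step => //; apply: H.
rewrite /hcons fcatE inP_cat; split=> [/andP[/A a /C c] p lp|H].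
  by split=> [|i li gt]; [apply: a|apply: c].
by apply/andP; split; [apply/A => p /H []|apply/C => p i /H [_] /[apply] /[apply]].
Qed.

End HomCells.

(** * Gluing maps and their fixed points *)

Section GeometricFacts.
Variables (R : realType) (k : complex_kind) (T : Type) (U : udata R).
Variables (at_ : nat -> vec R -> T -> Prop).
Hypothesis geo : geometric k U at_.
Local Notation D := (udim U).

Lemma aff_gapply d (g : glue R) s : aff d (fun x => gapply d g x s).
Proof.
apply: affD; last exact: aff_const.
by apply: (aff_fsum (f := fun r x => x r * g.2.1 r s)) => r lt; apply/affZr/aff_coord.
Qed.

Lemma gapply0 d (g : glue R) s : gapply d g (fun=> 0) s = g.2.2 s.
Proof. by rewrite /gapply fsumE big1 ?add0r // => r _; rewrite mul0r. Qed.

Lemma glue_refl i u y : at_ i u y -> tight D u (gluing U i i).1 /\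
  forall s, (s < D)%N -> gapply D (gluing U i i) u s = u s.
Proof.
move=> a; have lt := geo_lt geo a; have t := geo_meet geo a a.
by split=> // s ls; apply: (geo_inj geo (geo_glue geo lt a t) a).
Qed.

(* The origin is the only point of a pointed cone that is not the midpoint of
   two others, so an affine isomorphism between faces of cones fixes it. *)
Lemma cone_glue0 i j v y : k = Conical -> at_ i (fun=> 0) y -> at_ j v y ->
  forall s, (s < D)%N -> (gluing U i j).2.2 s = 0.
Proof.
move=> kc ai aj.
have li := geo_lt geo ai; have lj := geo_lt geo aj.
have [hi pi] : kind_ok D Conical (ineqs U i) by rewrite -kc; apply: (geo_kind_ok geo li).
have [hj pj] : kind_ok D Conical (ineqs U j) by rewrite -kc; apply: (geo_kind_ok geo lj).
pose t := gapply D (gluing U i j) (fun=> 0).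
have at_t : at_ j t y := geo_glue geo lj ai (geo_meet geo ai aj).
suff t0 s : (s < D)%N -> t s = 0 by move=> s /t0; rewrite /t gapply0.
have tt := geo_meet geo at_t ai.
have Pt := geo_in geo at_t.
have supp := geo_supp geo lj li; have b0 := cone_supp0 hj supp Pt tt.
pose G := gluing U j i.
have t0 : tight D (fun=> 0) G.1 by rewrite /tight dotn0 b0.
have t2E : (fun j => 2%:R * t j) = fun j => 2%:R * t j + (- 1) * (fun=> 0) j.
  by apply/funext => ?; rewrite mulr0 addr0.
have t2 : tight D (fun j => 2%:R * t j) G.1.
  by rewrite /tight t2E dotn_lin dotn0 (eqP tt) b0 !mulr0 addr0.
have [y0 a0] := geo_ex geo lj (cone0 D hj).
have [y2 a2] := geo_ex geo lj (cone_scale hj (ler0n _ 2) Pt).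
have b_t := geo_glue geo li at_t tt.
have b_0 := geo_glue geo li a0 t0.
have b_2 := geo_glue geo li a2 t2.
(* [G] sends [t] to 0, the midpoint of the images of the origin and of twice [t]. These images are
   thus opposite points of a pointed cone, hence 0. *)
have e0 s1 : (s1 < D)%N -> gapply D G (fun=> 0) s1 = 0.
  apply: (pi _ (geo_in geo b_0)).
  rewrite -(inP_ext _ (x := gapply D G (fun j => 2%:R * t j))); first exact: (geo_in geo b_2).
  move=> s2 ls; rewrite t2E (aff_comb _ _ (aff_gapply D G s2)); last by ring.
  by rewrite (geo_inj geo b_t ai) // mulr0 add0r mulN1r.
have yE : y0 = y by apply: (geo_fun geo) ai; apply: (geo_ext geo b_0).
by move=> ls; apply: (geo_inj geo at_t _ ls); rewrite -yE.
Qed.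

End GeometricFacts.

(** * Polyhedra of maps *)

Section HomGeometry.
Variables (R : realType) (k : complex_kind) (T1 T2 : Type) (U V : udata R).
Variables (at1 : nat -> vec R -> T1 -> Prop) (at2 : nat -> vec R -> T2 -> Prop).
Hypotheses (geo1 : geometric k U at1) (geo2 : geometric k V at2).
Hypothesis cover1 : forall y, exists i u, at1 i u y.
Local Notation n := (ncell U).
Local Notation D := (udim U).
Local Notation E := (udim V).
Local Notation NP := (npt k U).
Local Notation pc := (ptcell k U).
Local Notation pv := (ptvec k U).
Local Notation N := (hdim k U V).
Local Notation tgt f i := (nth 0%N f i).
Implicit Types (f : seq nat) (W : vec R) (g : T1 -> T2).

Definition choice_ok f := forall i, (i < n)%N -> (tgt f i < ncell V)%N.

(** The chart of the polyhedron of [f], as a relation between coordinates and maps. *)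
Definition hat f W g :=
  inP N (hcons k U V f) W /\ forall i u y, at1 i u y -> at2 (tgt f i) (fval k U V W i u) (g y).

Lemma pt_at p : (p < NP)%N -> exists y, at1 (pc p) (pv p) y.
Proof.
move=> /ptP [lt vg]; apply: (geo_ex geo1) => //.
exact: gens_in (geo_kind_ok geo1 lt) vg.
Qed.

Lemma glue_testE p i : (p < NP)%N -> (i < n)%N ->
  glue_test k U p i = tight D (pv p) (gluing U (pc p) i).1.
Proof.
move=> lp li; have [y a] := pt_at lp.
by rewrite /tight eq_le (geo_supp geo1 (geo_lt geo1 a) li (geo_in geo1 a)).
Qed.

Lemma idx_lt p s : (p < NP)%N -> (s < E)%N -> (p * E + s < N)%N.
Proof.
move=> lp ls; rewrite /hdim fmulE; apply: (@leq_trans (p.+1 * E)).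
  by rewrite mulSn addnC ltn_add2r.
by rewrite leq_mul2r lp orbT.
Qed.

Lemma fval_ext W W' i u v s : (s < E)%N -> (forall j, (j < N)%N -> W j = W' j) ->
  (forall j, (j < D)%N -> u j = v j) -> fval k U V W i u s = fval k U V W' i v s.
Proof.
move=> ls eW eu; rewrite (aff_ext (aff_fval k U V W i s) eu).
by apply: eq_bigr => p _; rewrite /ptrow eW // idx_lt.
Qed.

Lemma fval_pt f W p : choice_ok f -> inP N (hcons k U V f) W -> (p < NP)%N ->
  forall s, (s < E)%N -> fval k U V W (pc p) (pv p) s = ptrow V W p s.
Proof.
move=> ok /hconsP PW lp s ls; have [Prow] := PW p lp.
have [lt _] := ptP lp; have [y a] := pt_at lp.
have [t e] := glue_refl geo1 a.
move=> /(_ _ lt); rewrite glue_testE // => /(_ t) [_ /(_ s ls)].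
have [z az] := geo_ex geo2 (ok _ lt) Prow.
have [_ -> //] := glue_refl geo2 az.
by move=> ->; apply: fval_ext => // j lj; rewrite e.
Qed.

Lemma hat_row f W g p y : choice_ok f -> hat f W g -> (p < NP)%N -> at1 (pc p) (pv p) y ->
  at2 (tgt f (pc p)) (ptrow V W p) (g y).
Proof.
move=> ok [PW H] lp a; apply: (geo_ext geo2 (H _ _ _ a)) => s ls.
exact: (fval_pt ok PW).
Qed.

Lemma hat_fun f W g g' : hat f W g -> hat f W g' -> g = g'.
Proof.
move=> [_ H] [_ H']; apply/funext => y; have [i [u a]] := cover1 y.
exact: (geo_fun geo2 (H _ _ _ a) (H' _ _ _ a)).
Qed.

Lemma idx_ind (Q : nat -> Prop) :
  (forall p s, (p < NP)%N -> (s < E)%N -> Q (p * E + s)%N) -> forall j, (j < N)%N -> Q j.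
Proof.
move=> H j; rewrite /hdim fmulE => /fdivmod_lt [_ l1 l2 ->]; exact: H.
Qed.

Lemma hat_inj f W W' g : choice_ok f -> hat f W g -> hat f W' g ->
  forall j, (j < N)%N -> W j = W' j.
Proof.
move=> ok H H'; apply: idx_ind => p s lp ls; have [y a] := pt_at lp.
exact: (geo_inj geo2 (hat_row ok H lp a) (hat_row ok H' lp a) ls).
Qed.

Lemma hat_ext f W W' g : hat f W g -> (forall j, (j < N)%N -> W j = W' j) -> hat f W' g.
Proof.
move=> [PW H] e; split; first by rewrite -(inP_ext _ e).
by move=> i u y a; apply: (geo_ext geo2 (H _ _ _ a)) => s ls; apply: fval_ext.
Qed.

(** Tightness of the target functional and equality of the two images are affine conditions on [u].
    They hold at the generators lying on the glued face by the equations of [consB], hence on the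
    whole face by [gens_face]. *)
Lemma fval_glue f W i i' u y z : choice_ok f -> inP N (hcons k U V f) W -> (i' < n)%N ->
  at1 i u y -> tight D u (gluing U i i').1 -> at2 (tgt f i) (fval k U V W i u) z ->
  at2 (tgt f i') (fval k U V W i' (gapply D (gluing U i i') u)) z.
Proof.
move=> ok PW li' a t az; have li := geo_lt geo1 a.
have kok := geo_kind_ok geo1 li; have supp := geo_supp geo1 li li'.
set G := gluing V (tgt f i) (tgt f i').
have onF (chi : vec R -> R) : aff D chi ->
    (forall p, (p < NP)%N -> pc p = i -> tight D (pv p) (gluing U i i').1 -> chi (pv p) = 0) ->
    chi u = 0.
  move=> achi H; apply: (gens_face kok supp achi _ (geo_in geo1 a) t) => v vg tv.
  have [p [lp ep ev]] := ptE li vg; rewrite -ev; apply: H => //; by rewrite ev.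
have key p : (p < NP)%N -> pc p = i -> tight D (pv p) (gluing U i i').1 ->
    tight E (ptrow V W p) G.1 /\ forall s, (s < E)%N ->
      gapply E G (ptrow V W p) s = fval k U V W i' (gapply D (gluing U i i') (pv p)) s.
  move=> lp ep tp; have /hconsP /(_ p lp) [_ /(_ i' li')] := PW.
  by rewrite glue_testE // ep => /(_ tp).
have rowE p : (p < NP)%N -> pc p = i -> forall s, (s < E)%N ->
    fval k U V W i (pv p) s = ptrow V W p s by move=> lp <-; apply: (fval_pt ok).
have tG : tight E (fval k U V W i u) G.1.
  rewrite /tight -subr_eq0; apply/eqP.
  apply: (onF (fun u => dotn E G.1.1 (fval k U V W i u) - G.1.2)) => [|p lp ep tp].
    by apply: affB; [apply: aff_dot_fval|apply: aff_const].
  rewrite (dotn_ext _ (rowE p lp ep)).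
  by have [/eqP -> _] := key p lp ep tp; rewrite subrr.
apply: (geo_ext geo2 (geo_glue geo2 (ok _ li') az tG)) => s ls.
apply/eqP; rewrite -subr_eq0; apply/eqP.
apply: (onF (fun u => gapply E G (fval k U V W i u) s -
           fval k U V W i' (gapply D (gluing U i i') u) s)) => [|p lp ep tp].
  apply: affB.
    apply: affD; last exact: aff_const.
    by apply: (aff_fsum (f := fun r u => fval k U V W i u r * G.2.1 r s)) => r _;
       apply/affZr/aff_fval.
  have [c [b H]] := aff_fval k U V W i' s.
  have : aff D (fun u => dotn D c (gapply D (gluing U i i') u) + b).
    apply: affD; last exact: aff_const.
    have := aff_sum (D := D) (n := D) (f := fun r u => c r * gapply D (gluing U i i') u r).
    move=> [|c' [b' H']]; first by move=> r _; apply/affZ/aff_gapply.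
    by exists c', b' => v; rewrite dotnE H'.
  by move=> [c' [b' H']]; exists c', b' => v; rewrite H H'.
have [_ <- //] := key p lp ep tp.
by rewrite (aff_ext (aff_gapply E G s) (rowE p lp ep)) subrr.
Qed.

Lemma fval_in f W i u : choice_ok f -> inP N (hcons k U V f) W -> (i < n)%N ->
  inP D (ineqs U i) u -> inP E (ineqs V (tgt f i)) (fval k U V W i u).
Proof.
move=> ok PW li Pu; apply/inPP => h hin; rewrite -subr_le0.
have lj := ok _ li.
apply: (gens_le0 (geo_kind_ok geo1 li)
          (phi := fun u => dotn E h.1 (fval k U V W i u) - h.2) _ _ _ Pu).
- by apply: affB; [apply: aff_dot_fval|apply: aff_const].
- move=> kc; rewrite fval0 // dotn0.
  have [h0 _] : kind_ok E Conical (ineqs V (tgt f i)) by rewrite -kc; apply: (geo_kind_ok geo2 lj).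
  by rewrite h0 // subrr.
move=> v /(ptE li) [p [lp ep ev]].
rewrite -ev -ep (dotn_ext _ (fval_pt ok PW lp)) subr_le0.
by have /hconsP /(_ p lp) [/inPP + _] := PW; rewrite ep; apply.
Qed.

(** The value at a point is read off in some cell containing it; by [fval_glue] every other such
    cell gives the same value. *)
Lemma hat_ex f W : choice_ok f -> inP N (hcons k U V f) W -> exists g, hat f W g.
Proof.
move=> ok PW.
have Z y : exists z, exists i u, at1 i u y /\ at2 (tgt f i) (fval k U V W i u) z.
  have [i [u a]] := cover1 y; have li := geo_lt geo1 a.
  have [z az] := geo_ex geo2 (ok _ li) (fval_in ok PW li (geo_in geo1 a)).
  by exists z, i, u.
have [g Hg] := choice Z; exists g; split=> // i u y a.
have [i' [u' [a' az]]] := Hg y; have li := geo_lt geo1 a.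
have t := geo_meet geo1 a' a.
apply: (geo_ext geo2 (fval_glue ok PW li a' t az)) => s ls.
by apply: fval_ext => //; apply: (geo_inj geo1 (geo_glue geo1 li a' t) a).
Qed.

Definition mor g i j :=
  exists A, forall u y, at1 i u y -> at2 j (haff k U A u) (g y).

Lemma hat_mor f W g i : hat f W g -> mor g i (tgt f i).
Proof.
move=> [_ H]; exists (fun r s => \sum_(p < NP) lamx k U i r p * ptrow V W p s) => u y a.
by rewrite -fval_haff; apply: H.
Qed.

(** The coordinates are the values of [g] at the generators. The interpolated map agrees with the
    given one at the generators by [lamv_haff], hence on the cell by [gens_eq]. *)
Lemma mor_hat f g : choice_ok f -> (forall i, (i < n)%N -> mor g i (tgt f i)) ->
  exists W, hat f W g.
Proof.
move=> ok mg.
have /choice [A HA] : forall i, exists A, (i < n)%N ->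
    forall u y, at1 i u y -> at2 (tgt f i) (haff k U A u) (g y).
  move=> i; case: (ltnP i n) => [/mg [A HA]|_]; first by exists A.
  by exists (fun _ _ => 0).
pose W : vec R := flat E (fun p => haff k U (A (pc p)) (pv p)).
have rowE p s : (s < E)%N -> ptrow V W p s = haff k U (A (pc p)) (pv p) s.
  by move=> ls; rewrite /ptrow /W /flat fdivmodMD.
have fvalE i u s : (i < n)%N -> inP D (ineqs U i) u -> (s < E)%N ->
    fval k U V W i u s = haff k U (A i) u s.
  move=> li Pu ls; apply/eqP; rewrite -subr_eq0; apply/eqP.
  apply: (gens_eq (geo_kind_ok geo1 li) (chi := fun u => fval k U V W i u s - haff k U (A i) u s) _ _ Pu).
    by apply: affB; [apply: aff_fval|apply: aff_haff].
  move=> v /(ptE li) [p [lp ep <-]]; apply/eqP; rewrite subr_eq0; apply/eqP.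
  rewrite -{1}ep -(lamv_haff (A i) s lp) /fval; apply: eq_bigr => p' _.
  rewrite rowE //; have [->//|ne] := eqVneq (pc p') (pc p); first by rewrite ep.
  by rewrite lamv_out // !mul0r.
have Hat i u y : at1 i u y -> at2 (tgt f i) (fval k U V W i u) (g y).
  move=> a; have li := geo_lt geo1 a.
  by apply: (geo_ext geo2 (HA i li u y a)) => s ls; rewrite fvalE //; apply: (geo_in geo1 a).
exists W; split=> //; apply/hconsP => p lp.
have [y a] := pt_at lp; have li := geo_lt geo1 a.
have ar : at2 (tgt f (pc p)) (ptrow V W p) (g y).
  apply: (geo_ext geo2 (Hat _ _ _ a)) => s ls.
  by rewrite fvalE ?rowE //; apply: (geo_in geo1 a).
split; first exact: (geo_in geo2 ar).
move=> i li'; rewrite glue_testE // => t.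
have a' := Hat _ _ _ (geo_glue geo1 li' a t).
have tr := geo_meet geo2 ar a'; split=> //.
exact: (geo_inj geo2 (geo_glue geo2 (ok _ li') ar tr) a').
Qed.

(** Compose with the gluing from [j] to [j'], putting its translation in row [D]. For cones this row
    is multiplied by 0, so the translation itself must be 0: the origin of cell [i] goes to the
    origin of cell [j], whose image also lies in cell [j'], and [cone_glue0] applies. *)
Lemma mor_transfer g i j j' : (i < n)%N -> (j' < ncell V)%N -> mor g i j ->
  (forall u y, at1 i u y -> exists v, at2 j' v (g y)) -> mor g i j'.
Proof.
move=> li lj' [A HA] sub; set G := gluing V j j'.
exists (fun r s => \sum_(t < E) A r t * G.2.1 t s + (if r == D then G.2.2 s else 0)) => u y a.
have [v av] := sub _ _ a; have ah := HA _ _ a.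
apply: (geo_ext geo2 (geo_glue geo2 lj' ah (geo_meet geo2 ah av))) => s ls.
rewrite /gapply fsumE /haff.
under eq_bigr => t _ do rewrite mulr_suml.
rewrite exchange_big /=; under [RHS]eq_bigr => r _ do rewrite mulrDr mulr_sumr.
rewrite big_split /=; congr (_ + _).
  by apply: eq_bigr => r _; apply: eq_bigr => t _; rewrite mulrA.
rewrite big_ord_recr /= eqxx big1 ?add0r => [|r _]; last first.
  by rewrite ltn_eqF // mulr0.
rewrite /homv fltnE ltnn; case kE: k => /=; first by rewrite mul1r.
rewrite mul0r.
have [h0 _] : kind_ok D Conical (ineqs U i) by rewrite -kE; apply: (geo_kind_ok geo1 li).
have [y0 a0] := geo_ex geo1 li (cone0 D h0).
have := HA _ _ a0; rewrite haff0 // => a0'; have [v0 av0] := sub _ _ a0.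
by apply: (cone_glue0 geo2 kE a0' av0).
Qed.

Lemma dotn_hglue f f' W : dotn N (hglue k U V f f').1.1 W =
  \sum_(p < NP) dotn E (gluing V (tgt f (pc p)) (tgt f' (pc p))).1.1 (ptrow V W p).
Proof.
rewrite /hdim fmulE /hglue /= dotn_flat !fnthE.
by apply: eq_bigr => p _; rewrite dotnE.
Qed.

Lemma gapply_hglue f f' W p s : (p < NP)%N -> (s < E)%N ->
  gapply N (hglue k U V f f') W (p * E + s)%N =
  gapply E (gluing V (tgt f (pc p)) (tgt f' (pc p))) (ptrow V W p) s.
Proof.
move=> lp ls; rewrite /gapply /= !fsumE /hdim fmulE !fnthE.
rewrite /flat fdivmodMD //=; set G := gluing V _ _; congr (_ + _).
rewrite (flat_sum NP E (fun j => W j *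
  (if feqn (fdivmod E j).1 p then G.2.1 (fdivmod E j).2 s else 0))).
rewrite (bigD1 (Ordinal lp)) //= [X in _ + X]big1 ?addr0 => [|p' ne].
  by apply: eq_bigr => s' _; rewrite fdivmodMD //= feqnE eqxx.
apply: big1 => s' _; rewrite fdivmodMD //= feqnE; case: eqP => [e|]; last by rewrite mulr0.
by case/eqP: ne; apply: val_inj.
Qed.

Lemma row_le f f' W p : choice_ok f -> choice_ok f' -> inP N (hcons k U V f) W -> (p < NP)%N ->
  dotn E (gluing V (tgt f (pc p)) (tgt f' (pc p))).1.1 (ptrow V W p) <=
  (gluing V (tgt f (pc p)) (tgt f' (pc p))).1.2.
Proof.
move=> ok ok' /hconsP /(_ p) H lp; have [lt _] := ptP lp; have [Pr _] := H lp.
exact: (geo_supp geo2 (ok _ lt) (ok' _ lt) Pr).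
Qed.

Lemma hglue_supp f f' W : choice_ok f -> choice_ok f' -> inP N (hcons k U V f) W ->
  dotn N (hglue k U V f f').1.1 W <= (hglue k U V f f').1.2.
Proof.
move=> ok ok' PW; rewrite dotn_hglue /= fsumE !fnthE.
by apply: ler_sum => p _; apply: row_le.
Qed.

Lemma tight_hglue f f' W : choice_ok f -> choice_ok f' -> inP N (hcons k U V f) W ->
  tight N W (hglue k U V f f').1 <-> forall p, (p < NP)%N ->
    tight E (ptrow V W p) (gluing V (tgt f (pc p)) (tgt f' (pc p))).1.
Proof.
move=> ok ok' PW; rewrite /tight dotn_hglue /= fsumE !fnthE; split; last first.
  by move=> H; apply/eqP/eq_bigr => p _; apply/eqP/H.
rewrite eq_sym -subr_eq0 -sumrB psumr_eq0 => [/allP H p lp|p _]; last first.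
  by rewrite subr_ge0; apply: row_le.
by have := H (Ordinal lp); rewrite mem_index_enum /= subr_eq0 eq_sym => /(_ isT).
Qed.

Lemma hglue_meet f f' W W' g : choice_ok f -> choice_ok f' -> hat f W g -> hat f' W' g ->
  tight N W (hglue k U V f f').1.
Proof.
move=> ok ok' H H'; apply/tight_hglue => //; first by case: H.
move=> p lp; have [y a] := pt_at lp.
exact: (geo_meet geo2 (hat_row ok H lp a) (hat_row ok' H' lp a)).
Qed.

(** Tightness spreads from the generators to whole cells, so [g] maps each cell into the one chosen
    by [f'] and has coordinates for [f']. Injectivity of the target charts identifies these with the
    glued ones, generator by generator. *)
Lemma hglue_glue f f' W g : choice_ok f -> choice_ok f' -> hat f W g ->
  tight N W (hglue k U V f f').1 -> hat f' (gapply N (hglue k U V f f') W) g.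
Proof.
move=> ok ok' H; have PW := H.1; move=> /tight_hglue -/(_ ok ok' PW) t.
have tf i u : (i < n)%N -> inP D (ineqs U i) u ->
    tight E (fval k U V W i u) (gluing V (tgt f i) (tgt f' i)).1.
  move=> li Pu; rewrite /tight -subr_eq0; apply/eqP; set G := gluing _ _ _.
  apply: (gens_eq (geo_kind_ok geo1 li)
            (chi := fun u => dotn E G.1.1 (fval k U V W i u) - G.1.2) _ _ Pu).
    by apply: affB; [apply: aff_dot_fval|apply: aff_const].
  move=> v /(ptE li) [p [lp ep <-]]; rewrite -ep (dotn_ext _ (fval_pt ok PW lp)).
  by have := t p lp; rewrite ep => /eqP ->; rewrite subrr.
have [W' H'] : exists W', hat f' W' g.
  apply: mor_hat => // i li; apply: (mor_transfer (j := tgt f i)) => //; first exact: ok'.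
    exact: hat_mor H.
  move=> u y a; have [_ /(_ _ _ _ a) ah] := H.
  by eexists; apply: (geo_glue geo2 (ok' _ li) ah); apply: tf => //; apply: (geo_in geo1 a).
apply: (hat_ext H'); apply: idx_ind => p s lp ls; have [y a] := pt_at lp.
have li := geo_lt geo1 a; rewrite gapply_hglue //.
apply: (geo_inj geo2 (hat_row ok' H' lp a) _ ls).
exact: (geo_glue geo2 (ok' _ li) (hat_row ok H lp a) (t p lp)).
Qed.

End HomGeometry.

(** * Faces of the polyhedra of maps *)

Section GeometricFaces.
Variables (R : realType) (k : complex_kind) (T : Type) (U : udata R).
Variables (at_ : nat -> vec R -> T -> Prop).
Hypothesis geo : geometric k U at_.
Local Notation D := (udim U).
Local Notation n := (ncell U).

Definition img (at_ : nat -> vec R -> T -> Prop) (i : nat) (y : T) : Prop :=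
  exists u, at_ i u y.

Lemma img_meet i j y : img at_ i y -> img at_ j y ->
  exists2 l, (l < n)%N & forall z, img at_ l z <-> img at_ i z /\ img at_ j z.
Proof.
move=> [u a] [v b]; have li := geo_lt geo a; have lj := geo_lt geo b.
have supp := geo_supp geo li lj.
have [l ll H] := geo_face geo li supp (geo_in geo a) (geo_meet geo a b).
exists l => // z; split.
  move=> /H [w aw t]; split; first by exists w.
  by eexists; apply: (geo_glue geo lj aw t).
by move=> [[w aw] [w' bw]]; apply/H; exists w => //; apply: (geo_meet geo aw bw).
Qed.

(** A face containing [A] but not included in another such face is replaced by their intersection,
    again a face since [A] is nonempty. The number of faces below it drops strictly. *)
Lemma min_face (A : T -> Prop) i : (i < n)%N -> (exists y, A y) ->
  (forall y, A y -> img at_ i y) ->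
  exists j, [/\ (j < n)%N, forall y, A y -> img at_ j y &
    forall j', (j' < n)%N -> (forall y, A y -> img at_ j' y) ->
      forall y, img at_ j y -> img at_ j' y].
Proof.
move=> li [y0 Ay0]; pose below j := [set l : 'I_n | `[< forall y, img at_ l y -> img at_ j y >]]%SET.
have [m] := ubnP #|below i|; elim: m i li => // m IH i li; rewrite ltnS => le Ai.
case: (EM (exists j', [/\ (j' < n)%N, forall y, A y -> img at_ j' y &
    ~ forall y, img at_ i y -> img at_ j' y])) => [[j' [lj' Aj' nsub]]|no]; last first.
  exists i; split=> // j' lj' Aj' y iy; case: (EM (img at_ j' y)) => // nj'.
  by case: no; exists j'; split=> // /(_ y iy).
have [l ll lE] := img_meet (Ai _ Ay0) (Aj' _ Ay0).
apply: (IH l ll); last by move=> y Ay; apply/lE; split; [apply: Ai|apply: Aj'].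
apply: leq_trans le; apply: proper_card; apply/properP; split.
  by apply/fintype.subsetP => x; rewrite !inE => /asboolP H; apply/asboolP => y /H /lE [].
exists (Ordinal li); rewrite inE; first exact/asboolP.
by apply/asboolP => H; apply: nsub => y /H /lE [].
Qed.

(** For [l] the smallest face containing [v], the point [v] is in its relative interior, so that a
    nonpositive affine function vanishing at [v] vanishes on all of [l]. *)
Lemma carrier_face i v y0 : at_ i v y0 -> exists l, [/\ (l < n)%N, img at_ l y0 &
  forall phi, aff D phi -> (forall u, inP D (ineqs U i) u -> phi u <= 0) -> phi v = 0 ->
    forall y, img at_ l y -> exists2 u, at_ i u y & phi u = 0].
Proof.
move=> a; have li := geo_lt geo a; have Pv := geo_in geo a.
pose S := [seq h <- ineqs U i | tight D v h].
have SP h : h \in S -> h \in ineqs U i by rewrite mem_filter => /andP[].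
(* The sum of the inequalities tight at [v] exposes exactly the points at which all of them are
   tight. *)
pose h0 : con R := (height S, \sum_(h <- S) h.2).
have supp u : inP D (ineqs U i) u -> dotn D h0.1 u <= h0.2.
  move=> /inPP Pu; rewrite dotn_height /h0 /= big_seq [leRHS]big_seq.
  by apply: ler_sum => h /SP /Pu.
have tE u : inP D (ineqs U i) u -> tight D u h0 -> forall h, h \in S -> tight D u h.
  move=> /inPP Pu; rewrite /tight dotn_height /h0 /= eq_sym -subr_eq0 -sumrB big_seq.
  rewrite psumr_eq0 => [/allP H h hS|h /SP /Pu]; last by rewrite subr_ge0.
  by have := H h hS; rewrite hS subr_eq0 eq_sym.
have tv : tight D v h0.
  rewrite /tight dotn_height /h0 /= big_seq [X in _ == X]big_seq; apply/eqP/eq_bigr => h.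
  by rewrite mem_filter => /andP[/eqP].
have [l ll lE] := geo_face geo li supp Pv tv.
exists l; split=> //; first by apply/lE; exists v.
move=> phi aphi phile phiv y /lE [u au tu]; exists u => //.
have Pu := geo_in geo au.
(* If [phi] were negative at [u], it would be positive just beyond [v] on the line coming from
   [u]. *)
have [|e e0 Pe] := push Pv Pu.
  by move=> h hin tvh; apply: (tE u Pu tu); rewrite mem_filter tvh.
have := phile _ Pe; rewrite (aff_comb _ _ aphi); last by ring.
rewrite phiv mulr0 add0r mulNr oppr_le0 pmulr_rge0 // => ge0.
by apply/eqP; rewrite eq_le ge0 phile.
Qed.

End GeometricFaces.

(** Only weak inequalities are available, so a slack of at least 1 is required and the scale [s] is
    left free; a point with slack d is scaled by the inverse of d. Conversely a solution with
    positive [s] is divided by [s], and one with [s] = 0 is a recession direction along which [c]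
    decreases, to be added to [x0]. *)
Lemma feasible_slack (R : realType) D (hs : seq (con R)) (c : con R) x0 :
  inP D hs x0 -> dotn D c.1 x0 <= c.2 ->
  feasible D.+1 ([:: (consv (- 1) (fun=> 0), 0); (consv (- c.2) c.1, - 1)] ++
                 map (fun h => (consv (- h.2) h.1, 0)) hs) <->
  exists2 x, inP D hs x & dotn D c.1 x < c.2.
Proof.
move=> P0 le0; set hs' := _ ++ _.
have HS s x : reflect [/\ 0 <= s, dotn D c.1 x <= c.2 * s - 1 &
    forall h, h \in hs -> dotn D h.1 x <= h.2 * s] (inP D.+1 hs' (consv s x)).
  rewrite inP_all /hs' /= /sat /= !dotn_consv /= dotn0l addr0 mulN1r oppr_le0.
  rewrite all_map; apply: (iffP and3P) => -[s0 cs].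
    move=> /allP H; split=> // [|h /H]; first by lra.
    rewrite /= dotn_consv; change (shift _) with h.1 => /=; lra.
  move=> H; split=> //; first by lra.
  by apply/allP => h /H; rewrite /= dotn_consv; change (shift _) with h.1 => /=; lra.
have lin1 a b (x y : vec R) e : dotn D e (fun j => a * x j + b * y j) = a * dotn D e x + b * dotn D e y.
  exact: dotn_lin.
split=> [/feasibleP [z]|[x Px lt]].
  rewrite -(consv_shift z); move: (z 0%N) (shift z) => s x /HS [s0 cx hx].
  have [s_gt0|s_le0] := ltP 0 s.
    exists (fun j => s^-1 * x j + 0 * x j); last first.
      rewrite lin1 mul0r addr0 mulrC ltr_pdivrMr //; lra.
    apply/inPP => h hin; rewrite lin1 mul0r addr0 mulrC ler_pdivrMr //; exact: hx.
  have sE : s = 0 by apply/eqP; rewrite eq_le s0 s_le0.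
  exists (fun j => 1 * x0 j + 1 * x j); last by rewrite lin1; move: cx; rewrite sE; lra.
  apply/inPP => h hin; rewrite lin1; have := hx h hin; rewrite sE.
  by move/inPP: P0 => /(_ h hin); lra.
have d0 : 0 < c.2 - dotn D c.1 x by rewrite subr_gt0.
set s := (c.2 - dotn D c.1 x)^-1.
have s0 : 0 < s by rewrite invr_gt0.
have sE : s * (c.2 - dotn D c.1 x) = 1 by rewrite mulVf // gt_eqF.
apply/feasibleP; exists (consv s (fun j => s * x j + 0 * x j)); apply/HS; split.
- exact: ltW.
- rewrite lin1; lra.
- move=> h hin; rewrite lin1 mul0r addr0 mulrC ler_pM2r //; by move/inPP: Px; apply.
Qed.

Lemma choicesP n m (f : seq nat) :
  (f \in choices n m) = (size f == n) && all (fun j => j < m)%N f.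
Proof.
elim: n f => [|n IH] f; first by rewrite inE; case: f.
rewrite -[choices n.+1 m]/(fbind (fun j => fmap (cons j) (choices n m)) (fiota m)) fbindE fiotaE.
apply/flatten_mapP/andP => [[j]|].
  rewrite mem_iota add0n => /= lj; rewrite fmapE => /mapP[f' + ->].
  by rewrite IH => /andP[/eqP <- al] /=; rewrite lj.
case: f => [|j f] [] // /eqP[sf] /= /andP[lj al]; exists j; first by rewrite mem_iota.
by rewrite fmapE map_f // IH sf eqxx.
Qed.

Lemma foldr_representatives (T : eqType) (p : pred T) (e : rel T) (s : seq T) :
  let r := foldr (fun x acc => if p x then if all (fun y => ~~ e x y) acc then x :: acc else acc
                               else acc) [::] s in
  [/\ forall x, x \in r -> p x && (x \in s), pairwise (fun x y => ~~ e x y) r &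
      forall x, x \in s -> p x -> exists2 y, y \in r & (y == x) || e x y].
Proof.
elim: s => [|x s [IH1 IH2 IH3]] //=; move: IH1 IH2 IH3; set r := foldr _ _ _ => IH1 IH2 IH3.
have old y : y \in s -> p y -> exists2 z, z \in x :: r & (z == y) || e y z.
  by move=> ys /(IH3 _ ys) [z zr ez]; exists z => //; rewrite inE zr orbT.
case: (boolP (p x)) => px; last first.
  split=> // y; first by move=> /IH1 /andP[-> ys]; rewrite inE ys orbT.
  by rewrite inE => /predU1P[-> /(negP px)//|]; apply: IH3.
case: ifP => [al|/negbT/allPn[z zr]].
  split=> [y||y].
  - rewrite inE => /predU1P[->|/IH1/andP[-> ys]]; first by rewrite px mem_head.
    by rewrite inE ys orbT.
  - by rewrite /= al.
  - rewrite inE => /predU1P[-> _|]; last exact: old.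
    by exists x; rewrite ?mem_head ?eqxx.
rewrite negbK => ez; split=> // y.
  by move=> /IH1 /andP[-> ys]; rewrite inE ys orbT.
rewrite inE => /predU1P[-> _|]; last exact: IH3.
by exists z => //; rewrite ez orbT.
Qed.

(** * The polyhedra of maps form a complex *)

Section HomComplex.
Variables (R : realType) (k : complex_kind) (T1 T2 : Type) (U V : udata R).
Variables (at1 : nat -> vec R -> T1 -> Prop) (at2 : nat -> vec R -> T2 -> Prop).
Hypotheses (geo1 : geometric k U at1) (geo2 : geometric k V at2).
Hypothesis cover1 : forall y, exists i u, at1 i u y.
Local Notation n := (ncell U).
Local Notation D := (udim U).
Local Notation E := (udim V).
Local Notation NP := (npt k U).
Local Notation pc := (ptcell k U).
Local Notation pv := (ptvec k U).
Local Notation N := (hdim k U V).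
Local Notation tgt f i := (nth 0%N f i).
Local Notation choice_ok := (choice_ok U V).
Local Notation hat := (hat k U V at1 at2).
Local Notation mor := (mor k U at1 at2).
Local Notation kept := (kept k U V).
Implicit Types (f : seq nat) (W : vec R) (g : T1 -> T2).

(** Equations are tight everywhere, so only the inequalities coming from target cells matter for the
    faces. The right-hand sides of the equations are recorded for [hom_conical], where they have to
    vanish. *)
Lemma hcons_cases f h : h \in hcons k U V f ->
  (exists p h', [/\ (p < NP)%N, h' \in ineqs V (tgt f (pc p)) & h = (at_pt V p h'.1, h'.2)]) \/
  (exists p i c, [/\ (p < NP)%N, (i < n)%N, glue_test k U p i,
     h \in eqc c /\ {subset eqc c <= hcons k U V f} &
     let g := gluing V (tgt f (pc p)) (tgt f i) in
     c.2 = g.1.2 \/ exists2 s, (s < E)%N & c.2 = - g.2.2 s]).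
Proof.
rewrite /hcons fcatE mem_cat => /orP[|].
  rewrite /consA fbindE => /flatten_mapP[p].
  rewrite fiotaE mem_iota add0n => /= lp; rewrite fmapE fnthE => /mapP[h' hin ->].
  by left; exists p, h'.
rewrite {1}/consB fbindE => /flatten_mapP[p pin]; rewrite fbindE => /flatten_mapP[i iin].
have lp : (p < NP)%N by move: pin; rewrite fiotaE mem_iota.
have li : (i < n)%N by move: iin; rewrite fiotaE mem_iota.
cbv zeta beta; rewrite -/(glue_test k U p i); case: ifP => // gt.
set blk := fcat _ _ => hin; right.
have sub : {subset blk <= consA k U V f ++ consB k U V f}.
  move=> h' h'in; rewrite mem_cat /consB fbindE; apply/orP; right.
  apply/flatten_mapP; exists p => //; rewrite fbindE; apply/flatten_mapP; exists i => //.
  by cbv zeta beta; rewrite -/(glue_test k U p i) gt.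
have : exists2 c, h \in eqc c & {subset eqc c <= blk} /\
    let g := gluing V (tgt f (pc p)) (tgt f i) in
    (c.2 = g.1.2 \/ exists2 s, (s < E)%N & c.2 = - g.2.2 s).
  move: hin; rewrite /blk fcatE mem_cat !fnthE => /orP[hin|].
    by eexists; first exact: hin; split; [move=> h' h'in; rewrite mem_cat h'in|left].
  rewrite fbindE => /flatten_mapP[s sin hin].
  have ls : (s < E)%N by move: sin; rewrite fiotaE mem_iota.
  eexists; first exact: hin; split; last by right; exists s.
  move=> h' h'in; rewrite mem_cat; apply/orP; right.
  by apply/flatten_mapP; exists s.
move=> [c hc [subc c2]]; exists p, i, c; split=> //; split=> // h' /subc; exact: sub.
Qed.

Lemma eqc_tight f c h W : {subset eqc c <= hcons k U V f} -> h \in eqc c ->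
  inP N (hcons k U V f) W -> tight N W h.
Proof.
move=> sub hc /inPP PW.
have : inP N (eqc c) W by apply/inPP => h' /sub /PW.
rewrite inP_eqc; move: hc; rewrite !inE => /orP[/eqP ->//|/eqP ->].
by rewrite /tight /= dotnNl => /eqP ->.
Qed.

Definition Hs f g := exists W, hat f W g.

Lemma Hs_mor f g i : Hs f g -> mor g i (tgt f i).
Proof. by move=> [W]; apply: hat_mor. Qed.

Lemma hat_img f W g i y : hat f W g -> img at1 i y -> img at2 (tgt f i) (g y).
Proof. by move=> [_ H] [u /H a]; eexists; exact: a. Qed.

Lemma Hs_transfer f f' g : choice_ok f' -> Hs f g ->
  (forall i y, (i < n)%N -> img at1 i y -> img at2 (tgt f' i) (g y)) -> Hs f' g.
Proof.
move=> ok' H sub; apply: (mor_hat geo1 geo2 ok') => i li.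
apply: (mor_transfer geo1 geo2 li (ok' i li) (Hs_mor i H)) => u y a.
by apply: (sub i) => //; exists u.
Qed.

(* [tau i] is the smallest face containing the images of the [i]-th cell; the
   generic point [Wx] reduces membership in the face to the inequalities tight on
   all of it. *)
Lemma hom_face f (h0 : con R) W0 : choice_ok f ->
  (forall W, inP N (hcons k U V f) W -> dotn N h0.1 W <= h0.2) ->
  inP N (hcons k U V f) W0 -> tight N W0 h0 ->
  exists f', [/\ size f' = n, choice_ok f' &
    forall g, Hs f' g <-> exists2 W, hat f W g & tight N W h0].
Proof.
move=> ok supp P0 t0.
pose F W := inP N (hcons k U V f) W /\ tight N W h0.
have [|x y [Px tx] [Py ty]|//|Wx [Px tx] gen] := @generic_point R N (hcons k U V f) F W0.
- by move=> x [].
- have e : (2^-1 : R) + 2^-1 = 1 by lra.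
  split; last by rewrite /tight dotn_lin (eqP tx) (eqP ty) -mulrDl e mul1r.
  apply/inPP => h hin; rewrite dotn_lin.
  by move/inPP: Px => /(_ h hin); move/inPP: Py => /(_ h hin); lra.
pose A i z := exists W g y, [/\ hat f W g, tight N W h0, img at1 i y & z = g y].
have Asub i z : A i z -> img at2 (tgt f i) z.
  by move=> [W [g [y [H _ iy ->]]]]; apply: hat_img H iy.
have A_ne i : (i < n)%N -> exists z, A i z.
  move=> li; have [g Hg] := hat_ex geo1 geo2 cover1 ok P0.
  have [u Pu] := geo_ne geo1 li; have [y a] := geo_ex geo1 li Pu.
  by exists (g y), W0, g, y; split=> //; exists u.
have /choice [tau Ht] : forall i, exists j, (i < n)%N -> [/\ (j < ncell V)%N,
    forall z, A i z -> img at2 j z &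
    forall j', (j' < ncell V)%N -> (forall z, A i z -> img at2 j' z) ->
      forall z, img at2 j z -> img at2 j' z].
  move=> i; case: (ltnP i n) => [li|_]; last by exists 0%N.
  by have [j Hj] := min_face geo2 (ok i li) (A_ne i li) (Asub i); exists j.
pose f' := mkseq tau n.
have f'E i : (i < n)%N -> tgt f' i = tau i by move=> li; rewrite nth_mkseq.
have ok' : choice_ok f' by move=> i li; rewrite f'E //; have [] := Ht i li.
exists f'; split=> //; first by rewrite size_mkseq.
move=> g; split=> [[W' H']|[W H t]]; last first.
  apply: (Hs_transfer ok'); first by exists W; exact: H.
  by move=> i y li iy; rewrite f'E //; have [_ + _] := Ht i li; apply; exists W, g, y.
(* By minimality the cell [tau i] is included in the one chosen by [f]. *)
have [W H] : Hs f g.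
  apply: (Hs_transfer ok); first by exists W'; exact: H'.
  move=> i y li iy; have [_ _ /(_ (tgt f i) (ok i li) (Asub i))] := Ht i li; apply.
  by rewrite -f'E //; apply: hat_img H' iy.
have PW := H.1; exists W => //.
apply: (tight_supp supp Px tx PW) => h hin tWx.
case: (hcons_cases hin) => [[p [h' [lp h'in hE]]]|[p [i [c [_ _ _ [hc sub] _]]]]]; last first.
  exact: eqc_tight sub hc PW.
have tE W1 : tight N W1 h = tight E (ptrow V W1 p) h'.
  by rewrite /tight hE /= dotn_at_pt.
have [y a] := pt_at geo1 lp; have [l [ll ly lphi]] := carrier_face geo1 a.
have lpc := geo_lt geo1 a.
have supp' u : inP E (ineqs V (tgt f (pc p))) u -> dotn E h'.1 u <= h'.2.
  by move=> /inPP; apply.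
have Prow : inP E (ineqs V (tgt f (pc p))) (ptrow V Wx p).
  by have /hconsP /(_ p lp) [] := Px.
(* Maps in the face of [h0] make [h'] tight at the generator [p], hence by [lphi] on its carrier
   face [l], so they send [l] into the target face [q] exposed by [h']. By minimality [q] contains
   [tau l], hence also the image of the generator under [g]. *)
have [q lq qE] := geo_face geo2 (ok _ lpc) supp' Prow (etrans (esym (tE Wx)) tWx).
have Aq z : A l z -> img at2 q z.
  move=> [W1 [g1 [y1 [H1 t1 ly1 ->]]]]; apply/qE.
  have PW1 := H1.1.
  have [|u Pu||u au phi0] := lphi (fun u => dotn E h'.1 (fval k U V W1 (pc p) u) - h'.2) _ _ _ y1 ly1.
  - by apply: affB; [apply: aff_dot_fval|apply: aff_const].
  - by rewrite subr_le0; apply/supp'/(fval_in geo1 geo2 ok PW1 lpc Pu).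
  - have := gen h W1 hin tWx (conj PW1 t1); rewrite tE => /eqP e.
    by rewrite (dotn_ext _ (fval_pt geo1 geo2 ok PW1 lp)) e subrr.
  exists (fval k U V W1 (pc p) u); first by have [_] := H1; apply.
  by rewrite /tight -subr_eq0; apply/eqP.
have [_ _ /(_ q lq Aq (g y))] := Ht l ll.
rewrite -f'E // => /(_ (hat_img H' ly)) /qE [u au tu].
rewrite tE /tight -(dotn_ext _ (geo_inj geo2 au (hat_row geo1 geo2 ok H lp a))).
exact: tu.
Qed.

(** The maps of [f] that belong to [f'] form the face exposed by the functional of [hglue].
    Inclusion thus means that this functional is nowhere slack, which [feasible_slack] decides. *)
Lemma hinclP f f' W0 : choice_ok f -> choice_ok f' -> inP N (hcons k U V f) W0 ->
  hincl k U V f f' <-> forall g, Hs f g -> Hs f' g.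
Proof.
move=> ok ok' P0; rewrite /hincl fcatE fmapE.
have := feasible_slack P0 (hglue_supp geo2 ok ok' P0); set b := feasible _ _ => bE.
split=> [nb g [W H]|sub].
  exists (gapply N (hglue k U V f f') W); apply: (hglue_glue geo1 geo2 ok ok' H).
  rewrite /tight eq_le (hglue_supp geo2 ok ok' H.1) /= leNgt; apply/negP => lt.
  have bt : b by apply/bE; exists W => //; case: H.
  by move: nb; rewrite bt.
case: ifP => // /bE [W PW lt].
have [g H] := hat_ex geo1 geo2 cover1 ok PW.
have [|W' H'] := sub g; first by exists W.
by move: lt; rewrite (eqP (hglue_meet geo1 geo2 ok ok' H H')) ltxx.
Qed.

Lemma keptP : [/\ forall f, f \in kept -> [/\ size f = n, choice_ok f &
                            exists W, inP N (hcons k U V f) W],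
  forall a b, (a < b < size kept)%N ->
    ~ (forall g, Hs (nth [::] kept a) g <-> Hs (nth [::] kept b) g) &
  forall f g, size f = n -> choice_ok f -> Hs f g ->
    exists2 f', f' \in kept & forall g, Hs f' g <-> Hs f g].
Proof.
have [K1 K2 K3] := foldr_representatives (fun f => feasible N (hcons k U V f))
  (fun f f' => hincl k U V f f' && hincl k U V f' f) (choices n (ncell V)).
set r := foldr _ _ _ in K1 K2 K3.
have -> : kept = r.
  rewrite /kept /r; elim: (choices _ _) => //= f s ->; case: ifP => // _.
  rewrite fallE (eq_all (a2 := fun f' => ~~ (hincl k U V f f' && hincl k U V f' f))) //.
  by move=> f' /=; case: (hincl _ _ _ _ _) => //; case: (hincl _ _ _ _ _).
have P1 f : f \in r -> [/\ size f = n, choice_ok f & exists W, inP N (hcons k U V f) W].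
  move=> /K1; rewrite choicesP => /andP[/feasibleP fe /andP[/eqP sf /(all_nthP 0%N) al]].
  by split=> // i li; apply: al; rewrite sf.
split=> //.
  move=> a b /andP[ab lb] same.
  have /(pairwiseP [::]) /(_ a b (ltn_trans ab lb) lb ab) /negP := K2; apply.
  have [_ oka [Wa Pa]] := P1 _ (mem_nth [::] (ltn_trans ab lb)).
  have [_ okb [Wb Pb]] := P1 _ (mem_nth [::] lb).
  by apply/andP; split; [apply/(hinclP oka okb Pa)|apply/(hinclP okb oka Pb)] => g /same.
move=> f g sf ok [W H].
have [||f' f'r] := K3 f.
- by rewrite choicesP sf eqxx; apply/(all_nthP 0%N) => i; rewrite sf => /ok.
- by apply/feasibleP; exists W; case: H.
case/orP => [/eqP e|/andP[i1 i2]]; first by exists f' => //; rewrite e.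
have [_ ok' [W' P']] := P1 _ f'r.
exists f' => // g'; split; first exact: (hinclP ok' ok P').1.
exact: (hinclP ok ok' H.1).1.
Qed.

Definition at_hom (a : nat) W g : Prop := (a < size kept)%N /\ hat (nth [::] kept a) W g.

Lemma hom_cover g : (forall i, (i < n)%N -> exists2 j, (j < ncell V)%N & mor g i j) <->
  exists a W, at_hom a W g.
Proof.
have [K1 _ K3] := keptP; split=> [H|[a [W [la Ha]]] i li]; last first.
  have [_ ok _] := K1 _ (mem_nth [::] la).
  by exists (tgt (nth [::] kept a) i); [apply: ok|apply: hat_mor Ha].
have /choice [t Ht] : forall i, exists j, (i < n)%N -> (j < ncell V)%N /\ mor g i j.
  move=> i; case: (ltnP i n) => [/H [j lj mj]|_]; [by exists j|by exists 0%N].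
have ok : choice_ok (mkseq t n) by move=> i li; rewrite nth_mkseq //; case: (Ht i li).
have [|f' f'k f'E] := K3 (mkseq t n) g (size_mkseq _ _) ok.
  by apply: (mor_hat geo1 geo2 ok) => i li; rewrite nth_mkseq //; case: (Ht i li).
have [W HW] : Hs f' g.
  by apply/f'E/(mor_hat geo1 geo2 ok) => i li; rewrite nth_mkseq //; case: (Ht i li).
by exists (index f' kept), W; split; rewrite ?index_mem ?nth_index.
Qed.

Lemma at_hom_inj a b : (a < size kept)%N -> (b < size kept)%N ->
  (forall g, img at_hom a g <-> img at_hom b g) -> a = b.
Proof.
move=> la lb same; have [_ K2 _] := keptP.
have imgE c : (c < size kept)%N -> forall g, img at_hom c g <-> Hs (nth [::] kept c) g.
  by move=> lc g; split=> [[W [_ H]]|[W H]]; exists W.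
have HsE g : Hs (nth [::] kept a) g <-> Hs (nth [::] kept b) g.
  by rewrite -(imgE a la) -(imgE b lb); apply: same.
case: (ltngtP a b) => // lt.
  by case: (K2 a b) => //; rewrite lt.
by case: (K2 b a) => [|g]; rewrite ?lt // HsE.
Qed.

Lemma hom_bounded : k = Polytopal -> exists B, forall a, (a < size kept)%N ->
  forall W, inP N (hcons k U V (nth [::] kept a)) W -> forall j, (j < N)%N -> `|W j| <= B.
Proof.
have [K1 _ _] := keptP; move=> kE.
have [B HB] : exists B, forall i, (i < ncell V)%N -> forall u, inP E (ineqs V i) u ->
    forall s, (s < E)%N -> `|u s| <= B by have := geo_kind geo2; rewrite kE.
exists B => a la W PW; apply: idx_ind => p s lp ls; have [lpc _] := ptP lp.
have [_ ok _] := K1 _ (mem_nth [::] la).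
have /hconsP /(_ p lp) [Pr _] := PW.
exact: (HB _ (ok _ lpc) _ Pr s ls).
Qed.

(** Pointedness is inherited from the target cells, row by row. The right-hand sides of the
    equations vanish because supporting functionals tight somewhere on a cone have bound 0 and the
    relevant gluings fix the origin. *)
Lemma hom_conical : k = Conical -> forall a, (a < size kept)%N ->
  kind_ok N Conical (hcons k U V (nth [::] kept a)).
Proof.
have [K1 _ _] := keptP; move=> kE a la; have [_ ok _] := K1 _ (mem_nth [::] la).
set f := nth _ _ _ in ok *.
have vk j : (j < ncell V)%N -> kind_ok E Conical (ineqs V j).
  by move=> lj; rewrite -kE; apply: (geo_kind_ok geo2 lj).
split=> [h hin|W P1 P2]; last first.
  apply: idx_ind => p s lp ls; have [lpc _] := ptP lp.
  have [_ pt] := vk _ (ok _ lpc).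
  have /hconsP /(_ p lp) [Q1 _] := P1; have /hconsP /(_ p lp) [Q2 _] := P2.
  exact: (pt _ Q1 Q2 s ls).
have [_ _ [W0 P0]] := K1 _ (mem_nth [::] la).
case: (hcons_cases hin) => [[p [h' [lp h'in ->]]]|[p [i [c [lp li gt [hc _] c2]]]]].
  have [lpc _] := ptP lp; have [h0 _] := vk _ (ok _ lpc); exact: (h0 _ h'in).
have [lpc _] := ptP lp.
suff c0 : c.2 = 0 by move: hc; rewrite !inE => /orP[/eqP ->|/eqP ->] //=; rewrite c0 oppr0.
set G := gluing _ _ _ in c2; have [h0 _] := vk _ (ok _ lpc).
have /hconsP /(_ p lp) [Prow /(_ i li gt) [tG _]] := P0.
have supp := geo_supp geo2 (ok _ lpc) (ok _ li).
have b0 : G.1.2 = 0 := cone_supp0 h0 supp Prow tG.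
case: c2 => [->//|[s ls ->]].
have [z az] := geo_ex geo2 (ok _ lpc) (cone0 E h0).
have t0 : tight E (fun=> 0) G.1 by rewrite /tight dotn0 b0.
have az' := geo_glue geo2 (ok _ li) az t0.
by rewrite (cone_glue0 geo2 kE az az' ls) oppr0.
Qed.

Lemma geometric_hom : geometric k (hom k U V) at_hom.
Proof.
have [K1 _ K3] := keptP.
have sz : ncell (hom k U V) = size kept by exact: fsizeE.
have inE_ a : ineqs (hom k U V) a = hcons k U V (nth [::] kept a).
  by rewrite /ineqs /= fnthE.
have glE a b : gluing (hom k U V) a b = hglue k U V (nth [::] kept a) (nth [::] kept b).
  by rewrite /gluing /= fnthE.
have dE : udim (hom k U V) = N by [].
have okK a : (a < size kept)%N -> choice_ok (nth [::] kept a).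
  by move=> la; have [] := K1 _ (mem_nth [::] la).
split; rewrite ?sz ?dE.
- by move=> a W g [].
- by move=> a la; rewrite inE_; have [] := K1 _ (mem_nth [::] la).
- by move=> a W g [_ []]; rewrite inE_.
- move=> a W la; rewrite inE_ => /(hat_ex geo1 geo2 cover1 (okK a la)) [g Hg].
  by exists g; split.
- by move=> a W g g' [_ H] [_ H']; apply: (hat_fun geo2 cover1 H H').
- by move=> a W W' g [la H] [_ H']; apply: (hat_inj geo1 geo2 (okK a la) H H').
- by move=> a W W' g [la H] e; split=> //; apply: (hat_ext geo2 H).
- move=> a b W la lb; rewrite inE_ glE; exact: (hglue_supp geo2 (okK a la) (okK b lb)).
- move=> a b W W' g [la H] [lb H']; rewrite glE.
  exact: (hglue_meet geo1 geo2 (okK a la) (okK b lb) H H').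
- move=> a b W g lb [la H]; rewrite glE => t; split=> //.
  exact: (hglue_glue geo1 geo2 (okK a la) (okK b lb) H t).
- move=> a h W0 la supp; rewrite inE_ in supp * => P0 t0.
  have [f' [sf' ok' f'E]] := hom_face (okK a la) supp P0 t0.
  have [g0 H0] := hat_ex geo1 geo2 cover1 (okK a la) P0.
  (* The choice given by [hom_face] may have been discarded as a repetition; its representative in
     [kept] describes the same maps. *)
  have [|f fk fE] := K3 f' g0 sf' ok'; first by apply/f'E; exists W0.
  have lf : (index f kept < size kept)%N by rewrite index_mem.
  exists (index f kept) => // g; split.
    move=> [W [_]]; rewrite nth_index // => H.
    have /f'E [W' H' t'] : Hs f' g by apply/fE; exists W.
    by exists W'.
  move=> [W [_ H] t]; have [W' H'] : Hs f g by apply/fE/f'E; exists W.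
  by exists W'; split=> //; rewrite nth_index.
have hb := hom_bounded; have hc := hom_conical.
move: hb hc inE_; case: (k) => hb hc inE_.
  by have [B HB] := hb erefl; exists B => a la W; rewrite inE_; apply: HB.
by move=> a la; rewrite inE_; apply: hc.
Qed.

End HomComplex.

Local Open Scope classical_set_scope.

(** * Encodings *)

Section Rows.
Variable R : realType.

Definition rowv (d : nat) (x : vec R) : 'rV[R]_d := \row_(j < d) x j.
Definition coords (d : nat) (x : 'rV[R]_d) : vec R := mx_fun x 0%N.

Lemma coordsE d (x : 'rV[R]_d) (j : 'I_d) : coords x j = x 0 j.
Proof. exact: (mx_funE x ord0 j). Qed.

Lemma coords_out d (x : 'rV[R]_d) j : (d <= j)%N -> coords x j = 0.
Proof. exact: mx_fun_out. Qed.

Lemma coordsK d (x : 'rV[R]_d) : rowv d (coords x) = x.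
Proof. by apply/rowP => j; rewrite mxE coordsE. Qed.

Lemma rowvK d (x : vec R) j : (j < d)%N -> coords (rowv d x) j = x j.
Proof. by move=> lt; rewrite (coordsE _ (Ordinal lt)) mxE. Qed.

Lemma rowv_eq d (x y : vec R) : (forall j, (j < d)%N -> x j = y j) <-> rowv d x = rowv d y.
Proof.
split=> [e|e j lt]; first by apply/rowP => j; rewrite !mxE e.
by rewrite -(rowvK x lt) e rowvK.
Qed.

Lemma dot_rowv d (c x : vec R) : dot (rowv d c) (rowv d x) = dotn d c x.
Proof. by rewrite dotnE /dot; apply: eq_bigr => j _; rewrite !mxE. Qed.

Lemma dot_coords d (c x : 'rV[R]_d) : dot c x = dotn d (coords c) (coords x).
Proof. by rewrite -{1}(coordsK c) -{1}(coordsK x) dot_rowv. Qed.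

Lemma sum_pad (d D : nat) (F : nat -> R) : (d <= D)%N ->
  (forall s, (d <= s < D)%N -> F s = 0) -> \sum_(s < D) F s = \sum_(s < d) F s.
Proof.
move=> le F0; rewrite -!(big_mkord xpredT) (big_cat_nat (leq0n d) le) /=.
by rewrite [X in _ + X]big_nat_cond [X in _ + X]big1 ?addr0 // => s; rewrite andbT => /F0.
Qed.

Lemma dotn_pad d D (c x : vec R) : (d <= D)%N -> (forall s, (d <= s < D)%N -> x s = 0) ->
  dotn D c x = dotn d c x.
Proof.
move=> le x0; rewrite !dotnE; apply: (sum_pad (F := fun s => c s * x s)) => // s /x0 ->.
by rewrite mulr0.
Qed.

Lemma bounded_coords d (A : set 'rV[R]_d) : bounded_set A <->
  exists B, forall x, A x -> forall j, `|x 0 j| <= B.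
Proof.
split=> [[M [Mreal H]]|[B HB]].
  exists (M + 1) => x Ax j; apply: le_trans (H (M + 1) _ x Ax); last by rewrite ltrDl.
  rewrite /= -[`|x|]/(mx_norm x) mx_normrE.
  exact: (le_bigmax _ (fun ij : 'I_1 * 'I_d => `|x ij.1 ij.2|) (0, j)).
exists `|B|; split; first exact: num_real.
move=> M lt x Ax; rewrite /= -[`|x|]/(mx_norm x) mx_normrE; apply: bigmax_le => [|[i j] _ /=].
  by apply: le_trans (ltW lt).
rewrite ord1; apply: le_trans (HB x Ax j) _; apply: le_trans (ltW lt); exact: ler_norm.
Qed.

End Rows.

(** An encoding may describe a cone by inequalities with nonzero right-hand sides. A linear form
    bounded above on a cone is nonpositive there, and the origin shows that the right-hand sides are
    nonnegative. *)
Lemma pointed_cone_ineqs (R : realType) d (P : set 'rV[R]_d) (hs : seq ('rV[R]_d * R)) :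
  is_pointed_cone P -> P = [set x | forall h, h \in hs -> dot h.1 x <= h.2] ->
  P = [set x | forall h, h \in hs -> dot h.1 x <= 0].
Proof.
move=> [[cs Pcs] _] Phs.
have dotZ c a (x : 'rV[R]_d) : dot c (a *: x) = a * dot c x.
  by rewrite /dot mulr_sumr; apply: eq_bigr => j _; rewrite mxE mulrCA.
have Pscale a x : 0 <= a -> P x -> P (a *: x).
  by rewrite Pcs => a0 Px c cin; rewrite dotZ mulr_ge0_le0 // Px.
apply/seteqP; split=> x /= Px.
  move=> h hin; rewrite leNgt; apply/negP => pos.
  (* Scaling by this factor gives the linear form the value [|h.2| + 1], which exceeds the bound
     [h.2]. *)
  have a0 : 0 <= (`|h.2| + 1) / dot h.1 x by rewrite divr_ge0 ?addr_ge0 ?normr_ge0 // ltW.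
  have := Pscale _ _ a0 Px; rewrite Phs => /(_ h hin); rewrite dotZ divfK ?gt_eqF //.
  have := ler_norm h.2; lra.
rewrite Phs => h hin; apply: le_trans (Px h hin) _.
have : P 0 by rewrite Pcs => c _; rewrite -(scale0r 0) dotZ mul0r.
by rewrite Phs => /(_ h hin); rewrite -(scale0r 0) dotZ mul0r.
Qed.

(** * From an encoded complex to coordinates padded to a common dimension *)

Section FromEncoding.
Variables (R : realType) (k : complex_kind) (X : Type).
Variables (Pi : polyhedral_complex R X) (c : den R complexT).
Hypotheses (kPi : of_kind k Pi) (encPi : encodes Pi c).
Local Notation U := (normalize k c).
Local Notation n := (nfaces Pi).
Local Notation D := (maxdim c).
Local Notation d := (adim Pi).

Lemma enc_size : ncell U = n.
Proof. by rewrite /ncell /= fsizeE; case: encPi. Qed.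

Lemma enc_dim (i : 'I_n) : cdim c i = d i.
Proof. by rewrite /cdim fnthE; have [_ /(_ i) [] ] := encPi. Qed.

Lemma enc_le (i : 'I_n) : (d i <= D)%N.
Proof.
have lt : (i < size c.1)%N by have [-> _ _] := encPi.
rewrite -enc_dim /cdim fnthE /maxdim; elim: c.1 (nat_of_ord i) lt => // P s IH [|m] lt /=.
  by rewrite faddE leq_addr.
by rewrite faddE; apply: leq_trans (IH m lt) _; rewrite leq_addl.
Qed.

Lemma enc_cell (i : 'I_n) : cell Pi i =
  [set x | all (fun h : den R halfspaceT => dot (vec_of (d i) h.1) x <= hrhs k h.2)
               (nth (0%N, [::]) c.1 i).2].
Proof.
have [_ /(_ i) [_ cE] _] := encPi.
case kE: k; first exact: cE.
have := kPi; rewrite kE => /(_ i) /= pcone.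
have allE (r : R -> R) : [set x : 'rV_(d i) | all (fun h : den R halfspaceT =>
      dot (vec_of (d i) h.1) x <= r h.2) (nth (0%N, [::]) c.1 i).2] =
    [set x | forall h, h \in [seq (vec_of (d i) (h : den R halfspaceT).1, h.2)
       | h <- (nth (0%N, [::]) c.1 i).2] -> dot h.1 x <= r h.2].
  apply/seteqP; split=> x /= => [/allP H h /mapP[h' hin ->]|H]; first exact: (H h' hin).
  by apply/allP => h hin; apply: (H (vec_of (d i) h.1, h.2)); apply/mapP; exists h.
rewrite (allE (fun=> 0)); apply: pointed_cone_ineqs => //.
by rewrite cE (allE id).
Qed.

Definition padded (i : 'I_n) (u : vec R) : Prop :=
  forall s, (d i <= s < D)%N -> u s = 0.

Lemma vec_ofE e (s : seq R) : vec_of e s = rowv e (nth 0 s).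
Proof. by []. Qed.

Lemma inP_normalize (i : 'I_n) u :
  inP D (ineqs U i) u <-> cell Pi i (rowv (d i) u) /\ padded i u.
Proof.
rewrite /ineqs /= /nineqs fcatE inP_cat !inP_all fmapE fbindE fiotaE all_flatten_map fnthE enc_dim.
have padE : all (fun s => all (sat D u) (if fltn s (d i) then [::] else eqc (delta R s, 0)))
    (iota 0 D) <-> padded i u.
  split=> [/all_iotaP H s /andP[le lt]|H].
    have := H s lt; rewrite fltnE; case: ltnP => [|_]; first by rewrite ltnNge le.
    by rewrite -inP_all inP_eqc /= dotn_delta // => /eqP.
  apply/all_iotaP => s lt; rewrite fltnE; case: ltnP => // le.
  by rewrite -inP_all inP_eqc /= dotn_delta // H // le.
have cellE : padded i u -> all (sat D u) [seq (fnth 0 (h : den R halfspaceT).1 : vec R, hrhs k h.2)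
      | h <- (nth (0%N, [::]) c.1 i).2] <-> cell Pi i (rowv (d i) u).
  move=> pad; rewrite enc_cell /= all_map.
  rewrite (eq_all (a2 := fun h : den R halfspaceT =>
    dot (vec_of (d i) h.1) (rowv (d i) u) <= hrhs k h.2)) // => h /=.
  by rewrite /sat /= fnthE (dotn_pad _ (enc_le i) pad) vec_ofE dot_rowv.
by split=> [/andP[H /padE pad]|[H pad]]; [split=> //; apply/cellE|rewrite (cellE pad).2 //; apply/padE].
Qed.

Definition at_of (i : nat) (u : vec R) (y : carrier Pi) : Prop :=
  exists i' : 'I_n, [/\ i = i', cell Pi i' (rowv (d i') u), padded i' u &
                       chart Pi i' (rowv (d i') u) = val y].

Lemma at_ofP (i : 'I_n) u y : at_of i u y <->
  [/\ cell Pi i (rowv (d i) u), padded i u & chart Pi i (rowv (d i) u) = val y].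
Proof. split=> [[j [/ord_inj e]]|[cu pu e]]; last by exists i.
by subst j. Qed.

Lemma chart_face (i : 'I_n) x : cell Pi i x -> face Pi i (chart Pi i x).
Proof. by have [H _ _] := chart_bij i; apply: H. Qed.

Lemma face_chart (i : 'I_n) z : face Pi i z -> exists2 x, cell Pi i x & chart Pi i x = z.
Proof. by have [_ _ H] := chart_bij i; move=> /H [x]; exists x. Qed.

Lemma chart_inj (i : 'I_n) x y : cell Pi i x -> cell Pi i y ->
  chart Pi i x = chart Pi i y -> x = y.
Proof. by have [_ H _] := chart_bij i; move=> cx cy; apply: H; rewrite inE. Qed.

Lemma coords_padded (i : 'I_n) (x : 'rV[R]_(d i)) : padded i (coords x).
Proof. by move=> s /andP[le _]; apply: coords_out. Qed.

Lemma img_face (i : 'I_n) (y : carrier Pi) : (exists u, at_of i u y) <-> face Pi i (val y).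
Proof.
split=> [[u /at_ofP [cu _ <-]]|/face_chart [x cx e]]; first exact: chart_face.
by exists (coords x); apply/at_ofP; rewrite coordsK; split=> //; apply: coords_padded.
Qed.

Lemma carrier_ex z (i : 'I_n) : face Pi i z -> exists y : carrier Pi, val y = z.
Proof. move=> H; have cz : carrier Pi z by exists i.
by exists (SigSub (mem_set cz)). Qed.

Lemma at_of_cover (y : carrier Pi) : exists i u, at_of i u y.
Proof.
have [i _ /img_face [u a]] := set_mem (valP y).
by exists i, u.
Qed.

Lemma enc_glue (i j : 'I_n) : let g := cgl c i j in
  let F := exposed (vec_of (d i) g.1.1.1) g.1.1.2 (cell Pi i) in
  [/\ supports (vec_of (d i) g.1.1.1) g.1.1.2 (cell Pi i),
      face Pi i `&` face Pi j = chart Pi i @` F &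
      forall x, F x -> let x' := x *m mx_of _ (d j) g.2.1 + vec_of _ g.2.2 in
        cell Pi j x' /\ chart Pi j x' = chart Pi i x].
Proof.
rewrite /cgl !fnthE; have [_ _ /(_ i j)] := encPi.
case: (nth _ _ _) => -[hF hG] [m t] /= [sF _ meetF _ H]; split=> // x Fx.
by have [[Gx _] e] := H x Fx.
Qed.

Lemma dotn_glue (i : 'I_n) (j : nat) u : padded i u ->
  dotn D (gluing U i j).1.1 u = dot (vec_of (d i) (cgl c i j).1.1.1) (rowv (d i) u).
Proof. by move=> pad; rewrite /gluing /= fnthE (dotn_pad _ (enc_le i) pad) vec_ofE dot_rowv. Qed.

Lemma rowv_gapply (i j : 'I_n) u : padded i u ->
  rowv (d j) (gapply D (gluing U i j) u) =
  rowv (d i) u *m mx_of _ (d j) (cgl c i j).2.1 + vec_of _ (cgl c i j).2.2.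
Proof.
move=> pad; apply/rowP => s; rewrite !mxE /gapply fsumE /= enc_dim fltnE ltn_ord.
rewrite fnthE; congr (_ + _); last by rewrite fnthE.
rewrite (sum_pad (F := fun r => u r * (fnth 0 (nth [::] (cgl c i j).2.1 r) s)) (enc_le i)).
  by apply: eq_bigr => r _; rewrite !mxE !fnthE.
by move=> r /pad ->; rewrite mul0r.
Qed.

Lemma gapply_padded (i : nat) (j : 'I_n) u : padded j (gapply D (gluing U i j) u).
Proof.
move=> s /andP[le _]; rewrite /gapply fsumE /= enc_dim fltnE ltnNge le /= addr0 big1 // => r _.
by rewrite mulr0.
Qed.

Lemma normalize_bounded : k = Polytopal -> exists B, forall i, (i < ncell U)%N ->
  forall u, inP D (ineqs U i) u -> forall s, (s < D)%N -> `|u s| <= B.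
Proof.
move=> kE; have bd (i : 'I_n) : exists B, forall x, cell Pi i x -> forall j, `|x 0 j| <= B.
  by apply/bounded_coords; have := kPi; rewrite kE => /(_ i) [].
have [B HB] := choice bd.
(* Starting the maximum at 0 makes it nonnegative, as the padding coordinates require. *)
exists (\big[Num.max/0]_(i < n) B i) => i; rewrite enc_size => li u.
move=> /(inP_normalize (Ordinal li)) [cu pad] s ls.
have [lt|ge] := ltnP s (d (Ordinal li)); last first.
  by rewrite pad ?ge // normr0 bigmax_idl le_max lexx.
apply: le_trans (le_bigmax _ B (Ordinal li)).
by have := HB _ _ cu (Ordinal lt); rewrite mxE.
Qed.

Lemma normalize_conical : k = Conical -> forall i, (i < ncell U)%N ->
  kind_ok D Conical (ineqs U i).
Proof.
move=> kE i; rewrite enc_size => li; split=> [h|u].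
  rewrite /ineqs /= /nineqs fcatE mem_cat fmapE fbindE => /orP[/mapP[h' _ ->]|/flatten_mapP[s _]].
    by rewrite kE.
  by case: ifP => // _; rewrite !inE => /orP[/eqP ->|/eqP ->] //=; rewrite oppr0.
move=> /(inP_normalize (Ordinal li)) [cu pad] /(inP_normalize (Ordinal li)) [cNu _] s ls.
have [lt|ge] := ltnP s (d (Ordinal li)); last by rewrite pad ?ge.
have := kPi; rewrite kE => /(_ (Ordinal li)) [_ /(_ _ cu)] pt.
have /rowP /(_ (Ordinal lt)) : rowv (d (Ordinal li)) u = 0.
  by apply: pt; rewrite (_ : - _ = rowv _ (fun j => - u j)) //; apply/rowP => j; rewrite !mxE.
by rewrite !mxE.
Qed.

Lemma geometric_normalize : geometric k U at_of.
Proof.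
have ordE i : (i < ncell U)%N -> exists i' : 'I_n, i = i'.
  by rewrite enc_size => li; exists (Ordinal li).
have udE : udim U = D by [].
split; rewrite ?udE.
- by move=> i u y [i' [-> _ _ _]]; rewrite enc_size.
- move=> _ /ordE[i ->]; have [z /face_chart[x cx _]] := face_nonempty i.
  by exists (coords x); apply/inP_normalize; rewrite coordsK; split=> //; apply: coords_padded.
- by move=> _ u y [i [-> cu pad _]]; apply/inP_normalize.
- move=> _ u /ordE[i ->] /inP_normalize [cu pad].
  have [y e] := carrier_ex (chart_face cu); exists y; exact/at_ofP.
- move=> _ u y y' [i [-> _ _ e]] /at_ofP [_ _ e']; apply: val_inj; by rewrite -e -e'.
- move=> _ u v y [i [-> cu pu eu]] /at_ofP [cv pv ev] s ls.
  have [lt|ge] := ltnP s (d i); last by rewrite pu ?pv ?ge.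
  by apply: (rowv_eq (d i) u v).2 lt; apply: chart_inj => //; rewrite eu ev.
- move=> _ u v y [i [-> cu pu eu]] e; apply/at_ofP.
  have -> : rowv (d i) v = rowv (d i) u.
    by apply/rowv_eq => s ls; rewrite e // (leq_trans ls) // enc_le.
  by split=> // s /andP[le lt]; rewrite -e // pu // le.
- move=> _ _ u /ordE[i ->] /ordE[j ->] /inP_normalize [cu pu].
  by rewrite dotn_glue //; have [sF _ _] := enc_glue i j; apply: sF.
- move=> _ _ u v y [i [-> cu pu eu]] [j [-> cv pv ev]].
  have [_ meetF _] := enc_glue i j; rewrite /tight dotn_glue //.
  have : (face Pi i `&` face Pi j) (val y).
    by split; [rewrite -eu|rewrite -ev]; apply: chart_face.
  by rewrite meetF => -[x [cx ex] e]; rewrite -(chart_inj cx cu (etrans e (esym eu))) ex.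
- move=> _ _ u y /ordE[j ->] [i [-> cu pu eu]]; rewrite /tight dotn_glue // => /eqP t.
  have [_ _ /(_ _ (conj cu t))] := enc_glue i j; rewrite -rowv_gapply // => -[cg eg].
  by apply/at_ofP; split=> //; [apply: gapply_padded|rewrite eg].
- move=> _ h u0 /ordE[i ->] supp /inP_normalize [cu0 pu0] t0.
  have dotE u : padded i u -> dotn D h.1 u = dot (rowv (d i) h.1) (rowv (d i) u).
    by move=> pad; rewrite (dotn_pad _ (enc_le i) pad) dot_rowv.
  have isF : is_face (cell Pi i) (exposed (rowv (d i) h.1) h.2 (cell Pi i)).
    exists (rowv (d i) h.1), h.2; split=> // x cx.
    rewrite -(coordsK x) -dotE; last exact: coords_padded.
    by apply: supp; apply/inP_normalize; rewrite coordsK; split=> //; apply: coords_padded.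
  have neF : exposed (rowv (d i) h.1) h.2 (cell Pi i) !=set0.
    by exists (rowv (d i) u0); split=> //; rewrite -dotE //; apply/eqP.
  have [l lE] := face_closed isF neF.
  exists l; first by rewrite enc_size.
  move=> y; rewrite img_face -lE; split=> [[x [cx ex] e]|[u /at_ofP [cu pu e] t]].
    exists (coords x); first by apply/at_ofP; rewrite coordsK; split=> //; apply: coords_padded.
    by rewrite /tight dotE ?coordsK ?ex //; apply: coords_padded.
  by exists (rowv (d i) u) => //; split=> //; rewrite -dotE //; apply/eqP.
have hb := normalize_bounded; have hc := normalize_conical.
by move: hb hc; case: (k) => hb hc; [apply: hb|apply: hc].
Qed.

End FromEncoding.

(** * From coordinates back to a polyhedral complex and its encoding *)

Section ToComplex.
Variables (R : realType) (k : complex_kind) (T : Type) (U : udata R).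
Variables (at_ : nat -> vec R -> T -> Prop).
Hypothesis geo : geometric k U at_.
Local Notation D := (udim U).
Local Notation n := (ncell U).
Hypothesis img_inj : forall a b, (a < n)%N -> (b < n)%N ->
  (forall y, img at_ a y <-> img at_ b y) -> a = b.

Definition gcell (i : 'I_n) : set 'rV[R]_D := [set x | inP D (ineqs U i) (coords x)].
Definition gface (i : 'I_n) : set T := img at_ i.

Lemma gface_nonempty i : gface i !=set0.
Proof.
have [u Pu] := geo_ne geo (ltn_ord i); have [y a] := geo_ex geo (ltn_ord i) Pu.
by exists y, u.
Qed.

(** A chart has to be a total function; outside the cell its value is an arbitrary point of the
    face, as [T] has no default element. *)
Definition gchart (i : 'I_n) (x : 'rV[R]_D) : T :=
  match pselect (exists y, at_ i (coords x) y) with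
  | left H => sval (cid H)
  | right _ => sval (cid (gface_nonempty i))
  end.

Lemma gchartE (i : 'I_n) x y : at_ i (coords x) y -> gchart i x = y.
Proof.
move=> a; rewrite /gchart; case: pselect => [H|[]]; last by exists y.
by apply: (geo_fun geo (svalP (cid H)) a).
Qed.

Lemma gchartP i x : gcell i x -> at_ i (coords x) (gchart i x).
Proof. by move=> /(geo_ex geo (ltn_ord i)) [y a]; rewrite (gchartE a). Qed.

Lemma at_coords i u y : at_ i u y -> at_ i (coords (rowv D u)) y.
Proof. by move=> a; apply: (geo_ext geo a) => s ls; rewrite rowvK. Qed.

Lemma at_gcell (i : 'I_n) x y : at_ i (coords x) y -> gcell i x.
Proof. exact: (geo_in geo). Qed.

Lemma gface_inj : injective gface.
Proof.
by move=> i j e; apply/ord_inj/img_inj => // y; rewrite -/(gface i y) e.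
Qed.

Definition row_ineqs (hs : seq (con R)) : seq ('rV[R]_D * R) :=
  [seq (rowv D h.1, h.2) | h <- hs].

Lemma dot_rowv_coords (c : vec R) (x : 'rV[R]_D) : dot (rowv D c) x = dotn D c (coords x).
Proof. by rewrite -{1}(coordsK x) dot_rowv. Qed.

Lemma gcellE i : gcell i = [set x | forall h, h \in row_ineqs (ineqs U i) -> dot h.1 x <= h.2].
Proof.
apply/seteqP; split=> x /=.
  by move=> /inPP H _ /mapP[h hin ->] /=; rewrite dot_rowv_coords; apply: H.
move=> H; apply/inPP => h hin; rewrite -dot_rowv_coords.
by apply: (H (rowv D h.1, h.2)); apply/mapP; exists h.
Qed.

Lemma gcell_polyhedron i : is_polyhedron (gcell i).
Proof. by exists (row_ineqs (ineqs U i)); apply: gcellE. Qed.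

Lemma gchart_bij i : set_bij (gcell i) (gface i) (gchart i).
Proof.
split.
- by move=> x /gchartP a; exists (coords x).
- move=> x y; rewrite !inE => /gchartP ax /gchartP ay e.
  rewrite -(coordsK x) -(coordsK y); apply/rowv_eq.
  by rewrite e in ax; apply: (geo_inj geo ax ay).
- move=> y [u a]; have a' := at_coords a; exists (rowv D u); [exact: at_gcell a'|exact: gchartE].
Qed.

Lemma gface_closed i (F : set 'rV[R]_D) :
  is_face (gcell i) F -> F !=set0 -> exists j, gchart i @` F = gface j.
Proof.
move=> [c [b [supp ->]]] [x0 [c0 e0]].
have [u|||l ll lE] := @geo_face _ _ _ _ _ geo i (coords c, b) (coords x0) (ltn_ord i).
- move=> Pu; rewrite /= -(dotn_ext _ (x := coords (rowv D u))) => [|j]; last exact: rowvK.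
  rewrite -dot_coords; apply: supp; rewrite /gcell /=.
  by rewrite (inP_ext _ (y := u)) // => j; apply: rowvK.
- exact: c0.
- by rewrite /tight /= -dot_coords e0.
exists (Ordinal ll); apply/seteqP; split=> y /=.
  move=> [x [cx ex] <-]; apply/lE; exists (coords x); first exact: gchartP.
  by rewrite /tight /= -dot_coords ex.
move=> /lE [u a t]; have a' := at_coords a; exists (rowv D u); last exact: gchartE.
split; first exact: at_gcell a'.
rewrite dot_coords; apply: etrans (eqP t); apply: dotn_ext => j; exact: rowvK.
Qed.

Definition gexposed (i j : 'I_n) : set 'rV[R]_D :=
  exposed (rowv D (gluing U i j).1.1) (gluing U i j).1.2 (gcell i).

Definition gmx (i j : 'I_n) : 'M[R]_D := \matrix_(r < D, s < D) (gluing U i j).2.1 r s.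

Definition gmap (i j : 'I_n) (x : 'rV[R]_D) : 'rV[R]_D :=
  x *m gmx i j + rowv D (gluing U i j).2.2.

Lemma gmapE i j x : gmap i j x = rowv D (gapply D (gluing U i j) (coords x)).
Proof.
apply/rowP => s; rewrite !mxE /gapply fsumE; congr (_ + _).
by apply: eq_bigr => r _; rewrite mxE coordsE.
Qed.

Lemma gexposedP i j x : gexposed i j x <->
  gcell i x /\ tight D (coords x) (gluing U i j).1.
Proof. by rewrite /gexposed /exposed /= dot_rowv_coords; split=> -[cx /eqP]. Qed.

Lemma gsupports (i j : 'I_n) : supports (rowv D (gluing U i j).1.1) (gluing U i j).1.2 (gcell i).
Proof. by move=> x cx; rewrite dot_rowv_coords; apply: (geo_supp geo). Qed.

Lemma gexposed_face i j : is_face (gcell i) (gexposed i j).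
Proof. by exists (rowv D (gluing U i j).1.1), (gluing U i j).1.2; split; first exact: gsupports. Qed.

Lemma gmeet i j : gface i `&` gface j = gchart i @` gexposed i j.
Proof.
apply/seteqP; split=> y.
  move=> [[u a] [v b]]; have a' := at_coords a; exists (rowv D u); last exact: gchartE.
  by apply/gexposedP; split; [apply: at_gcell a'|apply: (geo_meet geo a' b)].
move=> [x /gexposedP [cx t] <-]; have a := gchartP cx; split; first by exists (coords x).
by eexists; apply: (geo_glue geo (ltn_ord j) a t).
Qed.

Lemma gmapP i j x : gexposed i j x ->
  gexposed j i (gmap i j x) /\ gchart j (gmap i j x) = gchart i x.
Proof.
move=> /gexposedP [cx t]; have a := gchartP cx.
have b := at_coords (geo_glue geo (ltn_ord j) a t); rewrite -gmapE in b.
split; last exact: gchartE.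
by apply/gexposedP; split; [apply: at_gcell b|apply: (geo_meet geo b a)].
Qed.

(** Both gluings preserve the represented point, and the chart is injective on the cell. *)
Lemma gmapK i j x : gexposed i j x -> gmap j i (gmap i j x) = x.
Proof.
move=> ex; have [ex' e] := gmapP ex; have [ex'' e'] := gmapP ex'.
have [_ inj _] := gchart_bij i; apply: inj; rewrite ?inE; last by rewrite e' e.
  by case: ex''.
by case: ex.
Qed.

Lemma gaffine_iso i j : affine_iso (gexposed i j) (gexposed j i) (gmap i j).
Proof.
split.
- split.
  + by move=> x /gmapP [].
  + by move=> x y; rewrite !inE => ex ey e; rewrite -(gmapK ex) e gmapK.
  + by move=> y ey; exists (gmap j i y); [case: (gmapP ey)|apply: gmapK].
- by exists (gmx i j), (rowv D (gluing U i j).2.2).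
- exists (gmap j i); split; last by move=> x; apply: gmapK.
  by exists (gmx j i), (rowv D (gluing U j i).2.2).
Qed.

Lemma gface_meet i j : exists (F : set 'rV[R]_D) (G : set 'rV[R]_D),
  [/\ is_face (gcell i) F, is_face (gcell j) G,
      gface i `&` gface j = gchart i @` F, gface i `&` gface j = gchart j @` G &
      exists g, affine_iso F G g /\ (forall x, F x -> gchart j (g x) = gchart i x)].
Proof.
exists (gexposed i j), (gexposed j i); split.
- exact: gexposed_face.
- exact: gexposed_face.
- exact: gmeet.
- by rewrite setIC gmeet.
- by exists (gmap i j); split; [apply: gaffine_iso|move=> x /gmapP []].
Qed.

Definition complex_of : polyhedral_complex R T :=
  @PolyhedralComplex R T n gface (fun=> D) gcell gchart gface_inj gface_nonempty
    gcell_polyhedron gchart_bij gface_closed gface_meet.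

Lemma complex_of_kind : of_kind k complex_of.
Proof.
have := geo_kind geo; case: (k) => [[B HB] i|H i].
  split; first exact: gcell_polyhedron.
  apply/bounded_coords; exists B => x cx j.
  by have := HB i (ltn_ord i) _ cx j (ltn_ord j); rewrite coordsE.
have [h0 pt] := H i (ltn_ord i); split.
  exists [seq rowv D h.1 | h <- ineqs U i]; rewrite /= gcellE; apply/seteqP; split=> x /= Hx.
    move=> _ /mapP[h hin ->]; rewrite -(h0 h hin).
    by apply: (Hx (rowv D h.1, h.2)); apply/mapP; exists h.
  by move=> _ /mapP[h hin ->] /=; rewrite h0 //; apply: Hx; apply/mapP; exists h.
move=> x /= Px PNx; rewrite -(coordsK x); apply/rowP => j; rewrite !mxE.
apply: pt => //; rewrite -(inP_ext _ (x := coords (- x))) // => s ls.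
by rewrite -[s]/(nat_of_ord (Ordinal ls)) !coordsE mxE.
Qed.

Lemma nth_flist m (x : vec R) j : (j < m)%N -> nth 0 (flist m x) j = x j.
Proof. by move=> lt; rewrite /flist fmapE fiotaE (nth_map 0%N) ?size_iota // nth_iota. Qed.

Lemma vec_of_flist m (x : vec R) : vec_of m (flist m x) = rowv m x.
Proof. by apply/rowP => j; rewrite !mxE nth_flist. Qed.

Lemma nth_fmap_iota (S : Type) (s0 : S) m (f : nat -> S) j : (j < m)%N ->
  nth s0 (fmap f (fiota m)) j = f j.
Proof. by move=> lt; rewrite fmapE fiotaE (nth_map 0%N) ?size_iota // nth_iota. Qed.

Lemma mx_of_flist a b m p (f : nat -> vec R) : (a <= m)%N -> (b <= p)%N ->
  mx_of a b (fmap (fun r => flist p (f r)) (fiota m)) = \matrix_(r < a, s < b) f r s.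
Proof.
move=> la lb; apply/matrixP => r s; rewrite !mxE nth_fmap_iota ?(leq_trans _ la) //.
by rewrite nth_flist // (leq_trans _ lb).
Qed.

Lemma encodes_complex_of : encodes complex_of (encode U).
Proof.
split=> [|i|i j].
- by rewrite /encode /= fmapE fiotaE size_map size_iota.
- rewrite /encode [nth _ _ _]nth_fmap_iota //=; split=> //.
  apply/seteqP; split=> x /=; rewrite /gcell /= inP_all fmapE all_map => H;
    apply: etrans H; [symmetry|]; apply: eq_all => h /=;
    by rewrite vec_of_flist dot_rowv_coords.
- rewrite /encode [nth [::] _ _]nth_fmap_iota // [nth _ _ _]nth_fmap_iota //=.
  rewrite !vec_of_flist; split.
  + exact: gsupports.
  + exact: gsupports.
  + exact: gmeet.
  + by rewrite setIC; apply: gmeet.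
  + by move=> x ex; rewrite mx_of_flist //; apply: gmapP.
Qed.

End ToComplex.

(** * Existence of encodings *)

Section Encoding.
Variable R : realType.

Definition list_of d (v : 'rV[R]_d) : seq R := [seq v 0 j | j <- enum 'I_d].

Lemma list_ofK d (v : 'rV[R]_d) : vec_of d (list_of v) = v.
Proof.
apply/rowP => j; rewrite mxE /list_of (nth_map j) ?size_enum_ord //.
by rewrite nth_ord_enum.
Qed.

Lemma nth_enum_map (S : Type) (s0 : S) n (f : 'I_n -> S) (i : 'I_n) :
  nth s0 [seq f j | j <- enum 'I_n] i = f i.
Proof. by rewrite (nth_map i) ?size_enum_ord // nth_ord_enum. Qed.

Lemma mx_listK d e (M : 'M[R]_(d, e)) :
  mx_of d e [seq list_of (row i M) | i <- enum 'I_d] = M.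
Proof.
apply/matrixP => r s; rewrite mxE nth_enum_map.
by have /rowP /(_ s) := list_ofK (row r M); rewrite !mxE.
Qed.

(** This reduces the existence of the complex of maps, in which no encoding is given, to the
    algorithmic statement. *)
Lemma encoding_exists (X : Type) (Pi : polyhedral_complex R X) : exists c, encodes Pi c.
Proof.
have [hs hsE] : exists hs : 'I_(nfaces Pi) -> den R (List halfspaceT), forall i,
    cell Pi i = [set x | all (fun h => dot (vec_of _ h.1) x <= h.2) (hs i)].
  have Hi i : exists hs : den R (List halfspaceT),
      cell Pi i = [set x | all (fun h : den R halfspaceT => dot (vec_of _ h.1) x <= h.2) hs].
    have [hs ->] := @cell_polyhedron _ _ Pi i; exists [seq (list_of h.1, h.2) | h <- hs].
    apply/seteqP; split=> x /=; rewrite all_map.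
      by move=> H; apply/allP => h hin /=; rewrite list_ofK; apply: H.
    by move=> /allP H h /H /=; rewrite list_ofK.
  by have [hs H] := choice Hi; exists hs.
pose ok i j (g : den R gluingT) :=
  let: (hF, hG, (m, t)) := g in
  let F := exposed (vec_of (adim Pi i) hF.1) hF.2 (cell Pi i) in
  let G := exposed (vec_of (adim Pi j) hG.1) hG.2 (cell Pi j) in
  [/\ supports (vec_of (adim Pi i) hF.1) hF.2 (cell Pi i),
      supports (vec_of (adim Pi j) hG.1) hG.2 (cell Pi j),
      face Pi i `&` face Pi j = chart Pi i @` F,
      face Pi i `&` face Pi j = chart Pi j @` G &
      forall x, F x -> let x' := x *m mx_of _ _ m + vec_of _ t in
        G x' /\ chart Pi j x' = chart Pi i x].
have [gl glE] : exists gl : 'I_(nfaces Pi) * 'I_(nfaces Pi) -> den R gluingT,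
    forall ij, ok ij.1 ij.2 (gl ij).
  have Hij ij : exists g, ok ij.1 ij.2 g.
    case: ij => i j /=; have [F [G [[cF [bF [sF FE]]] [cG [bG [sG GE]]] mF mG]]] := @face_meet _ _ Pi i j.
    move=> [g [[[gFG _ _] [M [t gE]] _] gchart]].
    exists (((list_of cF, bF), (list_of cG, bG)),
            ([seq list_of (row r M) | r <- enum 'I_(adim Pi i)], list_of t)).
    rewrite /ok !list_ofK mx_listK -FE -GE; split=> // x Fx /=.
    by rewrite -gE //; split; [apply: gFG|apply: gchart].
  by have [gl H] := choice Hij; exists gl.
exists ([seq (adim Pi i, hs i) | i <- enum 'I_(nfaces Pi)],
   [seq [seq gl (i, j) | j <- enum 'I_(nfaces Pi)] | i <- enum 'I_(nfaces Pi)]); split.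
- by rewrite /= size_map size_enum_ord.
- by move=> i; rewrite [nth _ _ _]nth_enum_map.
- by move=> i j; rewrite [nth [::] _ _]nth_enum_map [nth _ _ _]nth_enum_map; apply: (glE (i, j)).
Qed.

End Encoding.

(** * The complex of affine maps and the correctness of its computed encoding *)

Section HomEncoding.
Variables (k : complex_kind) (R : realType) (X1 X2 : Type).
Variables (Pi1 : polyhedral_complex R X1) (Pi2 : polyhedral_complex R X2).
Variables (c1 c2 : den R complexT).
Hypotheses (k1 : of_kind k Pi1) (k2 : of_kind k Pi2).
Hypotheses (e1 : encodes Pi1 c1) (e2 : encodes Pi2 c2).
Local Notation U := (normalize k c1).
Local Notation V := (normalize k c2).
Local Notation D := (maxdim c1).
Local Notation E := (maxdim c2).
Local Notation at1 := (@at_of R X1 Pi1 c1).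
Local Notation at2 := (@at_of R X2 Pi2 c2).

Let geo1 : geometric k U at1 := geometric_normalize k1 e1.
Let geo2 : geometric k V at2 := geometric_normalize k2 e2.
Let cover1 := @at_of_cover R X1 Pi1 c1.
Let geoH := geometric_hom geo1 geo2 cover1.

Lemma hom_img_inj a b : (a < ncell (hom k U V))%N -> (b < ncell (hom k U V))%N ->
  (forall g, img (at_hom k U V at1 at2) a g <-> img (at_hom k U V at1 at2) b g) -> a = b.
Proof. rewrite /ncell /= fsizeE; exact: (at_hom_inj geo1 geo2 cover1). Qed.

Definition hom_complex : polyhedral_complex R (carrier Pi1 -> carrier Pi2) :=
  complex_of geoH hom_img_inj.

Lemma haffE (A : nat -> vec R) u s : haff k U A u s =
  \sum_(r < D) u r * A r s + hconst R k * A D s.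
Proof.
rewrite /haff big_ord_recr /= /homv /= fltnE ltnn; congr (_ + _).
by apply: eq_bigr => r _; rewrite fltnE ltn_ord.
Qed.

(** Matrices on the padded coordinates and on the ambient spaces of the charts correspond to each
    other by truncation and by padding with zeros. *)
Lemma mor_morphism (g : carrier Pi1 -> carrier Pi2) (i : 'I_(nfaces Pi1)) (j : 'I_(nfaces Pi2)) :
  mor k U at1 at2 g i j <->
  (forall y : carrier Pi1, face Pi1 i (val y) -> face Pi2 j (val (g y))) /\
  exists phi, morphism_on k (cell Pi1 i) phi /\
    forall u (y : carrier Pi1), cell Pi1 i u -> val y = chart Pi1 i u ->
      cell Pi2 j (phi u) /\ chart Pi2 j (phi u) = val (g y).
Proof.
have at1_coords (u : 'rV_(adim Pi1 i)) (y : carrier Pi1) :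
    cell Pi1 i u -> val y = chart Pi1 i u -> at1 i (coords u) y.
  by move=> cu e; apply/at_ofP; rewrite coordsK; split=> //; apply: coords_padded.
split=> [[A HA]|[sub [phi [mphi Hphi]]]].
  split=> [y /(img_face c1 i) [u /HA a]|]; first by apply/(img_face c2 j); exists (haff k U A u).
  pose M : 'M[R]_(adim Pi1 i, adim Pi2 j) := \matrix_(r, s) A r s.
  pose t : 'rV[R]_(adim Pi2 j) := \row_s (hconst R k * A D s).
  exists (fun u => u *m M + t); split.
    case kE: k => /=; first by exists M, t.
    by exists M => x _; rewrite (_ : t = 0) ?addr0 //; apply/rowP => s; rewrite !mxE kE mul0r.
  move=> u y cu ey; have /at_ofP [cg _ eg] := HA _ _ (at1_coords u y cu ey).
  suff <- : rowv (adim Pi2 j) (haff k U A (coords u)) = u *m M + t by [].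
  apply/rowP => s; rewrite !mxE haffE; congr (_ + _).
  rewrite (sum_pad (F := fun r => coords u r * A r s) (enc_le e1 i)).
    by apply: eq_bigr => r _; rewrite mxE coordsE.
  by move=> r /andP[le _]; rewrite coords_out // mul0r.
have [M [t [pE t0]]] : exists M t, (forall x, cell Pi1 i x -> phi x = x *m M + t) /\
    (k = Conical -> t = 0).
  move: mphi; case kE: k; first by move=> [M [t H]]; exists M, t.
  by move=> [M H]; exists M, 0; split=> // x /H; rewrite addr0.
exists (fun r s => if r == D then mx_fun t 0 s else mx_fun M r s) => u y /at_ofP [cu pu eu].
have [cphi ephi] := Hphi _ _ cu (esym eu).
have hE s : haff k U (fun r s => if r == D then mx_fun t 0 s else mx_fun M r s) u s =
    coords (phi (rowv (adim Pi1 i) u)) s.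
  rewrite haffE eqxx pE //.
  have -> : hconst R k * mx_fun t 0 s = mx_fun t 0 s.
    case kE: k; rewrite ?mul1r // mul0r t0 //.
    by rewrite /mx_fun; case: insub => // ?; case: insub => // ?; rewrite mxE.
  have [lt|ge] := ltnP s (adim Pi2 j); last first.
    rewrite coords_out // [X in _ + X]mx_fun_out // addr0 big1 // => r _.
    by rewrite ltn_eqF // mx_fun_out // mulr0.
  rewrite -[s]/(nat_of_ord (Ordinal lt)) coordsE !mxE (mx_funE t ord0).
  congr (_ + _); under eq_bigr => r _ do rewrite ltn_eqF //.
  rewrite (sum_pad (F := fun r => u r * mx_fun M r (Ordinal lt)) (enc_le e1 i)).
    by apply: eq_bigr => r _; rewrite mxE mx_funE.
  by move=> r /pu ->; rewrite mul0r.
apply/at_ofP.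
have -> : rowv (adim Pi2 j) (haff k U (fun r s => if r == D then mx_fun t 0 s else mx_fun M r s) u) =
    phi (rowv (adim Pi1 i) u).
  by apply/rowP => s; rewrite mxE hE coordsE.
by split=> // s /andP[le _]; rewrite hE coords_out.
Qed.

Lemma carrier_hom_complex : carrier hom_complex = affine_maps k Pi1 Pi2.
Proof.
apply/seteqP; split=> g.
  move=> [h _ /= [W aW]] i.
  have /(hom_cover geo1 geo2 cover1) : exists a W, at_hom k U V at1 at2 a W g by exists h, W.
  move=> /(_ i); rewrite (enc_size k e1) => /(_ (ltn_ord i)) [j].
  rewrite (enc_size k e2) => lj /(mor_morphism g i (Ordinal lj)) m; by exists (Ordinal lj).
move=> H; have /(hom_cover geo1 geo2 cover1) [a [W aW]] : forall i, (i < ncell U)%N ->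
    exists2 j, (j < ncell V)%N & mor k U at1 at2 g i j.
  move=> i; rewrite (enc_size k e1) => li; have [j Hj] := H (Ordinal li).
  by exists j; [rewrite (enc_size k e2)|apply/(mor_morphism g (Ordinal li) j)].
have la := geo_lt geoH aW.
by exists (Ordinal la) => //; exists W.
Qed.

Lemma encodes_hom_complex : encodes_hom hom_complex (hom_program k (c1, c2)).
Proof.
split; first exact: encodes_complex_of.
move=> h i; have [K1 _ _] := keptP geo1 geo2 cover1.
have lh : (h < size (kept k U V))%N by rewrite -fsizeE; apply: ltn_ord.
set f := nth [::] (kept k U V) h.
have [_ ok _] : [/\ size f = ncell U, choice_ok U V f & _] := K1 _ (mem_nth [::] lh).
have li : (i < ncell U)%N by rewrite (enc_size k e1).
have lj : (nth 0%N f i < nfaces Pi2)%N by rewrite -(enc_size k e2); apply: ok.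
have -> : nth (0%N, [::]) (nth [::] (hom_program k (c1, c2)).2 h) i =
    (nth 0%N f i, hom_coefs k U V i).
  rewrite /hom_program /= /hom_charts [fmap _ (kept _ _ _)]fmapE.
  rewrite (nth_map [::]) // [nth _ _ _]nth_fmap_iota //.
  by rewrite fnthE.
exists (Ordinal lj); split=> // x u y cx cu ey.
have [_ /(_ i (coords u) y) Hf] : hat k U V at1 at2 f (coords x) (chart hom_complex h x).
  by have [] := gchartP geoH cx.
have a1 : at1 i (coords u) y.
  by apply/at_ofP; rewrite coordsK; split=> //; apply: coords_padded.
have /(at_ofP c2 (Ordinal lj)) [ca _ ea] := Hf a1.
have final z : z = rowv _ (fval k U V (coords x) i (coords u)) ->
    cell Pi2 (Ordinal lj) z /\ chart Pi2 (Ordinal lj) z = val (chart hom_complex h x y).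
  by move=> ->.
apply: final; apply/rowP => s.
have ls : (s < E)%N := leq_trans (ltn_ord s) (enc_le e2 _).
(* The constant coefficient is a pair of empty lists, which are read as zeros. *)
rewrite [mx_of _ _ _](_ : _ = 0); last by apply/matrixP => ? ?; rewrite !mxE !nth_nil.
rewrite [vec_of _ _](_ : _ = 0); last by apply/rowP => ?; rewrite !mxE nth_nil.
rewrite !add0r mulmx_sumr -big_split /= summxE.
(* The contribution of the coordinate [a] of the map to the entry [s] of its value at [u]: only
   coordinates recording the entry [s] of some generator count. *)
pose w (a : nat) : R := if (fdivmod E a).2 == s then lamv k U i (coords u) (fdivmod E a).1 else 0.
transitivity (\sum_(a < hdim k U V) coords x a * w a).
  apply: eq_bigr => a _; rewrite -scalemxAr -scalerDr mxE coordsE; congr (_ * _).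
  rewrite nth_fmap_iota // mx_of_flist ?enc_le //= mxE [vec_of _ _ _ _]mxE nth_flist // feqnE.
  rewrite /w mxE lamvE big_ord_recr /= /homv fltnE ltnn.
  rewrite -/V -/U; change (udim V) with E; change (udim U) with D.
  case: (boolP ((fdivmod E a).2 == s)) => [/eqP e|/negPf ne]; last first.
    by rewrite addr0 big1 // => r _; rewrite !mxE feqnE ne mulr0.
  congr (_ + _); under [RHS]eq_bigr => r _ do rewrite fltnE ltn_ord.
  rewrite (sum_pad (F := fun r => coords u r * lamx k U i r (fdivmod E a).1) (enc_le e1 i)).
    by apply: eq_bigr => r _; rewrite !mxE feqnE e eqxx coordsE.
  by move=> r /andP[le _]; rewrite coords_out // mul0r.
have sumE (F : vec R) :
    \sum_(a < hdim k U V) F a = \sum_(p < npt k U) \sum_(s' < E) F (p * E + s')%N.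
  by rewrite /hdim fmulE flat_sum.
rewrite (sumE (fun a => coords x a * w a)) mxE /fval; apply: eq_bigr => p _.
rewrite (bigD1 (Ordinal ls)) //= big1 ?addr0 => [|s' ne].
  by rewrite /w fdivmodMD //= eqxx mulrC.
rewrite /w fdivmodMD //=; case: eqP => [e|]; last by rewrite mulr0.
by case/eqP: ne; apply: val_inj.
Qed.

End HomEncoding.

Theorem theorem5p1 (k : complex_kind) :
  exists A : algorithm (Prod complexT complexT) homT,
  forall (R : realType) (X1 X2 : Type)
         (Pi1 : polyhedral_complex R X1) (Pi2 : polyhedral_complex R X2),
  of_kind k Pi1 -> of_kind k Pi2 ->
  (exists Pi : polyhedral_complex R (carrier Pi1 -> carrier Pi2),
     of_kind k Pi /\ carrier Pi = affine_maps k Pi1 Pi2)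
  /\
  (forall (c1 c2 : den R complexT), encodes Pi1 c1 -> encodes Pi2 c2 ->
   exists (Pi : polyhedral_complex R (carrier Pi1 -> carrier Pi2))
          (c : den R homT),
     [/\ of_kind k Pi, carrier Pi = affine_maps k Pi1 Pi2,
         computes A (R := R) (c1, c2) c & encodes_hom Pi c]).
Proof.
exists (hom_algorithm k) => R X1 X2 Pi1 Pi2 k1 k2.
have main c1 c2 : encodes Pi1 c1 -> encodes Pi2 c2 ->
    exists (Pi : polyhedral_complex R (carrier Pi1 -> carrier Pi2)) (c : den R homT),
      [/\ of_kind k Pi, carrier Pi = affine_maps k Pi1 Pi2,
          computes (hom_algorithm k) (R := R) (c1, c2) c & encodes_hom Pi c].
  move=> e1 e2; exists (hom_complex k1 k2 e1 e2), (hom_program k (c1, c2)); split.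
  - exact: complex_of_kind.
  - exact: carrier_hom_complex.
  - exact: hom_algorithmP.
  - exact: encodes_hom_complex.
split; last exact: main.
have [c1 e1] := encoding_exists Pi1; have [c2 e2] := encoding_exists Pi2.
by have [Pi [c [kPi cPi _ _]]] := main c1 c2 e1 e2; exists Pi.
Qed.
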